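(* Let $X$ be a smooth complex surface and let $w\in H^0(X,S^2\Omega^1_X)$ be a symmetric differential of rank 2. Set $P_2w=\det(w)^2R^{\mathbb{C}}w$, where $R^{\mathbb C}$ is the complexified Gaussian curvature operator. Then the nonlinear differential operator $$P_2:H^0(X,S^2\Omega^1_X)\to H^0(X,4K_X)$$ is such that $w$ is closed if and only if $P_2w=0$. Moreover, $P_2w=0$ implies that $w$ is of the 1st kind on $X\setminus D_w$, where $D_w$ is the degeneracy locus of $w$.
   Context: Manifolds are connected. Locally write $w|_U=a_{11}dz_1^2+a_{12}dz_1dz_2+a_{22}dz_2^2$ with $a_{ij}\in\mathcal{O}(U)$. Then $\det(w)$ is the section of $2K_X$ given locally by $\det(w)=a_{11}a_{22}-\frac14a_{12}^2$. The operator $R^{\mathbb{C}}$ is the complexification of the Gaussian curvature operator for Riemannian metrics on real surfaces (replace $\partial/\partial x_i$ by $\partial/\partial z_i$); it sends $w$ (of rank 2) to a meromorphic function, given locally by the Brioschi formula $$R^{\mathbb{C}}w|_U=\frac{1}{\det(w)^2}\left[\begin{vmatrix}-\frac12\left(\frac{\partial^2a_{11}}{\partial z_2^2}+\frac{\partial^2a_{22}}{\partial z_1^2}-\frac{\partial^2a_{12}}{\partial z_1\partial z_2}\right)&\frac12\frac{\partial a_{11}}{\partial z_1}&\frac12\left(\frac{\partial a_{12}}{\partial z_1}-\frac{\partial a_{11}}{\partial z_2}\right)\\ \frac12\left(\frac{\partial a_{12}}{\partial z_2}-\frac{\partial a_{22}}{\partial z_1}\right)&a_{11}&\frac12a_{12}\\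 \frac12\frac{\partial a_{22}}{\partial z_2}&\frac12a_{12}&a_{22}\end{vmatrix}-\begin{vmatrix}0&\frac12\frac{\partial a_{11}}{\partial z_2}&\frac12\frac{\partial a_{22}}{\partial z_1}\\ \frac12\frac{\partial a_{11}}{\partial z_2}&a_{11}&\frac12a_{12}\\ \frac12\frac{\partial a_{22}}{\partial z_1}&\frac12a_{12}&a_{22}\end{vmatrix}\right].$$ Thus $P_2w$ is locally the bracketed expression (times $(dz_1\wedge dz_2)^{\otimes 4}$), which also makes sense when $\det(w)\equiv0$. Rank: $w$ has rank 2 if at a general point $x$ the form $w(x)$ is a product of two linearly independent linear forms on $T_xX$. Degeneracy locus: $D_w$ is the set of points $x$ such that $w(x)=0$ or $w(x)$ defines fewer than two distinct lines in $T_xX$ (equivalently $\det(w)(x)=0$). A holomorphic exact decomposition of $w$ at $x$ is an equality $w|_{U_x}=df_1\,df_2$ on a neighborhood $U_x$ of $x$ with $f_1,f_2\in\mathcal{O}(U_x)$. The differential $w$ is closed if it has a holomorphic exact decomposition at a general point of $X$ (i.e. at every point outside some proper closed analytic subset), and closed of the 1st kind on an open set if it has a holomorphic exact decomposition at every point of that set. *)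

(* Defs.v *)
From HB Require Import structures.
From mathcomp Require Import all_boot all_order all_algebra.
From mathcomp Require Import complex.
From mathcomp Require Import all_classical all_reals all_analysis.

Set Implicit Arguments.
Unset Strict Implicit.
Unset Printing Implicit Defensive.

Import Order.TTheory GRing.Theory Num.Theory.
Import numFieldNormedType.Exports.

Local Open Scope classical_set_scope.
Local Open Scope ring_scope.

(* Naming the numClosedFieldType structure gives R[i] its canonical topology
   and its structure of normed module over itself. *)
Definition Cplx (R : realType) : numClosedFieldType := R[i].

Notation C2 R := 'rV[Cplx R]_2.

(* [differentiable] over the scalar field C is complex differentiability;
   on an open set O it is holomorphy. *)
Definition holomorphic_on (R : realType) (W : normedModType (Cplx R))
    (O : set (C2 R)) (f : C2 R -> W) : Prop :=
  forall z, O z -> differentiable f z.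

(* The atlas is indexed by the type [chart].  [chart_map a] and its inverse
   [chart_inv a] carry no meaning outside [chart_dom a] and
   [chart_map a @` chart_dom a]. *)
Record complex_surface (R : realType) := ComplexSurface {
  surface_space :> topologicalType;
  surface_hausdorff : hausdorff_space surface_space;
  surface_second_countable : @second_countable surface_space;
  surface_nonempty : [set: surface_space] !=set0;
  surface_connected : connected [set: surface_space];
  chart : Type;
  chart_dom : chart -> set surface_space;
  chart_map : chart -> surface_space -> C2 R;
  chart_inv : chart -> C2 R -> surface_space;
  chart_dom_open : forall a, open (chart_dom a);
  chart_img_open : forall a, open (chart_map a @` chart_dom a);
  chart_mapK : forall a x, chart_dom a x -> chart_inv a (chart_map a x) = x;
  chart_map_continuous : forall a x,
    chart_dom a x -> {for x, continuous (chart_map a)};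
  chart_inv_continuous : forall a z,
    (chart_map a @` chart_dom a) z -> {for z, continuous (chart_inv a)};
  chart_dom_cover : forall x, exists a, chart_dom a x;
  transition_holomorphic : forall a b,
    holomorphic_on (chart_map a @` (chart_dom a `&` chart_dom b))
      (chart_map b \o chart_inv a) }.

Definition transition (R : realType) (X : complex_surface R) (a b : chart X) :
  C2 R -> C2 R := chart_map b \o chart_inv a.

Definition chart_img (R : realType) (X : complex_surface R) (a : chart X) :
  set (C2 R) := chart_map a @` chart_dom a.

Definition z1 : 'I_2 := ord0.
Definition z2 : 'I_2 := ord_max.

Definition partial (R : realType) (i : 'I_2) (f : C2 R -> Cplx R) :
  C2 R -> Cplx R := fun z => 'D_(delta_mx 0 i) f z.

(* The quadratic form a11 dz1^2 + a12 dz1 dz2 + a22 dz2^2 at a tangent vector v;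
   a12 is the full coefficient of dz1 dz2, not half of it. *)
Definition qform (R : realType) (a11 a12 a22 : Cplx R) (v : C2 R) : Cplx R :=
  a11 * v 0 z1 ^+ 2 + a12 * (v 0 z1 * v 0 z2) + a22 * v 0 z2 ^+ 2.

(* H^0(X, S^2 Omega^1_X): coefficients in every chart, matching under pull-back
   by the coordinate changes.  The values off [chart_img a] carry no meaning. *)
Record symdiff (R : realType) (X : complex_surface R) := SymDiff {
  c11 : chart X -> C2 R -> Cplx R;
  c12 : chart X -> C2 R -> Cplx R;
  c22 : chart X -> C2 R -> Cplx R;
  c11_holomorphic : forall a, holomorphic_on (chart_img a) (c11 a);
  c12_holomorphic : forall a, holomorphic_on (chart_img a) (c12 a);
  c22_holomorphic : forall a, holomorphic_on (chart_img a) (c22 a);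
  symdiff_compat : forall (a b : chart X) (x : X),
    chart_dom a x -> chart_dom b x ->
    forall v : C2 R,
      let z := chart_map a x in let z' := chart_map b x in
      qform (c11 a z) (c12 a z) (c22 a z) v =
      qform (c11 b z') (c12 b z') (c22 b z') ('d (transition a b) z v) }.

(* H^0(X, m K_X): a section is h_a (dz1 /\ dz2)^m in the chart a. *)
Record pluricanonical (R : realType) (X : complex_surface R) (m : nat) :=
  Pluricanonical {
  pcoef :> chart X -> C2 R -> Cplx R;
  pcoef_holomorphic : forall a, holomorphic_on (chart_img a) (pcoef a);
  pcoef_compat : forall (a b : chart X) (x : X),
    chart_dom a x -> chart_dom b x ->
    pcoef a (chart_map a x) =
    pcoef b (chart_map b x) *
      \det (jacobian (transition a b) (chart_map a x)) ^+ m }.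

Definition is_zero_section (R : realType) (X : complex_surface R) (m : nat)
    (s : pluricanonical X m) : Prop :=
  forall (a : chart X) z, chart_img a z -> s a z = 0.

Section LocalOperators.
Variable R : realType.
Local Notation C := (Cplx R).

Definition mx3 (rows : seq (seq C)) : 'M[C]_3 :=
  \matrix_(i < 3, j < 3) nth 0 (nth [::] rows i) j.

Definition det_loc (a11 a12 a22 : C2 R -> C) (z : C2 R) : C :=
  a11 z * a22 z - 4^-1 * a12 z ^+ 2.

Definition brioschi_bracket (a11 a12 a22 : C2 R -> C) (z : C2 R) : C :=
  \det (mx3
    [:: [:: - (2^-1 * (partial z2 (partial z2 a11) z
                       + partial z1 (partial z1 a22) z
                       - partial z1 (partial z2 a12) z));
            2^-1 * partial z1 a11 z;
            2^-1 * (partial z1 a12 z - partial z2 a11 z)];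
        [:: 2^-1 * (partial z2 a12 z - partial z1 a22 z);
            a11 z;
            2^-1 * a12 z];
        [:: 2^-1 * partial z2 a22 z;
            2^-1 * a12 z;
            a22 z]])
  - \det (mx3
    [:: [:: 0;
            2^-1 * partial z2 a11 z;
            2^-1 * partial z1 a22 z];
        [:: 2^-1 * partial z2 a11 z;
            a11 z;
            2^-1 * a12 z];
        [:: 2^-1 * partial z1 a22 z;
            2^-1 * a12 z;
            a22 z]]).

(* Meaningful where [det_loc] does not vanish. *)
Definition RC_loc (a11 a12 a22 : C2 R -> C) (z : C2 R) : C :=
  (det_loc a11 a12 a22 z ^+ 2)^-1 * brioschi_bracket a11 a12 a22 z.

End LocalOperators.

Section Notions.
Variables (R : realType) (X : complex_surface R).
Implicit Types (w : symdiff X) (a : chart X) (x y : X).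
Local Notation C := (Cplx R).

(* [T_x X] is identified with C^2 through a chart a at x. *)
Definition value w a x : C2 R -> C :=
  let z := chart_map a x in qform (c11 w a z) (c12 w a z) (c22 w a z).

Definition holomorphic_fun (U : set X) (f : X -> C) : Prop :=
  forall a, holomorphic_on (chart_map a @` (chart_dom a `&` U)) (f \o chart_inv a).

Definition dfun (f : X -> C) a x : C2 R -> C := 'd (f \o chart_inv a) (chart_map a x).

(* Closedness of A follows, as the condition is imposed at every x of X. *)
Definition analytic_subset (A : set X) : Prop :=
  forall x, exists (U : set X) (k : nat) (g : 'I_k -> X -> C),
    [/\ open_nbhs x U,
        forall i, holomorphic_fun U (g i) &
        A `&` U = [set y | U y /\ forall i, g i y = 0]].

Definition at_general_point (P : X -> Prop) : Prop :=
  exists A : set X, [/\ analytic_subset A, A <> setT & forall x, ~ A x -> P x].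

Definition rank2 w : Prop :=
  at_general_point (fun x => forall a, chart_dom a x ->
    exists l1 l2 : 'Hom(C2 R, C),
      free [:: l1; l2] /\ forall v, value w a x v = l1 v * l2 v).

Definition is_line_of (q : C2 R -> C) (L : {vspace C2 R}) : Prop :=
  \dim L = 1%N /\ forall v, v \in L -> q v = 0.

Definition degeneracy_locus w : set X :=
  [set x | forall a, chart_dom a x ->
    (forall v, value w a x v = 0) \/
    ~ (exists L1 L2 : {vspace C2 R},
         [/\ is_line_of (value w a x) L1, is_line_of (value w a x) L2 &
             L1 <> L2])].

Definition exact_at w x : Prop :=
  exists (U : set X) (f1 f2 : X -> C),
    [/\ open_nbhs x U, holomorphic_fun U f1, holomorphic_fun U f2 &
        forall y a, U y -> chart_dom a y ->
          forall v, value w a y v = dfun f1 a y v * dfun f2 a y v].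

Definition closed_differential w : Prop := at_general_point (exact_at w).

Definition closed_1st_kind_on w (V : set X) : Prop :=
  forall x, V x -> exact_at w x.

(* P = det^2 R^C, extended by the Brioschi bracket to the points where det = 0. *)
Definition is_P2_operator (P : symdiff X -> pluricanonical X 4) : Prop :=
  forall w a z, chart_img a z ->
    P w a z = brioschi_bracket (c11 w a) (c12 w a) (c22 w a) z /\
    (det_loc (c11 w a) (c12 w a) (c22 w a) z != 0 ->
     P w a z = det_loc (c11 w a) (c12 w a) (c22 w a) z ^+ 2 *
               RC_loc (c11 w a) (c12 w a) (c22 w a) z).

End Notions.

(* Main.v *)
(** Where det(w) <> 0 the form factors locally as w = alpha beta with alpha, beta
    independent holomorphic 1-forms. There is a unique 1-form omega with
    d alpha = omega /\ alpha and d beta = - omega /\ beta, and d omega is, up to a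
    nowhere zero factor, the Brioschi bracket times dz1 /\ dz2. If the bracket vanishes,
    the Poincare lemma gives omega = dg, and w = (e^(-g) alpha) (e^g beta) is a product of
    two closed, hence exact, forms. Conversely, under a holomorphic map (f1, f2) of C^2 the bracket of
    the pulled back form is the bracket times the fourth power of the Jacobian; this is a
    polynomial identity in the 2-jets. It shows that the bracket defines a section of 4 K_X,
    and, applied to the pull-back of dz1 dz2, that the bracket of df1 df2 is zero. As a proper
    analytic subset of a connected surface has empty interior, a closed w has vanishing
    bracket everywhere.

    The facts needed from several complex variables (holomorphy of partial derivatives and
    the identity principle) come from Cauchy estimates, and these from the maximum
    principle; Goursat's lemma is used only on rectangles. *)

Require Import Defs.
From HB Require Import structures.
From mathcomp Require Import all_boot all_order all_algebra.
From mathcomp Require Import ring lra.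
From mathcomp Require Import complex.
From mathcomp Require Import all_classical all_reals all_analysis.

Set Implicit Arguments.
Unset Strict Implicit.
Unset Printing Implicit Defensive.

Import Order.TTheory GRing.Theory Num.Theory.
Import numFieldNormedType.Exports.
Import Normc.

Local Open Scope classical_set_scope.
Local Open Scope ring_scope.
Local Open Scope complex_scope.

(** * Complex derivatives along real curves *)

(** The obstacle is regularity. Complex differentiability gives one derivative at each point,
    without continuity, while the bracket involves second derivatives and its pull-back third ones.
    An elementary maximum principle compares a point with four neighbours and so asks for a second
    derivative. Goursat's lemma bridges the gap: it gives g a primitive F, the increments F (z + h)
    - F z are twice differentiable, and bounding them by M |h| bounds g. A factor inserted only to
    make a quotient derivable at its pole disappears when the maximum principle is applied to n-th
    powers and n grows. In two variables each estimate is obtained on complex lines, with constants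
    that depend on a bound and a radius only; this uniformity lets first-order expansions of
    difference quotients survive the passage to the limit. The Poincare lemma and the exponential
    serve a second time, to provide the holomorphic square root of the discriminant that the
    factorization of w requires. *)

Lemma is_derive_epsP (K : numFieldType) (f : K -> K) (z d : K) :
  is_derive z 1 f d <->
  forall e : K, 0 < e -> \forall h \near 0, `|f (z + h) - f z - d * h| <= e * `|h|.
Proof.
have E (e h : K) : h != 0 ->
    (`|d - h^-1 *: ((f \o shift z) (h *: (1 : K)) - f z)| <= e) =
    (`|f (z + h) - f z - d * h| <= e * `|h|).
  move=> h0; rewrite -[in RHS](ler_pM2l (_ : 0 < `|h|^-1)) ?invr_gt0 ?normr_gt0//.
  rewrite [e * _]mulrC mulKf ?normr_eq0// -normfV -normrM distrC.
  congr (`|_| <= _); rewrite /= scaler1 addrC -[h + z]addrC.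
  by rewrite [in RHS]mulrBr [d * h]mulrC mulKf // addrC.
split.
  move=> [fz fd] e e0.
  have /cvgrPdist_le/(_ e e0) : h^-1 *: ((f \o shift z) (h *: (1 : K)) - f z) @[h --> 0^'] --> d.
    by rewrite -fd; exact: fz.
  rewrite near_withinE; apply: filterS => h H.
  (* Once the denominator is cleared the inequality is trivial at h = 0, so the punctured
     neighbourhood of the definition becomes a full one. *)
  have [->|h0] := eqVneq h 0.
    by rewrite normr0 !mulr0 addr0 subrr subr0 normr0.
  by rewrite -E //; exact: H.
move=> H.
have L : h^-1 *: ((f \o shift z) (h *: (1 : K)) - f z) @[h --> 0^'] --> d.
  apply/cvgrPdist_le => e e0; rewrite near_withinE.
  by move: (H e e0); apply: filterS => h + h0; rewrite E.
split; first by apply/cvg_ex; exists d.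
by apply/cvg_lim => //; exact: norm_hausdorff.
Qed.

Section PlaneCurves.
Variable R : realType.
Local Notation C := (Cplx R).
Local Notation re := (@complex.Re R).
Local Notation im := (@complex.Im R).
Implicit Types (z w h d : C) (f g : C -> C).

(** The norm of C takes its values in C. Estimates are carried out with the real-valued [normc],
    where the order is total and [lra] applies. *)
Lemma normr_normc z : `|z| = (normc z)%:C. Proof. by case: z. Qed.

Lemma ltc0E z : 0 < z -> 0 < re z /\ z = (re z)%:C.
Proof. by case: z => a b; rewrite ltcE /= => /andP[/eqP -> ?]. Qed.

Lemma normc_ge0 z : 0 <= normc z.
Proof. by case: z => a b; exact: sqrtr_ge0. Qed.

Lemma normc_eq0 z : (normc z == 0) = (z == 0).
Proof. by apply/eqP/eqP => [/eq0_normc//|->]; rewrite normc0. Qed.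

Lemma normc_gt0 z : (0 < normc z) = (z != 0).
Proof. by rewrite lt_def normc_ge0 normc_eq0 andbT. Qed.

Lemma normcX z n : normc (z ^+ n) = normc z ^+ n.
Proof. by elim: n => [|n IH]; rewrite ?expr0 ?normc1// !exprS normcM IH. Qed.

Lemma normcB z w : normc (z - w) = normc (w - z).
Proof. by rewrite -normcN opprB. Qed.

Lemma normcD z w : normc (z + w) <= normc z + normc w.
Proof. exact: le_normcD. Qed.

Lemma normc_re z : `|re z| <= normc z.
Proof. by case: z => a b /=; rewrite -sqrtr_sqr ler_wsqrtr// lerDl sqr_ge0. Qed.

Lemma normc_im z : `|im z| <= normc z.
Proof. by case: z => a b /=; rewrite -sqrtr_sqr ler_wsqrtr// lerDr sqr_ge0. Qed.

Lemma normc_le z : normc z <= `|re z| + `|im z|.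
Proof.
case: z => a b /=; rewrite -[leRHS]ger0_norm ?addr_ge0// -sqrtr_sqr ler_wsqrtr//.
by rewrite sqrrD !real_normK ?num_real// addrAC lerDl mulrn_wge0 // mulr_ge0.
Qed.

Lemma normc_real (x : R) : normc x%:C = `|x|.
Proof. by rewrite /= expr0n /= addr0 sqrtr_sqr. Qed.

Lemma nbhsCP z (P : set C) :
  nbhs z P <-> exists2 e : R, 0 < e & forall w, normc (w - z) < e -> P w.
Proof.
split.
  move/nbhs_ballP => [e /= e0 H].
  have [e0' eE] := ltc0E e0.
  exists (re e) => // w wz; apply: H.
  by rewrite -ball_normE /= distrC normr_normc eE ltcR.
move=> [e e0 H]; apply/nbhs_ballP; exists (e%:C); first by rewrite /= ltcR.
by move=> w; rewrite -ball_normE /= distrC normr_normc ltcR => /H.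
Qed.

Lemma is_deriveCP f z d : is_derive z (1 : C) f d <->
  forall e : R, 0 < e -> exists2 r : R, 0 < r &
    forall h, normc h < r -> normc (f (z + h) - f z - d * h) <= e * normc h.
Proof.
rewrite is_derive_epsP; split=> H e e0.
  have /H/nbhsCP[r r0 K] : 0 < e%:C by rewrite ltcR.
  exists r => // h hr; have := K h.
  by rewrite subr0 => /(_ hr); rewrite !normr_normc -rmorphM lecR.
have [e0' ->] := ltc0E e0.
have [r r0 K] := H _ e0'; apply/nbhsCP; exists r => // h.
by rewrite subr0 => /K; rewrite !normr_normc -rmorphM lecR.
Qed.

Lemma cont_is_derive f z d : is_derive z (1 : C) f d ->
  forall e : R, 0 < e -> exists2 r : R, 0 < r &
    forall h, normc h < r -> normc (f (z + h) - f z) < e.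
Proof.
move=> /is_deriveCP/(_ _ ltr01)[r r0 H] e e0.
have p : 0 < normc d + 1 by rewrite ltr_wpDl // normc_ge0.
exists (Num.min r (e / (normc d + 1))).
  by rewrite lt_min r0 divr_gt0.
move=> h; rewrite lt_min => /andP[/H h1 h2].
have -> : f (z + h) - f z = (f (z + h) - f z - d * h) + d * h by rewrite subrK.
apply: le_lt_trans (normcD _ _) _.
rewrite ltr_pdivlMr// in h2; apply: le_lt_trans h2.
by rewrite normcM mulrDr mulr1 addrC [normc h * _]mulrC lerD2l (le_trans h1)// mul1r.
Qed.

Lemma re_conjc_mul z : re (z^* * z) = normc z ^+ 2 /\ normc (z^*) = normc z.
Proof.
case: z => a b; split; last by rewrite /= sqrrN.
by rewrite /= sqr_sqrtr ?addr_ge0 ?sqr_ge0// mulNr opprK !expr2.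
Qed.

Lemma reB z w : re (z - w) = re z - re w. Proof. by case: z w => a b []. Qed.
Lemma reD z w : re (z + w) = re z + re w. Proof. by case: z w => a b []. Qed.
Lemma imB z w : im (z - w) = im z - im w. Proof. by case: z w => a b []. Qed.
Lemma imD z w : im (z + w) = im z + im w. Proof. by case: z w => a b []. Qed.
Lemma reMr z (t : R) : re (z * t%:C) = re z * t.
Proof. by case: z => a b /=; rewrite mulr0 subr0. Qed.
Lemma imMr z (t : R) : im (z * t%:C) = im z * t.
Proof. by case: z => a b /=; rewrite mulr0 add0r. Qed.

(** C serves here as a normed space over itself, so the derivative of a curve with a real parameter
    is spelled out with epsilons. *)
Definition vderive (g : R -> C) (t : R) (d : C) : Prop :=
  forall e : R, 0 < e -> exists2 r : R, 0 < r &
    forall s, `|s| < r -> normc (g (t + s) - g t - d * s%:C) <= e * `|s|.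

Lemma is_deriveRP (f : R -> R) (x d : R) : is_derive x (1 : R) f d <->
  forall e : R, 0 < e -> exists2 r : R, 0 < r &
    forall h : R, `|h| < r -> `|f (x + h) - f x - d * h| <= e * `|h|.
Proof.
rewrite is_derive_epsP; split=> H e e0.
  have /nbhs_ballP[r /= r0 K] := H e e0.
  by exists r => // h hr; apply: K; rewrite -ball_normE /= sub0r normrN.
have [r r0 K] := H e e0; apply/nbhs_ballP; exists r => // h.
by rewrite -ball_normE /= sub0r normrN; exact: K.
Qed.

Lemma vderive_re (g : R -> C) (t : R) d u :
  vderive g t d -> is_derive t (1 : R) (fun s => re (u * g s)) (re (u * d)).
Proof.
move=> H; apply/is_deriveRP => e e0.
have p : 0 < normc u + 1 by rewrite ltr_wpDl // normc_ge0.
have [r r0 K] := H (e / (normc u + 1)) (divr_gt0 e0 p); exists r => // s /K.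
rewrite mulrAC ler_pdivlMr // => {}K; apply: le_trans K.
rewrite -!reB -reMr -reB -mulrA -!mulrBr; apply: le_trans (normc_re _) _.
by rewrite normcM mulrDr mulr1 [leLHS]mulrC lerDl normc_ge0.
Qed.

(** The mean value theorem is applied to the real function re (u * g), with u the conjugate of g b -
    g a. Its increment is |g b - g a|^2, and one factor cancels. *)
Lemma vderive_mvt (g : R -> C) (d : R -> C) (a b m : R) : a <= b ->
  (forall t, a <= t <= b -> vderive g t (d t)) ->
  (forall t, a <= t <= b -> normc (d t) <= m) ->
  normc (g b - g a) <= m * (b - a).
Proof.
move=> ab dg dm; set u := (g b - g a)^*.
have [||c] := @MVT_segment _ (fun s => re (u * g s)) (fun s => re (u * d s)) a b ab.
- move=> x; rewrite in_itv /= => /andP[ax xb].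
  by apply/vderive_re/dg; rewrite !ltW.
- apply: derivable_within_continuous => x; rewrite in_itv /= => xab.
  by have [] := vderive_re u (dg _ xab).
rewrite in_itv /= => cab; rewrite -reB -mulrBr /u.
have [-> uE] := re_conjc_mul (g b - g a) => E.
have [->|n0] := eqVneq (normc (g b - g a)) 0.
  rewrite mulr_ge0 ?subr_ge0//; apply: le_trans (dm a _); first exact: normc_ge0.
  by rewrite lexx.
rewrite -(@ler_pM2l _ (normc (g b - g a))) ?lt_def ?n0 ?normc_ge0//.
rewrite -expr2 E mulrA ler_wpM2r ?subr_ge0// (le_trans (ler_norm _))//.
by rewrite (le_trans (normc_re _))// normcM uE ler_wpM2l ?normc_ge0// dm.
Qed.

Lemma is_derive_line f z h d (t : R) : is_derive (z + t%:C * h) (1 : C) f d ->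
  vderive (fun s => f (z + s%:C * h)) t (d * h).
Proof.
move=> /is_deriveCP H e e0.
have p : 0 < normc h + 1 by rewrite ltr_wpDl // normc_ge0.
have [r r0 K] := H (e / (normc h + 1)) (divr_gt0 e0 p).
exists (r / (normc h + 1)); first by rewrite divr_gt0.
move=> s; rewrite ltr_pdivlMr // => sr.
have le1 : `|s| * normc h <= `|s| * (normc h + 1).
  by rewrite ler_wpM2l// lerDl.
have := K (s%:C * h); rewrite normcM normc_real => /(_ (le_lt_trans le1 sr)).
rewrite rmorphD mulrDl addrA mulrA [_ * s%:C * h]mulrAC => /le_trans; apply.
by rewrite mulrAC ler_pdivrMr // -mulrA ler_wpM2l // ltW.
Qed.

Lemma is_derive_mvt f (d : C -> C) z h (m : R) :
  (forall t : R, 0 <= t <= 1 -> is_derive (z + t%:C * h) (1 : C) f (d (z + t%:C * h))) ->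
  (forall t : R, 0 <= t <= 1 -> normc (d (z + t%:C * h)) <= m) ->
  normc (f (z + h) - f z) <= m * normc h.
Proof.
move=> df dm.
have := @vderive_mvt (fun s => f (z + s%:C * h)) (fun s => d (z + s%:C * h) * h)
  0 1 (m * normc h) ler01.
rewrite mul1r mul0r addr0 subr0 mulr1; apply=> t t01.
  exact/is_derive_line/df.
by rewrite normcM ler_wpM2r ?normc_ge0// dm.
Qed.

End PlaneCurves.

(** * Antiderivatives of curves, nested intervals, derivatives from quadratic errors *)

Section CurveRules.
Variable R : realType.
Local Notation C := (Cplx R).
Local Notation re := (@complex.Re R).
Local Notation im := (@complex.Im R).
Implicit Types (z w h d : C) (f g : C -> C).

Lemma vderiveB (g k : R -> C) (t : R) d d' :
  vderive g t d -> vderive k t d' -> vderive (fun s => g s - k s) t (d - d').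
Proof.
move=> dg dk e e0; have e2 : 0 < e / 2 by rewrite divr_gt0.
have [r r0 H] := dg _ e2; have [r' r0' H'] := dk _ e2.
exists (Num.min r r') => [|s]; first by rewrite lt_min r0.
rewrite lt_min => /andP[/H h1 /H' h2].
have -> : g (t + s) - k (t + s) - (g t - k t) - (d - d') * s%:C =
  (g (t + s) - g t - d * s%:C) - (k (t + s) - k t - d' * s%:C) by ring.
apply: le_trans (normcD _ _) _; rewrite normcN.
by apply: le_trans (lerD h1 h2) _; rewrite -mulrDl -splitr.
Qed.

Lemma vderiveZ (c : C) (g : R -> C) (t : R) d :
  vderive g t d -> vderive (fun s => c * g s) t (c * d).
Proof.
move=> dg e e0.
have p : 0 < normc c + 1 by rewrite ltr_wpDl // normc_ge0.
have [r r0 H] := dg _ (divr_gt0 e0 p); exists r => // s /H.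
rewrite mulrAC ler_pdivlMr // => {}H; apply: le_trans H.
rewrite -mulrA -!mulrBr normcM mulrC.
by rewrite ler_wpM2l ?normc_ge0// lerDl.
Qed.

Lemma vderive_mvt_dist (g : R -> C) (d : R -> C) (a b m : R) :
  (forall t, Num.min a b <= t <= Num.max a b -> vderive g t (d t)) ->
  (forall t, Num.min a b <= t <= Num.max a b -> normc (d t) <= m) ->
  normc (g b - g a) <= m * `|b - a|.
Proof.
move=> H K; have [ab|/ltW ba] := leP a b.
  rewrite ger0_norm ?subr_ge0//; move: H K; rewrite min_l// max_r// => H K.
  exact: vderive_mvt H K.
rewrite normcB distrC ger0_norm ?subr_ge0//.
move: H K; rewrite min_r// max_l// => H K; exact: vderive_mvt H K.
Qed.

Lemma antiderivative_real (u : R -> R) (A B : R) : A < B ->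
  (forall x, {for x, continuous u}) ->
  exists U : R -> R, forall x, A < x < B -> is_derive x (1 : R) U (u x).
Proof.
move=> AB cu.
exists (fun x => (\int[lebesgue_measure]_(t in [set` `[A, x]]) (u t))%R).
move=> x /andP[Ax xB].
have [] := @continuous_FTC1_closed R u A x B xB _ Ax (cu x).
  apply: continuous_compact_integrable; first exact: segment_compact.
  by apply: continuous_subspaceT => y; exact: cu.
by move=> d1; rewrite derive1E; exact: DeriveDef.
Qed.

Lemma antiderivative (g : R -> C) (A B : R) : A < B ->
  (forall (x e : R), 0 < e -> exists2 r : R, 0 < r &
    forall s, `|s| < r -> normc (g (x + s) - g x) < e) ->
  exists U : R -> C, forall x, A < x < B -> vderive U x (g x).
Proof.
move=> AB cg.
have [|U1 H1] := @antiderivative_real (fun x => re (g x)) _ _ AB.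
  move=> x; apply/(@cvgrPdist_lt _ R) => e /(cg x)[r r0 H].
  apply/nbhs_ballP; exists r => // y /= yr; move: yr; rewrite /ball /= distrC => /H.
  by rewrite subrKC distrC -reB; exact/le_lt_trans/normc_re.
have [|U2 H2] := @antiderivative_real (fun x => im (g x)) _ _ AB.
  move=> x; apply/(@cvgrPdist_lt _ R) => e /(cg x)[r r0 H].
  apply/nbhs_ballP; exists r => // y /= yr; move: yr; rewrite /ball /= distrC => /H.
  by rewrite subrKC distrC -imB; exact/le_lt_trans/normc_im.
exists (fun x => U1 x +i* U2 x) => x xAB e e0; have e2 : 0 < e / 2 by rewrite divr_gt0.
have /is_deriveRP/(_ _ e2)[r1 r10 K1] := H1 _ xAB.
have /is_deriveRP/(_ _ e2)[r2 r20 K2] := H2 _ xAB.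
exists (Num.min r1 r2) => [|s]; first by rewrite lt_min r10.
rewrite lt_min => /andP[/K1 k1 /K2 k2]; apply: le_trans (normc_le _) _.
rewrite !(reB, imB) reMr imMr /=.
by apply: le_trans (lerD k1 k2) _; rewrite -mulrDl -splitr.
Qed.

Lemma half_lt (x e : R) : 0 < e -> exists n, x / 2 ^+ n < e.
Proof.
move=> e0; exists (Num.bound `|x / e|); rewrite ltr_pdivrMr ?exprn_gt0//.
rewrite mulrC -ltr_pdivrMr//; apply: le_lt_trans (ler_norm _) _.
apply: lt_trans (archi_boundP (normr_ge0 _)) _.
by rewrite -natrX ltr_nat ltn_expl.
Qed.

(** Every right end bounds every left end, so the supremum of the left ends lies in all the
    intervals. *)
Lemma nested_point (a : nat -> R) (s : R) : 0 <= s ->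
  (forall n, a n <= a n.+1) ->
  (forall n, a n.+1 + s / 2 ^+ n.+1 <= a n + s / 2 ^+ n) ->
  exists x, forall n, a n <= x <= a n + s / 2 ^+ n.
Proof.
move=> s0 up dn.
have sn n : 0 <= s / 2 ^+ n by rewrite divr_ge0// exprn_ge0.
have up' n k : a n <= a (n + k)%N.
  by elim: k => [|k IH]; rewrite ?addn0// addnS (le_trans IH).
have dn' n k : a (n + k)%N + s / 2 ^+ (n + k) <= a n + s / 2 ^+ n.
  by elim: k => [|k IH]; rewrite ?addn0// addnS (le_trans (dn _)).
have ub n m : a m <= a n + s / 2 ^+ n.
  apply: le_trans (up' m n) _; rewrite addnC; apply: le_trans _ (dn' n m).
  by rewrite lerDl.
have hs : has_sup (range a).
  by split; [exists (a 0%N), 0%N | exists (a 0%N + s / 2 ^+ 0) => _ [m _ <-]].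
exists (sup (range a)) => n; apply/andP; split.
  by apply: sup_upper_bound => //; exists n.
by apply: ge_sup => [|_ [m _ <-]//]; exists (a 0%N), 0%N.
Qed.

(** A shortcut to the derivatives of quadratic polynomials, and of quotients by powers of z - c at
    the point c itself, where the quotient rule does not apply. *)
Lemma is_derive_quad f z d (K r : R) : 0 < r ->
  (forall h, normc h < r -> normc (f (z + h) - f z - d * h) <= K * normc h ^+ 2) ->
  is_derive z (1 : C) f d.
Proof.
move=> r0 H; apply/is_deriveCP => e e0.
have p : 0 < `|K| + 1 by rewrite ltr_wpDl.
exists (Num.min r (e / (`|K| + 1))) => [|h]; first by rewrite lt_min r0 divr_gt0.
rewrite lt_min => /andP[/H h1]; rewrite ltr_pdivlMr// => h2.
apply: le_trans h1 _; rewrite expr2 mulrA ler_wpM2r ?normc_ge0//.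
apply: le_trans (ltW h2); rewrite mulrC ler_wpM2l ?normc_ge0//.
by rewrite (le_trans (ler_norm _))// lerDl.
Qed.

Lemma vderive_lin (c : C) (t : R) : vderive (fun s => c * s%:C) t c.
Proof.
move=> e e0; exists 1 => // s _.
rewrite (_ : _ - _ = 0) ?normc0 ?mulr_ge0// 1?ltW//; last by rewrite rmorphD; ring.
Qed.

Lemma is_derive_eqfun f g z d d' :
  is_derive z (1 : C) f d -> f =1 g -> d = d' -> is_derive z (1 : C) g d'.
Proof. by move=> H /funext <- <-. Qed.

End CurveRules.

(** * Goursat's lemma and primitives on rectangles *)

Section Rectangles.
Variable R : realType.
Local Notation C := (Cplx R).
Local Notation re := (@complex.Re R).
Local Notation im := (@complex.Im R).
Implicit Types (z w h d : C) (f g : C -> C).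

Local Notation ii := (0 +i* 1 : C).

Lemma vderive_h f (t c : R) d : is_derive (t +i* c : C) (1 : C) f d ->
  vderive (fun s => f (s +i* c)) t d.
Proof.
move=> H; have := @is_derive_line R f (0 +i* c) 1 d t.
rewrite mulr1; have E s : (0 +i* c : C) + s%:C * 1 = s +i* c.
  by rewrite mulr1; apply/eqP; rewrite eq_complex /= add0r addr0 !eqxx.
rewrite E => /(_ H); congr vderive; apply/funext => s; by rewrite E.
Qed.

Lemma vderive_v f (a t : R) d : is_derive (a +i* t : C) (1 : C) f d ->
  vderive (fun s => f (a +i* s)) t (d * ii).
Proof.
move=> H; have := @is_derive_line R f a%:C ii d t.
have E s : (a%:C : C) + s%:C * ii = a +i* s.
  by apply/eqP; rewrite eq_complex /=; apply/andP; split; apply/eqP; ring.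
rewrite E => /(_ H); congr vderive; apply/funext => s; by rewrite E.
Qed.

Definition clamp (a b x : R) := Num.max a (Num.min b x).

Lemma clamp_in (a b x : R) : a <= b -> a <= clamp a b x <= b.
Proof. by move=> ab; rewrite /clamp le_max lexx ge_max ab ge_min lexx. Qed.

Lemma clamp_id (a b x : R) : a <= x <= b -> clamp a b x = x.
Proof. by move=> /andP[ax xb]; rewrite /clamp min_r// max_r. Qed.

Lemma clamp_dist (a b x y : R) : `|clamp a b x - clamp a b y| <= `|x - y|.
Proof.
rewrite /clamp /Num.max /Num.min.
have h (u v : R) : u - v <= `|u - v| by exact: ler_norm.
have h' (u v : R) : v - u <= `|u - v| by rewrite distrC ler_norm.
move: (h x y) (h' x y) (normr_ge0 (x - y)) => h1 h2 h3.
case: (ltP b x) => ?; case: (ltP b y) => ?; repeat case: (ltP a _) => ?; rewrite ler_norml; lra.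
Qed.

Definition in_rect (x0 x1 y0 y1 : R) z := x0 <= re z <= x1 /\ y0 <= im z <= y1.

Section Goursat.
Variables (g : C -> C) (x0 x1 y0 y1 : R).
Hypotheses (x01 : x0 <= x1) (y01 : y0 <= y1).
Hypothesis dg : forall z, in_rect x0 x1 y0 y1 z -> exists d, is_derive z (1 : C) g d.

(* Clamping the coordinates extends g from the rectangle to a continuous function on R^2. *)
Let gt (x y : R) : C := g (clamp x0 x1 x +i* clamp y0 y1 y).

Lemma clamped_cont (x y e : R) : 0 < e -> exists2 r : R, 0 < r &
  forall s t, `|s| + `|t| < r -> normc (gt (x + s) (y + t) - gt x y) < e.
Proof.
move=> e0; have [|d] := @dg (clamp x0 x1 x +i* clamp y0 y1 y).
  by split; exact: clamp_in.
move=> /cont_is_derive/(_ e e0)[r r0 H]; exists r => // s t st; rewrite /gt.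
rewrite -[X in g X](subrKC (clamp x0 x1 x +i* clamp y0 y1 y : C)).
apply: H; apply: le_lt_trans st; apply: le_trans (normc_le _) _; rewrite reB imB /=.
by apply: lerD; apply: le_trans (clamp_dist _ _ _ _) _; rewrite addrC addKr.
Qed.

Lemma exists_sides : exists U V : R -> R -> C,
  (forall x y, x0 <= x <= x1 -> vderive (U ^~ y) x (gt x y)) /\
  (forall x y, y0 <= y <= y1 -> vderive (V x) y (gt x y)).
Proof.
(* [antiderivative] works inside an open interval. Enlarging [x0, x1] by 1 at both ends covers the
   closed interval and keeps it nondegenerate when x0 = x1; the clamped function is continuous there
   too. *)
have [U HU] : exists U : R -> R -> C, forall y x, x0 - 1 < x < x1 + 1 -> vderive (U y) x (gt x y).
  suff /choice[U HU] : forall y, exists Uy, forall x, x0 - 1 < x < x1 + 1 -> vderive Uy x (gt x y).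
    by exists U.
  move=> y; apply: antiderivative => [|x e /(clamped_cont x y)[r r0 H]].
    by move: x01; lra.
  by exists r => // s sr; have := H s 0; rewrite normr0 !addr0; exact.
have [V HV] : exists V : R -> R -> C, forall x y, y0 - 1 < y < y1 + 1 -> vderive (V x) y (gt x y).
  suff /choice[V HV] : forall x, exists Vx, forall y, y0 - 1 < y < y1 + 1 -> vderive Vx y (gt x y).
    by exists V.
  move=> x; apply: antiderivative => [|y e /(clamped_cont x y)[r r0 H]].
    by move: y01; lra.
  by exists r => // s sr; have := H 0 s; rewrite normr0 add0r !addr0; exact.
exists (fun x y => U y x), V; split => x y /andP[h1 h2].
  by apply: HU; apply/andP; split; lra.
by apply: HV; apply/andP; split; lra.
Qed.

Variables (U V : R -> R -> C).
Hypothesis HU : forall x y, x0 <= x <= x1 -> vderive (U ^~ y) x (gt x y).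
Hypothesis HV : forall x y, y0 <= y <= y1 -> vderive (V x) y (gt x y).

(* U (. , y) and V (x, .) integrate g along horizontal and vertical segments, so this is
   the integral of g along the boundary of the rectangle [a, b] x [c, d]. *)
Definition circulation (a b c d : R) : C :=
  (U b c - U a c) - (U b d - U a d) + ii * ((V b d - V b c) - (V a d - V a c)).

(** The integral of p around the rectangle is zero, since the values of its primitive P at the
    corners cancel. Only g - p contributes, at most m times the perimeter. *)
Lemma circulation_small (P p : C -> C) (m a b c d : R) :
  (forall z, is_derive z (1 : C) P (p z)) ->
  x0 <= a -> a <= b -> b <= x1 -> y0 <= c -> c <= d -> d <= y1 ->
  (forall z, in_rect a b c d z -> normc (g z - p z) <= m) ->
  normc (circulation a b c d) <= 2 * m * ((b - a) + (d - c)).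
Proof.
move=> dP xa ab bx yc cd dy H.
have hh y : c <= y <= d -> normc (U b y - U a y - (P (b +i* y) - P (a +i* y))) <= m * (b - a).
  move=> /andP[cy yd].
  have -> : U b y - U a y - (P (b +i* y) - P (a +i* y)) =
    (U b y - P (b +i* y)) - (U a y - P (a +i* y)) by ring.
  apply: (@vderive_mvt R (fun x => U x y - P (x +i* y)) (fun x => gt x y - p (x +i* y))) => // t /andP[at_ tb].
    apply: vderiveB; last exact: vderive_h.
    by apply: HU; rewrite (le_trans xa)// (le_trans tb).
  rewrite /gt !clamp_id ?(le_trans xa)// ?(le_trans tb)// ?(le_trans yc)// ?(le_trans yd)//.
  by apply: H; split; apply/andP.
have vv x : a <= x <= b -> normc (ii * (V x d - V x c) - (P (x +i* d) - P (x +i* c))) <= m * (d - c).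
  move=> /andP[ax xb].
  have -> : ii * (V x d - V x c) - (P (x +i* d) - P (x +i* c)) =
    (ii * V x d - P (x +i* d)) - (ii * V x c - P (x +i* c)) by ring.
  apply: (@vderive_mvt R (fun y => ii * V x y - P (x +i* y)) (fun y => ii * gt x y - p (x +i* y) * ii)) => // t /andP[ct td].
    apply: vderiveB; last exact: vderive_v.
    by apply/vderiveZ/HV; rewrite (le_trans yc)// (le_trans td).
  rewrite mulrC -mulrBl normcM (_ : normc ii = 1) ?mulr1; last by rewrite /= expr0n expr1n add0r sqrtr1.
  rewrite /gt !clamp_id ?(le_trans xa)// ?(le_trans xb)// ?(le_trans yc)// ?(le_trans td)//.
  by apply: H; split; apply/andP.
have -> : circulation a b c d =
  ((U b c - U a c - (P (b +i* c) - P (a +i* c))) - (U b d - U a d - (P (b +i* d) - P (a +i* d))))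
  + ((ii * (V b d - V b c) - (P (b +i* d) - P (b +i* c))) - (ii * (V a d - V a c) - (P (a +i* d) - P (a +i* c)))).
  by rewrite /circulation; ring.
apply: le_trans (normcD _ _) _; rewrite [leRHS]mulrDr; apply: lerD.
  apply: le_trans (normcD _ _) _; rewrite normcN.
  rewrite (_ : 2 * m * (b - a) = m * (b - a) + m * (b - a)); last by ring.
  by apply: lerD; apply: hh; rewrite ?lexx ?cd.
apply: le_trans (normcD _ _) _; rewrite normcN.
rewrite (_ : 2 * m * (d - c) = m * (d - c) + m * (d - c)); last by ring.
by apply: lerD; apply: vv; rewrite ?lexx ?ab.
Qed.

(** Inner sides of the four quarters cancel, so their circulations add up to that of the whole. The
    threshold, K times the square of half the perimeter, is divided by four as well; hence some
    quarter exceeds its own threshold. *)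
Lemma circulation_halve (a b c d K : R) :
  a <= b -> c <= d -> K * ((b - a) + (d - c)) ^+ 2 < normc (circulation a b c d) ->
  exists a' c' : R, [/\ a' = a \/ a' = a + (b - a) / 2, c' = c \/ c' = c + (d - c) / 2 &
   K * ((b - a) / 2 + (d - c) / 2) ^+ 2 <
     normc (circulation a' (a' + (b - a) / 2) c' (c' + (d - c) / 2))].
Proof.
move=> ab cd H; apply: contrapT => N.
have {}N a' c' : a' = a \/ a' = a + (b - a) / 2 -> c' = c \/ c' = c + (d - c) / 2 ->
    normc (circulation a' (a' + (b - a) / 2) c' (c' + (d - c) / 2)) <=
    K * ((b - a) / 2 + (d - c) / 2) ^+ 2.
  by move=> ha hc; rewrite leNgt; apply/negP => h; apply: N; exists a', c'.
have Eb : a + (b - a) / 2 + (b - a) / 2 = b by field.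
have Ed : c + (d - c) / 2 + (d - c) / 2 = d by field.
have h1 := N a c (or_introl erefl) (or_introl erefl).
have := N _ c (or_intror erefl) (or_introl erefl); rewrite Eb => h2.
have := N a _ (or_introl erefl) (or_intror erefl); rewrite Ed => h3.
have := N _ _ (or_intror erefl) (or_intror erefl); rewrite Eb Ed => h4.
move: H; rewrite ltNge => /negP; apply.
set p := a + (b - a) / 2 in h1 h2 h3 h4; set q := c + (d - c) / 2 in h1 h2 h3 h4.
have -> : circulation a b c d = (circulation a p c q + circulation p b c q) +
   (circulation a p q d + circulation p b q d) by rewrite /circulation; ring.
apply: le_trans (normcD _ _) _.
apply: le_trans (lerD (normcD _ _) (normcD _ _)) _.
rewrite (_ : K * _ = (K * ((b - a) / 2 + (d - c) / 2) ^+ 2 + K * ((b - a) / 2 + (d - c) / 2) ^+ 2) +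
  (K * ((b - a) / 2 + (d - c) / 2) ^+ 2 + K * ((b - a) / 2 + (d - c) / 2) ^+ 2)); last by field.
by apply: lerD; apply: lerD.
Qed.

Lemma goursat (a b c d : R) : x0 <= a -> a <= b -> b <= x1 -> y0 <= c -> c <= d -> d <= y1 ->
  circulation a b c d = 0.
Proof.
move=> xa ab bx yc cd dy; apply: contrapT => /eqP; rewrite -normc_gt0 => J0.
set s := b - a; set t := d - c.
have s0 : 0 <= s by rewrite subr_ge0.
have t0 : 0 <= t by rewrite subr_ge0.
(* K is small enough for the whole rectangle to exceed its threshold; the + 1 keeps the denominator
   positive when the rectangle is a point. *)
have [K K0 HK] : exists2 K : R, 0 < K & K * (s + t) ^+ 2 < normc (circulation a b c d).
  exists (normc (circulation a b c d) / (2 * ((s + t) ^+ 2 + 1))).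
    by rewrite divr_gt0// mulr_gt0// ltr_wpDl// sqr_ge0.
  rewrite mulrAC ltr_pdivrMr ?mulr_gt0 ?ltr_wpDl ?sqr_ge0// ltr_pM2l//.
  by have := sqr_ge0 (s + t); lra.
pose bad n (p : R * R) := K * (s / 2 ^+ n + t / 2 ^+ n) ^+ 2 <
  normc (circulation p.1 (p.1 + s / 2 ^+ n) p.2 (p.2 + t / 2 ^+ n)).
have sn n : 0 <= s / 2 ^+ n by rewrite divr_ge0// exprn_ge0.
have tn n : 0 <= t / 2 ^+ n by rewrite divr_ge0// exprn_ge0.
have hs (u : R) n : u / 2 ^+ n / 2 = u / 2 ^+ n.+1 by rewrite exprSr invfM mulrA.
have step n p : exists q : R * R, bad n p -> [/\ bad n.+1 q,
    p.1 <= q.1, q.1 + s / 2 ^+ n.+1 <= p.1 + s / 2 ^+ n,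
    p.2 <= q.2 & q.2 + t / 2 ^+ n.+1 <= p.2 + t / 2 ^+ n].
  have [B|] := pselect (bad n p); last by exists p.
  have [||| a' [c' [ha hc B']]] := @circulation_halve p.1 (p.1 + s / 2 ^+ n) p.2 (p.2 + t / 2 ^+ n) K.
  - by rewrite lerDl.
  - by rewrite lerDl.
  - by rewrite !(addrC p.1) !(addrC p.2) !addrK -(addrC p.1) -(addrC p.2).
  have Es : p.1 + s / 2 ^+ n - p.1 = s / 2 ^+ n by ring.
  have Et : p.2 + t / 2 ^+ n - p.2 = t / 2 ^+ n by ring.
  rewrite Es Et in ha hc B'.
  exists (a', c') => _; split; rewrite /bad /= -?hs //.
  - by case: ha => ->; rewrite ?lerDl ?divr_ge0.
  - by case: ha => ->; have := sn n; lra.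
  - by case: hc => ->; rewrite ?lerDl ?divr_ge0.
  - by case: hc => ->; have := tn n; lra.
have /choice[F HF] : forall np : nat * (R * R), exists q : R * R, bad np.1 np.2 -> [/\ bad np.1.+1 q,
    np.2.1 <= q.1, q.1 + s / 2 ^+ np.1.+1 <= np.2.1 + s / 2 ^+ np.1,
    np.2.2 <= q.2 & q.2 + t / 2 ^+ np.1.+1 <= np.2.2 + t / 2 ^+ np.1].
  by move=> -[n p]; exact: step.
(* [P n] is the lower left corner of the n-th bad rectangle, whose sides are s / 2^n and t / 2^n. *)
pose fix P n : R * R := if n is m.+1 then F (m, P m) else (a, c).
have badP n : bad n (P n).
  elim: n => [|n IH]; last by have [] := HF (n, P n) IH.
  by rewrite /bad /= !expr0 !divr1 /s /t !subrKC.
have [u Hu] : exists x, forall n, (P n).1 <= x <= (P n).1 + s / 2 ^+ n.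
  by apply: nested_point => // n; have [] := HF (n, P n) (badP n).
have [v Hv] : exists x, forall n, (P n).2 <= x <= (P n).2 + t / 2 ^+ n.
  by apply: nested_point => // n; have [] := HF (n, P n) (badP n).
have inP n : [/\ a <= (P n).1, (P n).1 + s / 2 ^+ n <= b, c <= (P n).2 & (P n).2 + t / 2 ^+ n <= d].
  elim: n => [|n [h1 h2 h3 h4]].
    by rewrite /= !expr0 !divr1 /s /t !subrKC !lexx.
  have [_ /= k1 k2 k3 k4] := HF (n, P n) (badP n).
  by split; [exact: le_trans k1|exact: le_trans k2 _|exact: le_trans k3|exact: le_trans k4 _].
have [|dz dgz] := @dg (u +i* v).
  have := Hu 0%N; have := Hv 0%N; rewrite /= !expr0 !divr1 /s /t !subrKC.
  move=> /andP[h1 h2] /andP[h3 h4]; split; apply/andP; split => /=; lra.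
(* Near the common point g is within (K / 4) |z - z0| of its affine part, which has a quadratic
   primitive. [circulation_small] then bounds the n-th circulation by half of K (s / 2^n + t /
   2^n)^2, against its choice. *)
have K4 : 0 < K / 4 by rewrite divr_gt0.
have /is_deriveCP/(_ _ K4)[r r0 Hr] := dgz.
have [n Hn] := half_lt (s + t) r0.
rewrite mulrDl in Hn.
have := badP n; rewrite /bad ltNge => /negP; apply.
have [h1 h2 h3 h4] := inP n.
set z0 : C := u +i* v.
have dP z : is_derive z (1 : C) (fun z => g z0 * z + dz / 2 * (z - z0) ^+ 2) (g z0 + dz * (z - z0)).
  apply: (@is_derive_quad R _ z _ (normc (dz / 2)) 1) => // h _.
  by rewrite -normcX -normcM; rewrite le_eqVlt; apply/orP; left; apply/eqP; congr normc; field.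
set m := K / 4 * (s / 2 ^+ n + t / 2 ^+ n).
have := @circulation_small _ _ m (P n).1 ((P n).1 + s / 2 ^+ n) (P n).2 ((P n).2 + t / 2 ^+ n) dP.
rewrite !lerDl.
move=> /(_ (le_trans xa h1) (sn n) (le_trans h2 bx) (le_trans yc h3) (tn n) (le_trans h4 dy)).
move=> H; apply: le_trans (H _) _; last first.
  have := sqr_ge0 (s / 2 ^+ n + t / 2 ^+ n); rewrite /m; nra.
move=> z [/andP[z1 z2] /andP[z3 z4]].
have zz : normc (z - z0) <= s / 2 ^+ n + t / 2 ^+ n.
  apply: le_trans (normc_le _) _; rewrite reB imB /=.
  have /andP[? ?] := Hu n; have /andP[? ?] := Hv n.
  by apply: lerD; rewrite ler_norml; apply/andP; split; lra.
have := Hr (z - z0) (le_lt_trans zz Hn); rewrite subrKC => /le_trans; rewrite opprD addrA; apply.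
by rewrite /m ler_wpM2l// ltW.
Qed.

(** The integral of g from (x0, y0) along the bottom side and then straight up. *)
Let F z := (U (re z) y0 - U x0 y0) + ii * (V (re z) (im z) - V (re z) y0).

(** By Goursat's lemma F is also obtained by going up the left side first. Combining both
    expressions, F (z + h) - F z is the integral over a horizontal segment from z followed by a
    vertical one to z + h, along which g is close to g z. *)
Lemma primitive_derive z : x0 < re z < x1 -> y0 < im z < y1 ->
  is_derive z (1 : C) F (g z).
Proof.
case: z => x y /= /andP[zx0 zx1] /andP[zy0 zy1]; apply/is_deriveCP => e e0.
have zin : in_rect x0 x1 y0 y1 (x +i* y) by split; apply/andP; split; exact: ltW.
have [d /cont_is_derive] := dg zin.
have e2 : 0 < e / 2 by rewrite divr_gt0.
move=> /(_ _ e2)[r r0 Hr].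
exists (Num.min (r / 2) (Num.min (Num.min (x - x0) (x1 - x)) (Num.min (y - y0) (y1 - y)))).
  by rewrite !lt_min !subr_gt0 zx0 zx1 zy0 zy1 divr_gt0.
move=> h; rewrite !lt_min => /and3P[hr /andP[hx0 hx1] /andP[hy0 hy1]].
have [N NE] : exists N, normc h = N by exists (normc h).
have := normc_re h; have := normc_im h; rewrite NE in hr hx0 hx1 hy0 hy1 *.
have [s [t ->]] : exists s t, h = s +i* t by case: h {NE} => s t; exists s, t.
rewrite !ler_norml /= => /andP[t1 t2] /andP[s1 s2].
have F2 a b : x0 <= a <= x1 -> y0 <= b <= y1 ->
    (U a y0 - U x0 y0) + ii * (V a b - V a y0) = ii * (V x0 b - V x0 y0) + (U a b - U x0 b).
  move=> /andP[a0 a1] /andP[b0 b1].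
  have := @goursat x0 a y0 b (lexx _) a0 a1 (lexx _) b0 b1; rewrite /circulation => E.
  by apply/eqP; rewrite -subr_eq0 -E; apply/eqP; ring.
have -> : F ((x +i* y) + (s +i* t)) - F (x +i* y) =
    ii * (V (x + s) (y + t) - V (x + s) y) + (U (x + s) y - U x y).
  have xin : x0 <= x <= x1 by apply/andP; split; lra.
  have xsin : x0 <= x + s <= x1 by apply/andP; split; lra.
  have yin : y0 <= y <= y1 by apply/andP; split; lra.
  have /eqP := F2 _ _ xin yin; rewrite -subr_eq0 => /eqP E1.
  have /eqP := F2 _ _ xsin yin; rewrite -subr_eq0 => /eqP E2.
  apply/eqP; rewrite -subr_eq0 -(subr0 0) -[X in _ == X - _]E2 -E1; apply/eqP.
  by rewrite /F /=; ring.
have gE a b : x0 <= a <= x1 -> y0 <= b <= y1 -> gt a b = g (a +i* b).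
  by move=> a01 b01; rewrite /gt !clamp_id.
have close a b : `|a - x| <= N -> `|b - y| <= N -> normc (g (a +i* b) - g (x +i* y)) <= e / 2.
  move=> aN bN; rewrite -(subrKC (x +i* y : C) (a +i* b)); apply/ltW/Hr.
  apply: le_lt_trans (normc_le _) _; rewrite reB imB /=.
  by apply: le_lt_trans (lerD aN bN) _; move: hr; lra.
have hV : normc (V (x + s) (y + t) - V (x + s) y - g (x +i* y) * t%:C) <= e / 2 * N.
  have := @vderive_mvt_dist R (fun b => V (x + s) b - g (x +i* y) * b%:C)
    (fun b => gt (x + s) b - g (x +i* y)) y (y + t) (e / 2).
  have -> : V (x + s) (y + t) - g (x +i* y) * (y + t)%:C - (V (x + s) y - g (x +i* y) * y%:C) =
     V (x + s) (y + t) - V (x + s) y - g (x +i* y) * t%:C by rewrite rmorphD; ring.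
  move=> H; apply: le_trans (H _ _) _.
  - move=> b; rewrite ge_min le_max => hb; apply: vderiveB (vderive_lin _ _).
    by apply: HV; case/andP: hb => /orP[] ? /orP[] ?; apply/andP; split; lra.
  - move=> b; rewrite ge_min le_max => hb.
    have [h1 h2 h3 h4] : [/\ y0 <= b, b <= y1, b - y <= N & - N <= b - y].
      by case/andP: hb => /orP[] ? /orP[] ?; split; lra.
    rewrite gE ?h1 ?h2//; last by apply/andP; split; lra.
    by apply: close; rewrite ler_norml; apply/andP; split; lra.
  - rewrite ler_wpM2l ?(ltW e2)// (_ : y + t - y = t) ?ler_norml ?t1//; last by ring.
have hU : normc (U (x + s) y - U x y - g (x +i* y) * s%:C) <= e / 2 * N.
  have := @vderive_mvt_dist R (fun a => U a y - g (x +i* y) * a%:C)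
    (fun a => gt a y - g (x +i* y)) x (x + s) (e / 2).
  have -> : U (x + s) y - g (x +i* y) * (x + s)%:C - (U x y - g (x +i* y) * x%:C) =
     U (x + s) y - U x y - g (x +i* y) * s%:C by rewrite rmorphD; ring.
  move=> H; apply: le_trans (H _ _) _.
  - move=> a; rewrite ge_min le_max => ha; apply: (vderiveB (g := U^~ y)) (vderive_lin _ _).
    by apply: HU; case/andP: ha => /orP[] ? /orP[] ?; apply/andP; split; lra.
  - move=> a; rewrite ge_min le_max => ha.
    have [h1 h2 h3 h4] : [/\ x0 <= a, a <= x1, a - x <= N & - N <= a - x].
      by case/andP: ha => /orP[] ? /orP[] ?; split; lra.
    rewrite gE ?h1 ?h2//; last by apply/andP; split; lra.
    by apply: close; rewrite ler_norml; apply/andP; split; lra.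
  - rewrite ler_wpM2l ?(ltW e2)// (_ : x + s - x = s) ?ler_norml ?s1//; last by ring.
have -> : ii * (V (x + s) (y + t) - V (x + s) y) + (U (x + s) y - U x y) - g (x +i* y) * (s +i* t) =
  ii * (V (x + s) (y + t) - V (x + s) y - g (x +i* y) * t%:C) + (U (x + s) y - U x y - g (x +i* y) * s%:C).
  by rewrite [(s +i* t : C)]complexE /=; ring.
apply: le_trans (normcD _ _) _; rewrite normcM (_ : normc ii = 1) ?mul1r; last by rewrite /= expr0n expr1n add0r sqrtr1.
by rewrite [e in leRHS]splitr mulrDl; apply: lerD.
Qed.

End Goursat.

Lemma exists_primitive g (x0 x1 y0 y1 : R) : x0 <= x1 -> y0 <= y1 ->
  (forall z, in_rect x0 x1 y0 y1 z -> exists d, is_derive z (1 : C) g d) ->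
  exists F : C -> C, forall z, x0 < re z < x1 -> y0 < im z < y1 -> is_derive z (1 : C) F (g z).
Proof.
move=> x01 y01 dg; have [U [V [HU HV]]] := exists_sides x01 y01 dg.
by eexists => z zx zy; exact: (primitive_derive dg HU HV zx zy).
Qed.

End Rectangles.

(** * Maximum principle on squares *)

Section MaximumModulus.
Variable R : realType.
Local Notation C := (Cplx R).
Local Notation re := (@complex.Re R).
Local Notation im := (@complex.Im R).
Implicit Types (z w h d : C) (f g : C -> C).

Local Notation ii := (0 +i* 1 : C).

(** The sup norm of the plane. Its balls are the squares on which [exists_primitive] supplies
    primitives. *)
Definition snorm z : R := Num.max `|re z| `|im z|.

Lemma snorm_le z (r : R) : (snorm z <= r) = (`|re z| <= r) && (`|im z| <= r).
Proof. by rewrite /snorm ge_max. Qed.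

Lemma snorm_lt z (r : R) : (snorm z < r) = (`|re z| < r) && (`|im z| < r).
Proof. by rewrite /snorm gt_max. Qed.

Lemma snorm0 : snorm 0 = 0.
Proof. by rewrite /snorm /= normr0 maxxx. Qed.

Lemma snorm_normc z : snorm z <= normc z.
Proof. by rewrite snorm_le normc_re normc_im. Qed.

Lemma normc_snorm z : normc z <= 2 * snorm z.
Proof.
apply: le_trans (normc_le _) _; rewrite mulr_natl mulr2n.
by have := lexx (snorm z); rewrite {1}snorm_le => /andP[]; exact: lerD.
Qed.

Lemma snormD z w : snorm (z + w) <= snorm z + snorm w.
Proof.
have := lexx (snorm z); rewrite {1}snorm_le => /andP[a b].
have := lexx (snorm w); rewrite {1}snorm_le => /andP[c d].
rewrite snorm_le reD imD; apply/andP; split; apply: le_trans (ler_normD _ _) _; exact: lerD.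
Qed.

Lemma snormN z : snorm (- z) = snorm z.
Proof. by rewrite /snorm; case: z => a b /=; rewrite !normrN. Qed.

Lemma square_max (u : C -> R) c (r : R) : 0 <= r ->
  (forall z, snorm (z - c) <= r -> forall e : R, 0 < e -> exists2 d : R, 0 < d &
    forall w, normc (w - z) < d -> `|u w - u z| < e) ->
  exists2 z1, snorm (z1 - c) <= r & forall z, snorm (z - c) <= r -> u z <= u z1.
Proof.
move=> r0 cu; case: c cu => a b cu.
pose A : set (R * R) := `[a - r, a + r]%classic `*` `[b - r, b + r]%classic.
have inA x y : A (x, y) <-> snorm ((x +i* y) - (a +i* b)) <= r.
  rewrite /A /= !in_itv /= snorm_le reB imB /= !ler_norml; split.
    by move=> [/andP[? ?] /andP[? ?]]; apply/andP; split; apply/andP; split; lra.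
  by move=> /andP[/andP[? ?] /andP[? ?]]; split; apply/andP; split; lra.
have [|||p] := @compact_EVT_max _ R (fun p : R * R => u (p.1 +i* p.2)) A.
- by exists (a, b); apply/inA; rewrite subrr snorm0.
- by apply: compact_setX; exact: segment_compact.
- apply: continuous_in_subspaceT => -[x y]; rewrite inE => /inA /cu H.
  apply/(@cvgrPdist_lt _ R) => e /H[d d0 K].
  have d2 : 0 < d / 2 by rewrite divr_gt0.
  exists (ball x (d / 2), ball y (d / 2)) => [|[x' y'] [/= h1 h2]].
    by split; exact: nbhsx_ballx.
  rewrite distrC; apply: K; apply: le_lt_trans (normc_le _) _; rewrite reB imB /=.
  rewrite (splitr d); apply: ltrD; rewrite distrC; exact.
case: p => x y; rewrite inE => /inA h1 h2; exists (x +i* y) => // -[x' y'] h.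
by apply: (h2 (x', y')); rewrite inE; apply/inA.
Qed.

(** The mean value inequality for f w - df z * w - d / 2 * (w - z)^2, whose derivative is the
    first-order error of df at z. *)
Lemma taylor2 f (df : C -> C) z d (r0 : R) : 0 < r0 ->
  (forall w, normc (w - z) < r0 -> is_derive w (1 : C) f (df w)) ->
  is_derive z (1 : C) df d ->
  forall e : R, 0 < e -> exists2 r : R, 0 < r &
  forall h, normc h < r ->
    normc (f (z + h) - f z - df z * h - d / 2 * h ^+ 2) <= e * normc h ^+ 2.
Proof.
move=> r00 Hf /is_deriveCP Hd e e0; have [r r0' H] := Hd e e0.
exists (Num.min r0 r) => [|h]; first by rewrite lt_min r00.
rewrite lt_min => /andP[h1 h2].
have tn (t : R) : 0 <= t <= 1 -> normc (t%:C * h) <= normc h.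
  by move=> /andP[t0 t1]; rewrite normcM normc_real ger0_norm// ler_piMl// normc_ge0.
have := @is_derive_mvt R (fun w => f w - df z * w - d / 2 * (w - z) ^+ 2)
  (fun w => df w - df z - d * (w - z)) z h (e * normc h).
have -> : f (z + h) - df z * (z + h) - d / 2 * (z + h - z) ^+ 2 - (f z - df z * z - d / 2 * (z - z) ^+ 2)
  = f (z + h) - f z - df z * h - d / 2 * h ^+ 2 by ring.
rewrite (_ : e * normc h ^+ 2 = e * normc h * normc h); last by rewrite expr2 mulrA.
apply.
  move=> t t01; have D : is_derive (z + t%:C * h) (1 : C) f (df (z + t%:C * h)).
    by apply: Hf; rewrite addrC addKr (le_lt_trans (tn t t01)).
  have D2 : is_derive (z + t%:C * h) (1 : C) (fun w => df z * w + d / 2 * (w - z) ^+ 2) (df z + d * (z + t%:C * h - z)).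
    apply: (@is_derive_quad R _ _ _ (normc (d / 2)) 1) => // k _.
    by rewrite -normcX -normcM le_eqVlt; apply/orP; left; apply/eqP; congr normc; field.
  by apply: is_derive_eqfun (is_deriveB D D2) _ _ => [w|]; rewrite ?fctE opprD addrA.
move=> t t01; have := H (t%:C * h) (le_lt_trans (tn t t01) h2).
rewrite [X in df X - _ - _]addrC [z + _]addrC addrK => /le_trans; apply.
by rewrite ler_wpM2l ?tn// ltW.
Qed.

(* If |f z0| > B inside the square, then Re (conj (f z0) f z) + e |z - c|^2 has an interior
   maximum for small e > 0, where the sum of its values at four symmetric neighbours
   contradicts the harmonicity of the real part of f. *)
Lemma max_modulus_twice f (df : C -> C) c (r r' B : R) : 0 <= r -> r < r' -> 0 <= B ->
  (forall z, snorm (z - c) < r' -> is_derive z (1 : C) f (df z)) ->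
  (forall z, snorm (z - c) < r' -> exists d, is_derive z (1 : C) df d) ->
  (forall z, snorm (z - c) = r -> normc (f z) <= B) ->
  forall z, snorm (z - c) <= r -> normc (f z) <= B.
Proof.
move=> r0 rr' B0 Df Ddf HB z0 z0r; rewrite leNgt; apply/negP => fz0.
set u0 := f z0 in fz0.
have u00 : 0 < normc u0 by exact: le_lt_trans fz0.
have gap : 0 < normc u0 ^+ 2 - normc u0 * B.
  by rewrite expr2 -mulrBr mulr_gt0 ?subr_gt0.
pose q z := re (z - c) ^+ 2 + im (z - c) ^+ 2.
have q0 z : 0 <= q z by rewrite addr_ge0 ?sqr_ge0.
have qr z : snorm (z - c) <= r -> q z <= 2 * r ^+ 2.
  rewrite snorm_le => /andP[h1 h2]; rewrite mulr_natl mulr2n /q.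
  by apply: lerD; rewrite -real_normK ?num_real// ler_sqr ?nnegrE.
have qq z : q z = normc (z - c) ^+ 2.
  by rewrite /q; case: (z - c) => a b /=; rewrite sqr_sqrtr ?addr_ge0 ?sqr_ge0.
have r20 : 0 < 2 * r ^+ 2 + 1 by rewrite ltr_wpDl// mulr_ge0 ?sqr_ge0.
(* On the square q is at most 2 r^2, so e * q stays below the gap |u0|^2 - |u0| B; the + 1 covers r
   = 0. *)
pose e := (normc u0 ^+ 2 - normc u0 * B) / (2 * r ^+ 2 + 1).
have e0 : 0 < e by rewrite divr_gt0.
have er : e * (2 * r ^+ 2) < normc u0 ^+ 2 - normc u0 * B.
  by rewrite /e mulrAC ltr_pdivrMr// ltr_pM2l// ltrDl.
pose u z := re (u0^* * f z) + e * q z.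
have reu w : re (u0^* * w) <= normc u0 * normc w.
  apply: le_trans (ler_norm _) _; apply: le_trans (normc_re _) _.
  by rewrite normcM (re_conjc_mul u0).2.
have [z1 z1r z1max] : exists2 z1, snorm (z1 - c) <= r & forall z, snorm (z - c) <= r -> u z <= u z1.
  apply: square_max => // z zr k k0.
  have [d dz] : exists d, is_derive z (1 : C) (fun w => u0^* * f w) d.
    exists (u0^* * df z); have D := Df z (le_lt_trans zr rr').
    exact: is_deriveZ.
  have k2 : 0 < k / 2 by rewrite divr_gt0.
  have [r1 r10 H1] := cont_is_derive dz k2.
  have k3 : 0 < k / 2 / e by rewrite divr_gt0.
  have [r2 r20' H2] : exists2 r2 : R, 0 < r2 & forall h, normc h < r2 -> `|q (z + h) - q z| < k / 2 / e.
    pose Q := 2 * normc (z - c) + 1.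
    have Q0 : 0 < Q by rewrite /Q ltr_wpDl// mulr_ge0// normc_ge0.
    exists (Num.min 1 (k / 2 / e / Q)) => [|h]; first by rewrite lt_min ltr01 divr_gt0.
    rewrite lt_min ltr_pdivlMr// => /andP[h1 h2]; apply: le_lt_trans h2.
    have -> : q (z + h) - q z = 2 * (re (z - c) * re h + im (z - c) * im h) + (re h ^+ 2 + im h ^+ 2).
      by rewrite /q !(reB, imB, reD, imD); ring.
    have -> : re (z - c) * re h + im (z - c) * im h = re ((z - c)^* * h).
      by case: (z - c) h {h1} => a b [a' b'] /=; ring.
    have -> : re h ^+ 2 + im h ^+ 2 = normc h ^+ 2.
      by case: h {h1} => a b /=; rewrite sqr_sqrtr ?addr_ge0 ?sqr_ge0.
    apply: le_trans (ler_normD _ _) _; rewrite normrM normr_nat (ger0_norm (sqr_ge0 _)).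
    rewrite /Q mulrDr mulr1; apply: lerD.
      rewrite mulrCA ler_wpM2l//; apply: le_trans (normc_re _) _.
      by rewrite normcM (re_conjc_mul _).2 mulrC.
    by rewrite expr2 ler_piMl ?normc_ge0// ltW.
  exists (Num.min r1 r2) => [|w]; first by rewrite lt_min r10.
  rewrite lt_min => /andP[/H1 h1 /H2 h2].
  rewrite subrKC in h1 h2; rewrite /u.
  rewrite (_ : _ - _ = re (u0^* * f w - u0^* * f z) + e * (q w - q z)); last by rewrite reB; ring.
  apply: le_lt_trans (ler_normD _ _) _; rewrite (splitr k); apply: ltrD.
    exact: le_lt_trans (normc_re _) h1.
  by rewrite normrM (gtr0_norm e0) mulrC -ltr_pdivlMr.
have uz1 : normc u0 ^+ 2 <= u z1.
  apply: le_trans (z1max _ z0r); rewrite /u (re_conjc_mul u0).1.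
  by rewrite lerDl mulr_ge0// ltW.
(* On the boundary u is at most |u0| B + 2 e r^2, which is less than |u0|^2 <= u z1; so the maximum
   is interior. *)
have [z1b|z1i] := eqVneq (snorm (z1 - c)) r.
  move: uz1; apply/negP; rewrite -ltNge /u.
  have := reu (f z1); have := HB _ z1b; have := qr _ z1r => h1 h2 h3.
  have : normc u0 * normc (f z1) <= normc u0 * B by rewrite ler_wpM2l// ltW.
  have : e * q z1 <= e * (2 * r ^+ 2) by rewrite ler_wpM2l// ltW.
  lra.
have {}z1i : snorm (z1 - c) < r by rewrite lt_neqAle z1i.
have [d dz1] := Ddf _ (lt_trans z1i rr').
(* Four Taylor errors of this size, multiplied by |u0|, cost 2 e t^2, half of the gain 4 e t^2 that
   e * q makes at the four neighbours. *)
have eps0 : 0 < e / (normc u0 * 2) by rewrite divr_gt0// mulr_gt0.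
have gr : 0 < r - snorm (z1 - c) by rewrite subr_gt0.
have [|k k0 Hk] := @taylor2 f df z1 d _ gr _ dz1 _ eps0.
  move=> w wz; apply: Df; apply: lt_trans rr'.
  have -> : w - c = (w - z1) + (z1 - c) by ring.
  apply: le_lt_trans (snormD _ _) _.
  by rewrite -ltrBrDr (le_lt_trans (snorm_normc _)).
pose t := Num.min (k / 2) ((r - snorm (z1 - c)) / 2).
have t0 : 0 < t by rewrite lt_min !divr_gt0.
have tk : t < k.
  by rewrite gt_min; apply/orP; left; rewrite ltr_pdivrMr// mulr_natr mulr2n ltrDl.
have tr : t <= r - snorm (z1 - c).
  by rewrite ge_min; apply/orP; right; rewrite ler_pdivrMr// mulr_natr mulr2n lerDl ltW.
have mx h : normc h = t -> u (z1 + h) <= u z1.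
  move=> ht; apply: z1max; rewrite addrAC; apply: le_trans (snormD _ _) _.
  by rewrite -lerBrDl; apply: le_trans (snorm_normc _) _; rewrite ht.
have nt : normc t%:C = t by rewrite normc_real ger0_norm// ltW.
have nii : normc ii = 1 by rewrite /= expr0n expr1n add0r sqrtr1.
have E1 : normc (- t%:C) = t by rewrite normcN.
have E2 : normc (ii * t%:C) = t by rewrite normcM nii nt mul1r.
have E3 : normc (- (ii * t%:C)) = t by rewrite normcN.
have i2 : ii ^+ 2 = -1 :> C by rewrite sqr_i.
pose T h := f (z1 + h) - f z1 - df z1 * h - d / 2 * h ^+ 2.
(* Over the directions 1, -1, i, -i both h and h^2 sum to zero, so only the Taylor remainders are
   left. *)
have S : f (z1 + t%:C) + f (z1 - t%:C) + f (z1 + ii * t%:C) + f (z1 - ii * t%:C) - 4 * f z1 =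
   T t%:C + T (- t%:C) + T (ii * t%:C) + T (- (ii * t%:C)).
  by rewrite /T !(sqrrN, exprMn) i2; ring.
have NT h : normc h = t -> normc (T h) <= e / (normc u0 * 2) * t ^+ 2.
  by move=> ht; rewrite -ht; apply: Hk; rewrite ht.
have := mx _ nt; have := mx _ E1; have := mx _ E2; have := mx _ E3; rewrite /u => m1 m2 m3 m4.
have Q : q (z1 + t%:C) + q (z1 - t%:C) + q (z1 + ii * t%:C) + q (z1 - ii * t%:C) - 4 * q z1 = 4 * t ^+ 2.
  by rewrite /q !(reB, imB, reD, imD) /=; ring.
have RS : - (4 * normc u0 * (e / (normc u0 * 2) * t ^+ 2)) <=
   re (u0^* * (f (z1 + t%:C) + f (z1 - t%:C) + f (z1 + ii * t%:C) + f (z1 - ii * t%:C) - 4 * f z1)).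
  rewrite S; set W := _ + T _; have : normc W <= 4 * (e / (normc u0 * 2) * t ^+ 2).
    rewrite (_ : 4 * _ = e / (normc u0 * 2) * t ^+ 2 + e / (normc u0 * 2) * t ^+ 2 +
     e / (normc u0 * 2) * t ^+ 2 + e / (normc u0 * 2) * t ^+ 2); last by ring.
    rewrite /W; do 3 (apply: le_trans (normcD _ _) _; apply: lerD; last exact: NT).
    exact: NT.
  move=> HW; rewrite lerNl; apply: le_trans (ler_norm _) _; rewrite normrN.
  apply: le_trans (normc_re _) _; rewrite normcM (re_conjc_mul u0).2.
  rewrite (_ : 4 * normc u0 * _ = normc u0 * (4 * (e / (normc u0 * 2) * t ^+ 2))); last by ring.
  by rewrite ler_wpM2l ?normc_ge0.
have u0E : 4 * normc u0 * (e / (normc u0 * 2) * t ^+ 2) = 2 * e * t ^+ 2.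
  by field; rewrite gt_eqF.
have re4 w : re (4 * w) = 4 * re w.
  by rewrite -[4 in LHS](rmorph_nat (real_complex R)) mulrC reMr mulrC.
rewrite u0E !mulrBr !mulrDr !reB !reD [u0^* * (4 * _)]mulrCA re4 in RS.
have {Q} : e * (q (z1 + t%:C) + q (z1 - t%:C) + q (z1 + ii * t%:C) + q (z1 - ii * t%:C) - 4 * q z1) = e * (4 * t ^+ 2) by rewrite Q.
have : 0 < e * t ^+ 2 by rewrite mulr_gt0// exprn_gt0.
clear -RS m1 m2 m3 m4.
lra.
Qed.

End MaximumModulus.

(** * Cauchy estimates and the identity principle *)

Section CauchyEstimates.
Variable R : realType.
Local Notation C := (Cplx R).
Local Notation re := (@complex.Re R).
Local Notation im := (@complex.Im R).
Implicit Types (z w h d : C) (f g : C -> C).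

Lemma is_derive_shiftC f z h d : is_derive (z + h) (1 : C) f d ->
  is_derive z (1 : C) (fun w => f (w + h)) d.
Proof.
move=> /is_deriveCP H; apply/is_deriveCP => e /H[r r0 K]; exists r => // k /K.
by rewrite (addrAC z).
Qed.

Lemma is_derive_bound f z d (r B : R) : 0 < r -> is_derive z (1 : C) f d ->
  (forall h, normc h < r -> normc (f (z + h) - f z) <= B * normc h) -> normc d <= B.
Proof.
move=> r0 /is_deriveCP D H; apply/ler_addgt0Pr => e /[dup] e0 /D[r1 r10 K].
pose t := Num.min (r / 2) (r1 / 2).
have t0 : 0 < t by rewrite lt_min !divr_gt0.
have nt : normc t%:C = t by rewrite normc_real ger0_norm// ltW.
have tr : t < r by rewrite gt_min ltr_pdivrMr// mulr_natr mulr2n ltrDl r0.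
have tr1 : t < r1 by rewrite gt_min !ltr_pdivrMr// !mulr_natr !mulr2n !ltrDl r10 orbT.
have := H t%:C; have := K t%:C; rewrite nt => /(_ tr1) h1 /(_ tr) h2.
rewrite -(ler_pM2r t0) mulrDl -{1}nt -normcM.
have -> : d * t%:C = (f (z + t%:C) - f z) - (f (z + t%:C) - f z - d * t%:C) by ring.
by apply: le_trans (normcD _ _) _; rewrite normcN; apply: lerD.
Qed.

(* The increments F (z + h) - F z of a primitive of g are twice differentiable, and they are
   bounded by M |h| on the collar. *)
Lemma max_modulus g c (r r' M : R) : 0 <= r' -> r' < r -> 0 <= M ->
  (forall z, snorm (z - c) < r -> exists d, is_derive z (1 : C) g d) ->
  (forall z, r' <= snorm (z - c) < r -> normc (g z) <= M) ->
  forall z, snorm (z - c) < r -> normc (g z) <= M.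
Proof.
move=> r'0 r'r M0 dg HM z0 z0r.
have [?|z0r'] := leP r' (snorm (z0 - c)); first by apply: HM; apply/andP.
(* The collar is cut into six strips of width eta. F is a primitive up to r' + 4 eta, the square has
   radius r' + 2 eta, and a segment shorter than eta issuing from its boundary stays in the
   collar. *)
pose eta := (r - r') / 6; have eta0 : 0 < eta by rewrite divr_gt0// subr_gt0.
have rE : r = r' + 6 * eta by rewrite /eta; field.
have [F HF] : exists F : C -> C, forall z, snorm (z - c) < r' + 4 * eta -> is_derive z (1 : C) F (g z).
  pose s := r' + 4 * eta; have s0 : 0 <= s by rewrite /s; lra.
  have [|||F HF] := @exists_primitive R g (re c - s) (re c + s) (im c - s) (im c + s).
  - by lra.
  - by lra.
  - move=> z [/andP[h1 h2] /andP[h3 h4]]; apply: dg.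
    rewrite snorm_lt reB imB !ltr_norml rE; rewrite /s in h1 h2 h3 h4.
    by apply/andP; split; apply/andP; split; lra.
  exists F => z; rewrite snorm_lt reB imB !ltr_norml -/s => /andP[/andP[? ?] /andP[? ?]].
  by apply: HF; apply/andP; split; lra.
have dF := HF z0; apply: (is_derive_bound eta0 (HF z0 _)) => [|h hh]; first lra.
have sh z : snorm (z + h - c) <= snorm (z - c) + normc h.
  by rewrite addrAC; apply: le_trans (snormD _ _) _; rewrite lerD2l snorm_normc.
apply: (@max_modulus_twice R (fun z => F (z + h) - F z) (fun z => g (z + h) - g z) c (r' + 2 * eta) (r' + 3 * eta)).
- by lra.
- by lra.
- by rewrite mulr_ge0// normc_ge0.
- move=> z zr; apply: is_deriveB; first by apply/is_derive_shiftC/HF; have := sh z; lra.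
  by apply: HF; lra.
- move=> z zr; have [|d1 D1] := dg (z + h); first by have := sh z; lra.
  have [|d2 D2] := dg z; first by lra.
  by exists (d1 - d2); apply: is_deriveB => //; exact: is_derive_shiftC.
- move=> z zr; apply: (@is_derive_mvt R F g).
    move=> t /andP[t0 t1]; apply: HF.
    have : normc (t%:C * h) <= normc h.
      by rewrite normcM normc_real ger0_norm// ler_piMl// normc_ge0.
    have := snormD (z - c) (t%:C * h); have := snorm_normc (t%:C * h).
    rewrite (addrAC z); lra.
  move=> t /andP[t0 t1]; apply: HM.
  have : normc (t%:C * h) <= normc h.
    by rewrite normcM normc_real ger0_norm// ler_piMl// normc_ge0.
  have := snormD (z - c) (t%:C * h); have := snorm_normc (t%:C * h).
  have := snormD (z - c + t%:C * h) (- (t%:C * h)); rewrite addrK snormN.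
  rewrite (addrAC z) => h1 h2 h3 h4.
  apply/andP; split; lra.
- by lra.
Qed.

Lemma bernoulli (x : R) n : 0 <= x -> 1 + n%:R * x <= (1 + x) ^+ n.
Proof.
move=> x0; elim: n => [|n IH]; first by rewrite mul0r addr0 expr0.
rewrite exprS; apply: le_trans (ler_wpM2l _ IH); last by rewrite addr_ge0.
rewrite mulrDl mul1r mulrDr mulr1 -natr1 mulrDl mul1r addrA lerD2l.
by rewrite lerDl mulr_ge0// mulr_ge0.
Qed.

(** Taking n-th roots for large n removes the constants k and K; Bernoulli's inequality makes this
    quantitative. *)
Lemma pow_le_bound (a b k K : R) : 0 <= b -> 0 < k ->
  (forall n, a ^+ n * k <= b ^+ n * K) -> a <= b.
Proof.
move=> b0 k0 H; rewrite leNgt; apply/negP => ba.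
have a0 : 0 < a by exact: le_lt_trans ba.
have K0 : 0 < K by have := H 0%N; rewrite !expr0 !mul1r; exact: lt_le_trans.
have [b1|b1] := eqVneq b 0.
  by have := H 1%N; rewrite !expr1 b1 mul0r leNgt mulr_gt0.
have {}b0 : 0 < b by rewrite lt_def b1.
pose x := a / b - 1; have x0 : 0 < x by rewrite subr_gt0 ltr_pdivlMr// mul1r.
pose n := Num.bound `|K / k / x|.
have Hn : K / k / x < n%:R := le_lt_trans (ler_norm _) (archi_boundP (normr_ge0 _)).
have := H n; rewrite leNgt => /negP; apply.
have aE : a = b * (1 + x) by rewrite /x subrKC mulrC divfK.
rewrite aE exprMn -mulrA ltr_pM2l ?exprn_gt0// -ltr_pdivrMr//.
apply: lt_le_trans (bernoulli n (ltW x0)).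
by rewrite ltr_pdivrMr// in Hn; rewrite (lt_le_trans Hn)// lerDr.
Qed.

Lemma derivable_pow f n z : derivable f z (1 : C) -> derivable (fun w => f w ^+ n) z (1 : C).
Proof.
move=> df; elim: n => [|n IH].
  have -> : (fun w => f w ^+ 0) = cst 1 by apply/funext => w; rewrite expr0.
  exact: derivable_cst.
have -> : (fun w => f w ^+ n.+1) = (fun w => f w * f w ^+ n).
  by apply/funext => w; rewrite exprS.
exact: (@derivableM _ _ f (fun w => f w ^+ n) z 1 df IH).
Qed.

(* The maximum principle is applied to ((g z - g c) / (z - c))^n (z - c)^2, which is derivable
   also at c; then n -> oo. *)
Lemma cauchy_estimate g c (r M : R) : 0 < r ->
  (forall z, snorm (z - c) < r -> derivable g z (1 : C)) ->
  (forall z, snorm (z - c) < r -> normc (g z) <= M) ->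
  normc ('D_(1 : C) g c) <= 4 * M / r.
Proof.
move=> r0 dg HM.
have c0 : snorm (c - c) < r by rewrite subrr snorm0.
have M0 : 0 <= M := le_trans (normc_ge0 _) (HM c c0).
have D := derivableP (dg c c0).
apply: (is_derive_bound r0 D) => h hr.
have [->|h0] := eqVneq h 0; first by rewrite addr0 subrr normc0 mulr0.
pose q z := (g z - g c) / (z - c).
have nh : 0 < normc h by rewrite normc_gt0.
suff : normc (q (c + h)) <= 4 * M / r.
  by rewrite /q [c + h - c]addrC addKr normcM normcV ler_pdivrMr.
apply: (@pow_le_bound _ _ (normc h ^+ 2) (4 * r ^+ 2)).
- by rewrite divr_ge0 ?mulr_ge0// ltW.
- by rewrite exprn_gt0.
move=> n.
(* On the collar r / 2 <= snorm (z - c) < r the quotient is at most 2 M / (r / 2), and |z - c| <= 2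
   snorm (z - c) < 2 r accounts for the factor 4 r^2. *)
have := @max_modulus (fun z => q z ^+ n * (z - c) ^+ 2) c r (r / 2) ((4 * M / r) ^+ n * (4 * r ^+ 2)).
move=> H; have := H _ _ _ _ _ (c + h).
rewrite normcM !normcX [c + h - c]addrC addKr; apply.
- by rewrite divr_ge0// ltW.
- by rewrite ltr_pdivrMr// mulr_natr mulr2n ltrDl.
- rewrite mulr_ge0 ?exprn_ge0 ?divr_ge0 ?mulr_ge0 ?exprn_ge0//; exact: ltW.
- move=> z zr; suff Hd : derivable (fun z => q z ^+ n * (z - c) ^+ 2) z (1 : C).
    by exists ('D_(1 : C) (fun z => q z ^+ n * (z - c) ^+ 2) z); exact: derivableP.
  (* Near c the quotient is bounded by |g'(c)| + 1 and (z - c)^2 makes the product quadratically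
     small, so its derivative at c is 0. *)
  have [->|zc] := eqVneq z c.
    have /is_deriveCP/(_ 1 ltr01)[r1 r10 K] := D.
    suff [] : is_derive c (1 : C) (fun z => q z ^+ n * (z - c) ^+ 2) 0 by [].
    apply: (@is_derive_quad R _ _ _ ((normc ('D_(1 : C) g c) + 1) ^+ n) r1) => // k kr1.
    rewrite subrr mul0r subr0 [_ * 0 ^+ 2]mulrC expr0n mul0r subr0.
    have -> : c + k - c = k by ring.
    rewrite normcM !normcX ler_wpM2r ?exprn_ge0 ?normc_ge0//.
    rewrite lerXn2r ?nnegrE ?normc_ge0 ?addr_ge0 ?normc_ge0//.
    rewrite /q [c + k - c]addrC addKr normcM normcV.
    have [->|k0] := eqVneq k 0; first by rewrite normc0 invr0 mulr0 addr_ge0 ?normc_ge0.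
    rewrite ler_pdivrMr ?normc_gt0// mulrDl mul1r -normcM.
    have -> : g (c + k) - g c = 'D_(1 : C) g c * k + (g (c + k) - g c - 'D_(1 : C) g c * k) by ring.
    apply: le_trans (normcD _ _) _; rewrite lerD2l.
    by have := K k kr1; rewrite mul1r.
  have dzc : derivable (fun w => w - c) z (1 : C).
    by apply: derivableB; [exact: derivable_id|exact: derivable_cst].
  have dq : derivable q z (1 : C).
    apply: (@derivableM _ _ (fun w => g w - g c) (fun w => (w - c)^-1)).
      by apply: derivableB; [exact: dg|exact: derivable_cst].
    by apply: (@derivableV _ _ (fun w => w - c)) => //; rewrite subr_eq0.
  by apply: (@derivableM _ _ (fun w => q w ^+ n) (fun w => (w - c) ^+ 2)); exact: derivable_pow.
- move=> z /andP[z1 z2]; rewrite normcM !normcX.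
  have z0 : 0 < snorm (z - c) by apply: lt_le_trans z1; rewrite divr_gt0.
  apply: ler_pM; rewrite ?exprn_ge0 ?normc_ge0//.
    rewrite lerXn2r ?nnegrE ?normc_ge0//; first by rewrite divr_ge0 ?mulr_ge0// ltW.
    have nz : 0 < normc (z - c) by apply: lt_le_trans z0 _; exact: snorm_normc.
    rewrite /q normcM normcV ler_pdivrMr//.
    apply: le_trans (normcD _ _) _; rewrite normcN.
    apply: le_trans (lerD (HM _ z2) (HM _ c0)) _.
    have h2 : r / 2 <= normc (z - c) by apply: le_trans z1 _; exact: snorm_normc.
    rewrite (_ : M + M = 4 * M / r * (r / 2)); last by field; rewrite gt_eqF.
    by rewrite ler_wpM2l// divr_ge0 ?mulr_ge0// ltW.
  rewrite (_ : 4 * _ = (2 * r) ^+ 2); last by ring.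
  rewrite lerXn2r ?nnegrE ?normc_ge0// ?mulr_ge0// 1?ltW//.
  by apply: le_lt_trans (normc_snorm _) _; rewrite ltr_pM2l.
- exact: le_lt_trans (snorm_normc _) hr.
Qed.

Lemma cauchy_estimate2 g c (r M : R) : 0 < r ->
  (forall z, snorm (z - c) < r -> derivable g z (1 : C)) ->
  (forall z, snorm (z - c) < r -> normc (g z) <= M) ->
  forall h, normc h < r / 4 ->
  normc (g (c + h) - g c - 'D_(1 : C) g c * h) <= 128 * M / r ^+ 2 * normc h ^+ 2.
Proof.
move=> r0 dg HM h hr.
have c0 : snorm (c - c) < r by rewrite subrr snorm0.
have M0 : 0 <= M := le_trans (normc_ge0 _) (HM c c0).
have tn k (t : R) : 0 <= t <= 1 -> normc (t%:C * k) <= normc k.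
  by move=> /andP[t0 t1]; rewrite normcM normc_real ger0_norm// ler_piMl// normc_ge0.
have D1 w : snorm (w - c) < r / 2 -> normc ('D_(1 : C) g w) <= 8 * M / r.
  move=> wr; have := @cauchy_estimate g w (r / 2) M.
  rewrite (_ : 4 * M / (r / 2) = 8 * M / r); last by field; rewrite gt_eqF.
  apply; first by rewrite divr_gt0.
    move=> z zr; apply: dg; rewrite (_ : z - c = (z - w) + (w - c)); last by ring.
    by apply: le_lt_trans (snormD _ _) _; lra.
  move=> z zr; apply: HM; rewrite (_ : z - c = (z - w) + (w - c)); last by ring.
  by apply: le_lt_trans (snormD _ _) _; lra.
have D2 k : normc k < r / 4 -> normc ('D_(1 : C) g (c + k) - 'D_(1 : C) g c) <= 128 * M / r ^+ 2 * normc k.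
  move=> kr; have k0 := snorm_normc k.
  have sk z : snorm (z + k - c) <= snorm (z - c) + snorm k by rewrite (addrAC z) snormD.
  have r4 : 0 < r / 4 by rewrite divr_gt0.
  have dk z : snorm (z - c) < r / 4 -> is_derive z (1 : C) (fun w => g (w + k) - g w) ('D_(1 : C) g (z + k) - 'D_(1 : C) g z).
    move=> zr; apply: is_deriveB.
      by apply/is_derive_shiftC/derivableP/dg; apply: le_lt_trans (sk z) _; lra.
    by apply/derivableP/dg; lra.
  have := @cauchy_estimate (fun w => g (w + k) - g w) c (r / 4) (8 * M / r * normc k) r4.
  have cc : snorm (c - c) < r / 4 by rewrite subrr snorm0.
  have [_ ->] := dk c cc.
  rewrite (_ : 4 * _ / _ = 128 * M / r ^+ 2 * normc k); last by field; rewrite gt_eqF.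
  apply; first by move=> z /dk[].
  move=> z zr; apply: (@is_derive_mvt R g ('D_(1 : C) g)) => t t01.
    apply/derivableP/dg; rewrite (addrAC z); apply: le_lt_trans (snormD _ _) _.
    by have := tn k t t01; have := snorm_normc (t%:C * k); lra.
  apply: D1; rewrite (addrAC z); apply: le_lt_trans (snormD _ _) _.
  by have := tn k t t01; have := snorm_normc (t%:C * k); lra.
have := @is_derive_mvt R (fun w => g w - 'D_(1 : C) g c * w) (fun w => 'D_(1 : C) g w - 'D_(1 : C) g c)
  c h (128 * M / r ^+ 2 * normc h).
rewrite (_ : g (c + h) - _ - _ = g (c + h) - g c - 'D_(1 : C) g c * h); last by ring.
rewrite -[X in _ -> _ -> _ <= X]mulrA -expr2; apply => t t01.
  apply: is_deriveB.
    apply/derivableP/dg; rewrite [c + _]addrC addrK.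
    by have := tn h t t01; have := snorm_normc (t%:C * h); lra.
  by apply: (@is_derive_quad R _ _ _ 0 1) => // k _; rewrite mul0r (_ : _ - _ = 0) ?normc0//; ring.
apply: le_trans (D2 _ (le_lt_trans (tn h t t01) hr)) _.
by rewrite ler_wpM2l ?tn// divr_ge0 ?mulr_ge0 ?exprn_ge0// ltW.
Qed.

(** As f vanishes near c, f z / (z - c)^n is derivable on the whole square. The maximum principle
    bounds it by M / s^n for an s between |z - c| and r, so |f z| <= M (|z - c| / s)^n for all n. *)
Lemma identity_square f c (r M : R) :
  (forall z, snorm (z - c) < r -> derivable f z (1 : C)) ->
  (forall z, snorm (z - c) < r -> normc (f z) <= M) ->
  (exists2 d : R, 0 < d & forall z, normc (z - c) < d -> f z = 0) ->
  forall z, normc (z - c) < r -> f z = 0.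
Proof.
move=> df HM [d d0 f0] z zr; apply/eqP; rewrite -normc_eq0 eq_le normc_ge0 andbT leNgt.
apply/negP => fz.
pose s := (normc (z - c) + r) / 2.
have zs : normc (z - c) < s by rewrite /s; lra.
have sr : s < r by rewrite /s; lra.
have s0 : 0 < s by apply: le_lt_trans zs; exact: normc_ge0.
have r0 : 0 < r by exact: lt_trans sr.
have M0 : 0 <= M by apply: le_trans (HM c _); rewrite ?normc_ge0// subrr snorm0.
move: (zs); apply/negP; rewrite -leNgt.
have zc : z - c != 0.
  apply/eqP => zc; move: fz; rewrite f0 ?normc0 ?ltxx//; by rewrite zc normc0.
have nzc : 0 < normc (z - c) by rewrite normc_gt0.
apply: (@pow_le_bound _ _ _ M (normc_ge0 _) fz) => n.
have sn : 0 < s ^+ n by rewrite exprn_gt0.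
suff : normc (f z / (z - c) ^+ n) <= M / s ^+ n.
  rewrite normcM normcV normcX ler_pdivrMr ?exprn_gt0// => H.
  apply: le_trans (ler_wpM2l (ltW sn) H) _.
  by rewrite mulrA mulrCA divff ?gt_eqF// mulr1 mulrC.
have zsn : snorm (z - c) < r by apply: le_lt_trans (snorm_normc _) _.
apply: (@max_modulus (fun z => f z / (z - c) ^+ n) c r s (M / s ^+ n) (ltW s0) sr) => //.
- by rewrite divr_ge0// exprn_ge0// ltW.
- move=> w wr; suff Hd : derivable (fun z => f z / (z - c) ^+ n) w (1 : C).
    by exists ('D_(1 : C) (fun z => f z / (z - c) ^+ n) w); exact: derivableP.
  have [->|wc] := eqVneq w c.
    suff [] : is_derive c (1 : C) (fun z => f z / (z - c) ^+ n) 0 by [].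
    apply: (@is_derive_quad R _ _ _ 0 d) => // h hd.
    rewrite !f0; first by rewrite !mul0r subrr subr0 normc0.
      by rewrite subrr normc0.
    by rewrite addrC addKr.
  apply: (@derivableM _ _ f (fun w => ((w - c) ^+ n)^-1)); first exact: df.
  apply: (@derivableV _ _ (fun w => (w - c) ^+ n)).
    by rewrite expf_neq0// subr_eq0.
  apply: derivable_pow.
  by apply: derivableB; [exact: derivable_id|exact: derivable_cst].
move=> w /andP[w1 w2]; rewrite normcM normcV normcX.
have sw : s <= normc (w - c) := le_trans w1 (snorm_normc _).
apply: ler_pM; rewrite ?invr_ge0 ?exprn_ge0 ?normc_ge0 ?HM//.
by rewrite lef_pV2 ?posrE ?exprn_gt0// ?(lt_le_trans s0)// lerXn2r ?nnegrE ?normc_ge0// ltW.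
Qed.

End CauchyEstimates.

(** * Differentiability on the complex plane C^2 *)

Section ComplexPlane2.
Variable R : realType.
Local Notation C := (Cplx R).
Local Notation re := (@complex.Re R).
Implicit Types (z w h d : C) (f g : C -> C).

Implicit Types (u v p q : C2 R).

Definition vnorm v : R := complex.Re `|v|.

Lemma normr_vnorm v : `|v| = (vnorm v)%:C.
Proof.
by have := normr_ge0 v; rewrite /vnorm; case: `|v| => a b; rewrite lecE /= => /andP[/eqP -> _].
Qed.

Lemma vnorm_ge0 v : 0 <= vnorm v.
Proof. by rewrite -lecR rmorph0 -normr_vnorm. Qed.

Lemma vnormD u v : vnorm (u + v) <= vnorm u + vnorm v.
Proof. by rewrite -lecR rmorphD /= -!normr_vnorm ler_normD. Qed.

Lemma vnormN v : vnorm (- v) = vnorm v.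
Proof. by rewrite /vnorm normrN. Qed.

Lemma vnorm0 : vnorm 0 = 0.
Proof. by rewrite /vnorm normr0. Qed.

Lemma vnormZ (l : C) v : vnorm (l *: v) = normc l * vnorm v.
Proof. by apply: (@complexI R); rewrite rmorphM /= -!normr_vnorm -normr_normc normrZ. Qed.

Lemma vnorm_eq0 v : vnorm v = 0 -> v = 0.
Proof. by move=> v0; apply/normr0_eq0; rewrite normr_vnorm v0 rmorph0. Qed.

Lemma normc_coord v i : normc (v 0 i) <= vnorm v.
Proof.
rewrite -lecR -normr_vnorm -normr_normc [leRHS]/Num.Def.normr /= mx_normE.
rewrite -[leLHS]nngE num_le; exact: (le_bigmax _ _ (0, i)).
Qed.

Lemma vnorm_lt v (r : R) : 0 < r -> (forall i, normc (v 0 i) < r) -> vnorm v < r.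
Proof.
move=> r0 H; have [v0|v0] := eqVneq (vnorm v) 0; first by rewrite v0.
have [|[i j] E] := @mx_norm_neq0 C 1 2 v.
  by rewrite -[mx_norm v]/`|v| normr_vnorm fmorph_eq0.
have : `|v| = `|v i j| by [].
by rewrite normr_vnorm normr_normc => /complexI ->; rewrite ord1.
Qed.

Definition ei (i : 'I_2) : C2 R := delta_mx 0 i.

Lemma vnorm_ei i : vnorm (ei i) <= 1.
Proof.
apply/ler_addgt0Pr => e e0; apply/ltW/vnorm_lt => [|j]; first by rewrite ltr_wpDl.
by rewrite mxE eqxx /=; case: (j == i); rewrite ?normc1 ?normc0 ?ltrDl// ltr_wpDl.
Qed.

Lemma ord2P (j : 'I_2) : j = z1 \/ j = z2.
Proof. by case: j => [[|[|//]] hj]; [left|right]; exact: val_inj. Qed.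

Lemma ei_decomp v : v = v 0 z1 *: ei z1 + v 0 z2 *: ei z2.
Proof.
by apply/rowP => j; rewrite !mxE !eqxx /=; have [->|->] := ord2P j;
  rewrite ?mulr1 ?mulr0 ?addr0 ?add0r.
Qed.

Lemma nbhsC2P p (P : set (C2 R)) :
  nbhs p P <-> exists2 r : R, 0 < r & forall q, vnorm (q - p) < r -> P q.
Proof.
split.
  move/nbhs_ballP => [e /= e0 H].
  have [e0' eE] := ltc0E e0.
  exists (re e) => // w wz; apply: H.
  by rewrite -ball_normE /= distrC normr_vnorm eE ltcR.
move=> [e e0 H]; apply/nbhs_ballP; exists (e%:C); first by rewrite /= ltcR.
by move=> w; rewrite -ball_normE /= distrC normr_vnorm ltcR => /H.
Qed.

Lemma differentiable_expand (F : C2 R -> C) p : differentiable F p ->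
  forall e : R, 0 < e -> exists2 r : R, 0 < r &
    forall v, vnorm v < r -> normc (F (p + v) - F p - 'd F p v) <= e * vnorm v.
Proof.
move=> /diff_locally /eqaddoP H e e0.
have /H/nbhsC2P[r r0 K] : 0 < e%:C by rewrite ltcR.
exists r => // v vr; have := K v; rewrite subr0 => /(_ vr).
by rewrite -lecR rmorphM /= -normr_vnorm -normr_normc !fctE /= opprD addrA [v + p]addrC.
Qed.

Lemma is_derive_path (F : C2 R -> C) p v (l : C) : differentiable F (p + l *: v) ->
  is_derive l (1 : C) (fun l : C => F (p + l *: v)) ('d F (p + l *: v) v).
Proof.
move=> dF; apply/is_deriveCP => e e0.
have n0 : 0 < vnorm v + 1 by rewrite ltr_wpDl// vnorm_ge0.
have [r r0 H] := differentiable_expand dF (divr_gt0 e0 n0).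
exists (r / (vnorm v + 1)) => [|h]; first by rewrite divr_gt0.
rewrite ltr_pdivlMr// => hr.
have hv : normc h * vnorm v <= normc h * (vnorm v + 1) by rewrite ler_wpM2l ?normc_ge0// lerDl.
have := H (h *: v); rewrite vnormZ => /(_ (le_lt_trans hv hr)).
rewrite (_ : p + l *: v + h *: v = p + (l + h) *: v); last by rewrite scalerDl addrA.
rewrite linearZ /= [h *: _]mulrC => /le_trans; apply.
by rewrite mulrAC ler_pdivrMr// -mulrA ler_wpM2l// ltW.
Qed.

Lemma partialE (F : C2 R -> C) p i : differentiable F p -> partial i F p = 'd F p (ei i).
Proof. by move=> dF; rewrite /partial deriveE. Qed.

Lemma diff_partial (F : C2 R -> C) p v : differentiable F p ->
  'd F p v = partial z1 F p * v 0 z1 + partial z2 F p * v 0 z2.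
Proof.
move=> dF; rewrite !partialE// [v in LHS]ei_decomp linearD !linearZ /=.
by rewrite ![_ * v 0 _]mulrC.
Qed.

(** A first-order expansion determines the differential by uniqueness. This is the way in for
    functions obtained as limits or by integration. *)
Lemma expand_differentiable (F : C2 R -> C) p (a b : C) :
  (forall e : R, 0 < e -> exists2 r : R, 0 < r &
    forall v, vnorm v < r -> normc (F (p + v) - F p - (a * v 0 z1 + b * v 0 z2)) <= e * vnorm v) ->
  [/\ differentiable F p, partial z1 F p = a & partial z2 F p = b].
Proof.
move=> H.
have lin : linear (fun v : C2 R => a * v 0 z1 + b * v 0 z2 : C).
  by move=> k u v; rewrite !mxE /GRing.scale /=; ring.
pose Lm := GRing.isLinear.Build _ _ _ _ _ lin.
pose L : {linear C2 R -> C} := HB.pack (fun v : C2 R => a * v 0 z1 + b * v 0 z2 : C) Lm.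
have cL : continuous L.
  move=> x; apply: (@differentiable_continuous _ _ _ x L).
  apply: (@differentiableD _ _ _ (fun v : C2 R => a * v 0 z1 : C) (fun v : C2 R => b * v 0 z2 : C)).
    apply: (@differentiableM _ _ (fun=> a) (fun v : C2 R => v 0 z1 : C)); first exact: differentiable_cst.
    exact: differentiable_coord.
  apply: (@differentiableM _ _ (fun=> b) (fun v : C2 R => v 0 z2 : C)); first exact: differentiable_cst.
  exact: differentiable_coord.
have E : F \o shift p = cst (F p) + (L : C2 R -> C) +o_ (0 : C2 R) (id : C2 R -> C2 R).
  apply/eqaddoP => e e0; have [e0' ->] := ltc0E e0.
  have [r r0 K] := H _ e0'; apply/nbhsC2P; exists r => // v; rewrite subr0 => vr.
  rewrite normr_vnorm normr_normc -rmorphM lecR !fctE /= opprD addrA [v + p]addrC.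
  exact: K.
have dL := diff_unique cL E.
have dF : differentiable F p by apply/diff_locallyP; rewrite dL.
by split => //; rewrite partialE// dL /L /= !mxE /=; ring.
Qed.

End ComplexPlane2.

(** * Estimates in two variables by restriction to complex lines *)

Section BoundedHolomorphic.
Variable R : realType.
Local Notation C := (Cplx R).
Local Notation re := (@complex.Re R).
Local Notation im := (@complex.Im R).
Implicit Types (z w h d : C) (f g : C -> C).

Implicit Types (u v p q : C2 R).

(** Radius and bound are explicit so that estimates can be iterated on smaller balls with constants
    depending on r and M only. *)
Definition holo_bounded (F : C2 R -> C) p (r M : R) :=
  forall q, vnorm (q - p) < r -> differentiable F q /\ normc (F q) <= M.

Lemma line_bounded (F : C2 R -> C) p (r M : R) v : 0 < r -> holo_bounded F p r M ->
  forall l : C, snorm l * (2 * vnorm v) < r ->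
  is_derive l (1 : C) (fun l : C => F (p + l *: v)) ('d F (p + l *: v) v) /\
  normc (F (p + l *: v)) <= M.
Proof.
move=> r0 H l lr; have [] := H (p + l *: v).
  rewrite addrC addKr vnormZ; apply: le_lt_trans lr.
  by rewrite mulrCA mulrA ler_wpM2r ?vnorm_ge0// normc_snorm.
by move=> dF bF; split => //; exact: is_derive_path.
Qed.

Lemma diff_estimate (F : C2 R -> C) p (r M : R) v : 0 < r -> holo_bounded F p r M ->
  normc ('d F p v) <= 8 * M / r * vnorm v.
Proof.
move=> r0 H; have [v0|v0] := eqVneq (vnorm v) 0.
  by rewrite (vnorm_eq0 v0) linear0 normc0 vnorm0 mulr0.
have vp : 0 < vnorm v by rewrite lt_def v0 vnorm_ge0.
have L := line_bounded (v := v) r0 H.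
pose s := r / (2 * vnorm v); have s0 : 0 < s by rewrite divr_gt0// mulr_gt0.
have Ls l : snorm (l - 0) < s -> snorm l * (2 * vnorm v) < r.
  by rewrite subr0 /s ltr_pdivlMr// mulr_gt0.
have := @cauchy_estimate R (fun l : C => F (p + l *: v)) 0 s M s0.
have -> : 'D_(1 : C) (fun l : C => F (p + l *: v)) 0 = 'd F p v.
  have [] := L 0; first by rewrite snorm0 mul0r.
  by rewrite scale0r addr0 => -[].
rewrite (_ : 4 * M / s = 8 * M / r * vnorm v); last by rewrite /s; field; rewrite !gt_eqF.
by apply => l /Ls/L[] [].
Qed.

(** [cauchy_estimate2] on the line l |-> p + l v with radius s = r / (2 |v|): 128 M / s^2 is 512 M
    |v|^2 / r^2, and l = 1 is allowed when 1 < s / 4. *)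
Lemma quad_estimate (F : C2 R -> C) p (r M : R) v : 0 < r -> holo_bounded F p r M ->
  vnorm v < r / 8 ->
  normc (F (p + v) - F p - 'd F p v) <= 512 * M / r ^+ 2 * vnorm v ^+ 2.
Proof.
move=> r0 H; have [v0|v0] := eqVneq (vnorm v) 0.
  by rewrite (vnorm_eq0 v0) linear0 addr0 subrr subr0 normc0 vnorm0 expr0n /= mulr0.
have vp : 0 < vnorm v by rewrite lt_def v0 vnorm_ge0.
move=> vr; have L := line_bounded (v := v) r0 H.
pose s := r / (2 * vnorm v); have s0 : 0 < s by rewrite divr_gt0// mulr_gt0.
have Ls l : snorm (l - 0) < s -> snorm l * (2 * vnorm v) < r.
  by rewrite subr0 /s ltr_pdivlMr// mulr_gt0.
have := @cauchy_estimate2 R (fun l : C => F (p + l *: v)) 0 s M s0.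
have -> : 'D_(1 : C) (fun l : C => F (p + l *: v)) 0 = 'd F p v.
  have [] := L 0; first by rewrite snorm0 mul0r.
  by rewrite scale0r addr0 => -[].
move=> /(_ _ _ 1); rewrite normc1 add0r scale0r scale1r addr0 mulr1 expr1n mulr1.
rewrite (_ : 128 * M / s ^+ 2 = 512 * M / r ^+ 2 * vnorm v ^+ 2); last by rewrite /s; field; rewrite !gt_eqF.
apply.
- by move=> l /Ls/L[] [].
- by move=> l /Ls/L[].
- rewrite (_ : s / 4 = r / 8 / vnorm v); last by rewrite /s; field; rewrite gt_eqF.
  by rewrite ltr_pdivlMr// mul1r.
Qed.

Lemma holo_bounded_sub (F : C2 R -> C) p q (r r' M : R) :
  holo_bounded F p r M -> vnorm (q - p) + r' <= r -> holo_bounded F q r' M.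
Proof.
move=> H qr w wq; apply: H; rewrite (_ : w - p = (w - q) + (q - p)); last by rewrite addrA subrK.
by apply: le_lt_trans (vnormD _ _) _; apply: lt_le_trans qr; rewrite addrC ltrD2l.
Qed.

(** The intervals [x k - c k, x k + c k] meet pairwise, so they share a point, the supremum of their
    left ends. This gives a limit together with its rate. *)
Lemma cauchy_lim_real (x : nat -> R) (c : nat -> R) :
  (forall k l, `|x k - x l| <= c k + c l) -> exists y, forall k, `|x k - y| <= c k.
Proof.
move=> H; pose A := range (fun k => x k - c k).
have ub k l : x k - c k <= x l + c l.
  by have := H k l; rewrite ler_norml => /andP[_ ?]; lra.
have hs : has_sup A.
  by split; [exists (x 0%N - c 0%N), 0%N | exists (x 0%N + c 0%N) => _ [k _ <-]].
exists (sup A) => k; rewrite ler_norml; apply/andP; split.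
  have : sup A <= x k + c k by apply: ge_sup => [|_ [l _ <-]//]; exact: hs.1.
  by lra.
have : x k - c k <= sup A by apply: sup_upper_bound => //; exists k.
by lra.
Qed.

Lemma cauchy_lim (x : nat -> C) (c : nat -> R) :
  (forall k l, normc (x k - x l) <= c k + c l) ->
  exists y, forall k, normc (x k - y) <= 2 * c k.
Proof.
move=> H.
have [|a Ha] := @cauchy_lim_real (fun k => re (x k)) c.
  by move=> k l; rewrite -reB; exact: le_trans (normc_re _) (H k l).
have [|b Hb] := @cauchy_lim_real (fun k => im (x k)) c.
  by move=> k l; rewrite -imB; exact: le_trans (normc_im _) (H k l).
exists (a +i* b) => k; apply: le_trans (normc_le _) _; rewrite reB imB /=.
by rewrite mulr_natl mulr2n; exact: lerD.
Qed.

End BoundedHolomorphic.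

(** * Partial derivatives of holomorphic functions are holomorphic *)

Section Partials.
Variable R : realType.
Local Notation C := (Cplx R).
Implicit Types (z w h d : C) (f g : C -> C).

Implicit Types (u v p q : C2 R).

Lemma harmonic_lt (D e : R) : 0 < e -> exists k : nat, D / k.+1%:R < e.
Proof.
move=> e0; pose k := Num.bound `|D / e|; exists k.
have Hk : D / e < k.+1%:R.
  apply: le_lt_trans (ler_norm _) _; apply: lt_trans (archi_boundP (normr_ge0 _)) _.
  by rewrite ltr_nat.
by rewrite ltr_pdivrMr// mulrC -ltr_pdivrMr.
Qed.

Lemma le_harmonic (x y D : R) : (forall k : nat, x <= y + D / k.+1%:R) -> x <= y.
Proof.
move=> H; apply/ler_addgt0Pr => e /(harmonic_lt D)[k Hk].
by apply: le_trans (H k) _; rewrite lerD2l ltW.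
Qed.

Lemma diff_shift (F : C2 R -> C) p c : differentiable F (p + c) ->
  differentiable (fun w : C2 R => F (w + c)) p /\ forall v, 'd (fun w : C2 R => F (w + c)) p v = 'd F (p + c) v.
Proof.
move=> dF.
have [|d1 d2 d3] := @expand_differentiable R (fun w : C2 R => F (w + c)) p (partial z1 F (p + c)) (partial z2 F (p + c)).
  move=> e e0; have [r r0 H] := differentiable_expand dF e0.
  by exists r => // v vr; rewrite -diff_partial// (addrAC p); exact: H.
split; first exact: d1.
move=> v; apply: etrans (diff_partial v d1) _.
rewrite d2 d3.
exact: (esym (diff_partial v dF)).
Qed.

Lemma diff_lincomb (F G : C2 R -> C) (c : C) p : differentiable F p -> differentiable G p ->
  differentiable (fun w : C2 R => c * (F w - G w)) p /\
  forall v, 'd (fun w : C2 R => c * (F w - G w)) p v = c * ('d F p v - 'd G p v).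
Proof.
move=> dF dG; have dB := differentiableB dF dG.
split; first exact: (differentiableZ c dB).
move=> v; have := f_equal (fun k : C2 R -> C => k v) (diffZ c dB).
move=> H; apply: etrans H _.
by have := f_equal (fun k : C2 R -> C => c * k v) (diffB dF dG).
Qed.

Section PartialHolomorphic.
Variables (F : C2 R -> C) (p : C2 R) (r M : R) (i : 'I_2).
Hypotheses (r0 : 0 < r) (HF : holo_bounded F p r M).

Let M0 : 0 <= M.
Proof. by have [|_] := @HF p; [rewrite subrr vnorm0|apply: le_trans; exact: normc_ge0]. Qed.

(** [dq k] is a difference quotient of F in the direction i, with a step [h k] tending to 0.
    [E * h k] bounds its distance to the partial derivative, by [quad_estimate] at radius r / 2, and
    [B] bounds all of them: E r / 32 + 16 M / r = 80 M / r. *)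
Let h (k : nat) : R := r / 32 / k.+1%:R.
Let dq (k : nat) (z : C2 R) : C := (h k)%:C^-1 * (F (z + (h k)%:C *: ei R i) - F z).
Let E := 2048 * M / r ^+ 2.
Let B := 80 * M / r.

Let E0 : 0 <= E.
Proof.
rewrite /E; apply: divr_ge0; last by apply: exprn_ge0; exact: ltW.
by apply: mulr_ge0 M0; exact: ler0n.
Qed.

Let h0 k : 0 < h k. Proof. by rewrite !divr_gt0. Qed.
Let hr k : h k <= r / 32.
Proof. by rewrite /h ler_pdivrMr// ler_pMr ?divr_gt0// ler1n. Qed.
Let nh k : normc (h k)%:C = h k. Proof. by rewrite normc_real ger0_norm// ltW. Qed.
Let hC0 k : (h k)%:C != 0 :> C. Proof. by rewrite fmorph_eq0 gt_eqF. Qed.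
Let vh k : vnorm ((h k)%:C *: ei R i) <= h k.
Proof. by rewrite vnormZ nh ler_piMr ?vnorm_ei// ltW. Qed.

Let dF (z : C2 R) : vnorm (z - p) < r / 2 -> normc (partial i F z) <= 16 * M / r.
Proof.
move=> zr; have Hz : holo_bounded F z (r / 2) M by apply: holo_bounded_sub HF _; move: r0; lra.
have [dFz _] : differentiable F z /\ normc (F z) <= M by apply: HF; move: r0; lra.
rewrite partialE//; apply: le_trans (diff_estimate _ _ Hz) _; first by rewrite divr_gt0.
rewrite (_ : 8 * M / (r / 2) = 16 * M / r); last by field; rewrite gt_eqF.
by rewrite ler_piMr ?vnorm_ei// divr_ge0 ?mulr_ge0// ltW.
Qed.

Let dq_close k (z : C2 R) : vnorm (z - p) < r / 2 -> normc (dq k z - partial i F z) <= E * h k.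
Proof.
move=> zr; have Hz : holo_bounded F z (r / 2) M by apply: holo_bounded_sub HF _; move: r0; lra.
have [dFz _] : differentiable F z /\ normc (F z) <= M by apply: HF; move: r0; lra.
have := quad_estimate (v := (h k)%:C *: ei R i) _ Hz.
rewrite linearZ /= -partialE// => /(_ _ _)/le_trans H.
have -> : dq k z - partial i F z = (h k)%:C^-1 * (F (z + (h k)%:C *: ei R i) - F z - (h k)%:C * partial i F z).
  by rewrite /dq [RHS]mulrBr mulKf.
rewrite normcM normcV nh ler_pdivrMl//; apply: H.
- by rewrite divr_gt0.
- by apply: le_lt_trans (vh k) _; have := hr k; move: r0; lra.
- rewrite (_ : 512 * M / (r / 2) ^+ 2 = E); last by rewrite /E; field; rewrite gt_eqF.
  rewrite [leRHS]mulrCA -expr2 (ler_wpM2l E0)//.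
  by rewrite lerXn2r ?nnegrE ?vnorm_ge0 ?(ltW (h0 k)).
Qed.

Let dq_diff k (z : C2 R) : vnorm (z - p) < r / 2 -> differentiable (dq k) z /\
  forall v, 'd (dq k) z v = (h k)%:C^-1 * ('d F (z + (h k)%:C *: ei R i) v - 'd F z v).
Proof.
move=> zr; have [dFz _] : differentiable F z /\ normc (F z) <= M by apply: HF; move: r0; lra.
have [dFz' _] : differentiable F (z + (h k)%:C *: ei R i) /\ normc (F (z + (h k)%:C *: ei R i)) <= M.
  apply: HF; rewrite addrAC; apply: le_lt_trans (vnormD _ _) _.
  by have := vh k; have := hr k; move: r0; lra.
have [d1 d2] := diff_shift dFz'.
have [d3 d4] := diff_lincomb (h k)%:C^-1 d1 dFz.
split; first exact: d3.
move=> v; apply: etrans (d4 v) _.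
exact: (congr1 (fun x => (h k)%:C^-1 * (x - 'd F z v)) (d2 v)).
Qed.

Let dq_bounded k : holo_bounded (dq k) p (r / 4) B.
Proof.
move=> z zr; have zr2 : vnorm (z - p) < r / 2 by move: r0; lra.
split; first by case: (dq_diff k zr2).
rewrite -(subrK (partial i F z) (dq k z)); apply: le_trans (normcD _ _) _.
apply: le_trans (lerD (dq_close k zr2) (dF zr2)) _.
rewrite (_ : B = E * (r / 32) + 16 * M / r); last by rewrite /B /E; field; rewrite gt_eqF.
by rewrite lerD2r (ler_wpM2l E0).
Qed.

Let K := 32 * E / r.

(** [dq k] and [dq l] are uniformly within [E * (h k + h l)] of each other; [diff_estimate] on the
    ball of radius r / 4 turns this into closeness of their differentials. *)
Let ddq_cauchy k l v : normc ('d (dq k) p v - 'd (dq l) p v) <= K * (h k + h l) * vnorm v.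
Proof.
have pp : vnorm (p - p) < r / 2 by rewrite subrr vnorm0 divr_gt0.
have [dk _] := dq_diff k pp; have [dl _] := dq_diff l pp.
have Hkl : holo_bounded (dq k - dq l) p (r / 4) (E * (h k + h l)).
  move=> z zr; have zr2 : vnorm (z - p) < r / 2 by move: r0; lra.
  have [dk' _] := dq_diff k zr2; have [dl' _] := dq_diff l zr2.
  split; first exact: (differentiableB dk' dl').
  have -> : (dq k - dq l) z = (dq k z - partial i F z) - (dq l z - partial i F z).
    by rewrite opprB addrA subrK.
  by apply: le_trans (normcD _ _) _; rewrite normcN mulrDr; apply: lerD; exact: dq_close.
have r40 : 0 < r / 4 by rewrite divr_gt0.
have H := diff_estimate v r40 Hkl.
have Ed : 'd (dq k - dq l) p v = 'd (dq k) p v - 'd (dq l) p v.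
  exact: (f_equal (fun f : C2 R -> C => f v) (diffB dk dl)).
rewrite -Ed; apply: le_trans H _.
by rewrite le_eqVlt; apply/orP; left; apply/eqP; rewrite /K; field; rewrite gt_eqF.
Qed.

(** The [dq k] converge to the partial derivative and so do their differentials at p; the quadratic
    error bounds do not depend on k and pass to the limit. The last clause prepares the symmetry of
    second derivatives: the j-th derivative of [dq k] is the difference quotient of [partial j F] in
    the direction i. *)
Lemma partial_expand : exists (a : 'I_2 -> C) (K : R),
  [/\ 0 <= K, differentiable (partial i F) p, forall j, partial j (partial i F) p = a j &
    forall j (k : nat), normc ((r / 32 / k.+1%:R)%:C^-1 *
      (partial j F (p + (r / 32 / k.+1%:R)%:C *: ei R i) - partial j F p) - a j)
      <= 2 * (K * (r / 32 / k.+1%:R))].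
Proof.
have pp : vnorm (p - p) < r / 2 by rewrite subrr vnorm0 divr_gt0.
have K0 : 0 <= K.
  by rewrite /K; apply: divr_ge0; [apply: mulr_ge0 E0; exact: ler0n|exact: ltW].
have /choice[a Ha] : forall j, exists aj, forall k, normc ('d (dq k) p (ei R j) - aj) <= 2 * (K * h k).
  move=> j; apply: (@cauchy_lim R (fun k => 'd (dq k) p (ei R j)) (fun k => K * h k)) => k l.
  apply: le_trans (ddq_cauchy k l _) _; rewrite -[leRHS]mulrDr.
  apply: ler_piMr (vnorm_ei _ _); apply: (mulr_ge0 K0).
  by apply: addr_ge0; exact: ltW.
pose Q := 512 * B / (r / 4) ^+ 2.
have Hq v : vnorm v < r / 32 ->
    normc (partial i F (p + v) - partial i F p - (a z1 * v 0 z1 + a z2 * v 0 z2)) <= Q * vnorm v ^+ 2.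
  (* All terms depending on k are proportional to [h k], hence to 1 / (k + 1); letting k grow leaves
     the quadratic term. *)
  move=> vr; apply: (@le_harmonic _ _ ((2 * E + 4 * K * vnorm v) * (r / 32))) => k.
  rewrite -[_ * (r / 32) / _]mulrA -/(h k).
  have pv : vnorm (p + v - p) < r / 2 by rewrite addrC addKr; move: r0; lra.
  have [dk _] := dq_diff k pp.
  have -> : partial i F (p + v) - partial i F p - (a z1 * v 0 z1 + a z2 * v 0 z2) =
    (dq k (p + v) - dq k p - 'd (dq k) p v) - (dq k (p + v) - partial i F (p + v)) +
    (dq k p - partial i F p) + (('d (dq k) p (ei R z1) - a z1) * v 0 z1 + ('d (dq k) p (ei R z2) - a z2) * v 0 z2).
    have Ed : 'd (dq k) p v = 'd (dq k) p (ei R z1) * v 0 z1 + 'd (dq k) p (ei R z2) * v 0 z2.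
      by apply: etrans (diff_partial v dk) _; rewrite (partialE z1 dk) (partialE z2 dk).
    rewrite Ed; move: ('d (dq k) p (ei R z1)) ('d (dq k) p (ei R z2)) (dq k (p + v)) (dq k p) => A1 A2 x1 x2.
    move: (partial i F (p + v)) (partial i F p) (a z1) (a z2) (v 0 z1) (v 0 z2) => y1 y2 b1 b2 c1 c2.
    by ring.
  have -> : Q * vnorm v ^+ 2 + (2 * E + 4 * K * vnorm v) * h k =
    Q * vnorm v ^+ 2 + E * h k + E * h k + (2 * (K * h k) * vnorm v + 2 * (K * h k) * vnorm v).
    by move: (h k) (vnorm v) E K Q => *; ring.
  apply: le_trans (normcD _ _) _; apply: lerD; last first.
    apply: le_trans (normcD _ _) _; rewrite !normcM.
    by apply: lerD; apply: ler_pM; rewrite ?normc_ge0 ?normc_coord.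
  apply: le_trans (normcD _ _) _; apply: lerD; last exact: dq_close.
  apply: le_trans (normcD _ _) _; rewrite normcN; apply: lerD; last exact: dq_close.
  by apply: quad_estimate; [rewrite divr_gt0|exact: dq_bounded|move: r0; lra].
have [|d1 d2 d3] := @expand_differentiable R (partial i F) p (a z1) (a z2).
  move=> e e0; exists (Num.min (r / 32) (e / (`|Q| + 1))).
    by rewrite lt_min !divr_gt0// ltr_wpDl.
  move=> v; rewrite lt_min => /andP[v1]; rewrite ltr_pdivlMr ?ltr_wpDl// => v2.
  apply: le_trans (Hq v v1) _; move: Q v2 {Hq} => Q v2.
  rewrite expr2 mulrA ler_wpM2r ?vnorm_ge0//; apply: le_trans _ (ltW v2).
  by rewrite mulrC ler_wpM2l ?vnorm_ge0// (le_trans (ler_norm _))// lerDl.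
exists a, K; split; [exact: K0|exact: d1| |].
  by move=> j; have [->|->] := ord2P j; [rewrite d2|rewrite d3].
move=> j k; have := Ha j k; have [_ ->] := dq_diff k pp.
have [dFp _] : differentiable F p /\ normc (F p) <= M by apply: HF; rewrite subrr vnorm0.
have [dFp' _] : differentiable F (p + (h k)%:C *: ei R i) /\ normc (F (p + (h k)%:C *: ei R i)) <= M.
  by apply: HF; rewrite addrC addKr; have := vh k; have := hr k; move: r0; lra.
by rewrite !partialE.
Qed.

End PartialHolomorphic.

End Partials.

(** * Mixed partial derivatives and the identity principle on balls *)

Section PartialsOpen.
Variable R : realType.
Local Notation C := (Cplx R).
Local Notation re := (@complex.Re R).
Local Notation im := (@complex.Im R).
Implicit Types (z w h d : C) (f g : C -> C).

Implicit Types (u v p q : C2 R).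

Lemma holo_locally_bounded (O : set (C2 R)) (F : C2 R -> C) p : open O -> holomorphic_on O F -> O p ->
  exists r M : R, 0 < r /\ holo_bounded F p r M.
Proof.
move=> oO HF Op; have /nbhsC2P[r1 r10 H1] : nbhs p O by exact: open_nbhs_nbhs.
have dF := HF p Op; have [r2 r20 H2] := differentiable_expand dF ltr01.
pose K := normc (partial z1 F p) + normc (partial z2 F p).
have K0 : 0 <= K by rewrite addr_ge0 ?normc_ge0.
exists (Num.min r1 (Num.min r2 1)), (normc (F p) + (1 + K)); split.
  by rewrite !lt_min r10 r20 ltr01.
move=> q; rewrite !lt_min => /and3P[q1 q2 q3]; split; first by apply/HF/H1.
have E : F q = F p + ((F (p + (q - p)) - F p - 'd F p (q - p)) + 'd F p (q - p)).
  by rewrite subrKC; ring.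
rewrite E; apply: le_trans (normcD _ _) _; rewrite lerD2l.
apply: le_trans (normcD _ _) _; apply: lerD.
  by apply: le_trans (H2 _ q2) _; rewrite mul1r ltW.
rewrite (diff_partial _ dF); apply: le_trans (normcD _ _) _; rewrite !normcM.
by apply: lerD; rewrite ler_piMr ?normc_ge0//; apply: le_trans (normc_coord _ _) (ltW q3).
Qed.

Lemma partial_holomorphic (O : set (C2 R)) (F : C2 R -> C) i : open O -> holomorphic_on O F ->
  holomorphic_on O (partial i F).
Proof.
move=> oO HF p Op; have [r [M [r0 HM]]] := holo_locally_bounded oO HF Op.
by have [a [K []]] := @partial_expand R F p r M i r0 HM.
Qed.

(** The difference quotients of [partial j F] in the direction i tend to [partial i (partial j F) p]
    because [partial j F] is holomorphic, and to [partial j (partial i F) p] by the last clause of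
    [partial_expand]. *)
Lemma partialC (O : set (C2 R)) (F : C2 R -> C) i j p : open O -> holomorphic_on O F -> O p ->
  partial i (partial j F) p = partial j (partial i F) p.
Proof.
move=> oO HF Op; have [r [M [r0 HM]]] := holo_locally_bounded oO HF Op.
have [a [K [K0 _ aE Ha]]] := @partial_expand R F p r M i r0 HM.
have dG := partial_holomorphic j oO HF Op.
apply/eqP; rewrite aE -subr_eq0 -normc_eq0 eq_le normc_ge0 andbT.
apply/ler_addgt0Pr => e e0; rewrite add0r.
have e2 : 0 < e / 2 by rewrite divr_gt0.
have [r1 r10 H1] := differentiable_expand dG e2.
have [k Hk] : exists k : nat, r / 32 / k.+1%:R < Num.min r1 (e / 2 / (2 * K + 1)).
  set m := Num.min _ _; have m0 : 0 < m by rewrite lt_min r10 divr_gt0// ltr_wpDl// mulr_ge0.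
  exact: harmonic_lt.
move: Hk (Ha j k); set h := r / 32 / k.+1%:R; rewrite lt_min => /andP[hr he] Hj.
have h0 : 0 < h by rewrite !divr_gt0.
have nh : normc h%:C = h by rewrite normc_real ger0_norm// ltW.
have hC0 : h%:C != 0 :> C by rewrite fmorph_eq0 gt_eqF.
have vh : vnorm (h%:C *: ei R i) <= h by rewrite vnormZ nh ler_piMr ?vnorm_ei// ltW.
have := H1 _ (le_lt_trans vh hr); rewrite linearZ /= -partialE// => G1.
have -> : partial i (partial j F) p - a j =
  (h%:C^-1 * (partial j F (p + h%:C *: ei R i) - partial j F p) - a j) -
  h%:C^-1 * (partial j F (p + h%:C *: ei R i) - partial j F p - h%:C * partial i (partial j F) p).
  move: (partial i (partial j F) p) (partial j F _) (partial j F p) (a j) => x1 x2 x3 x4.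
  by rewrite [h%:C^-1 * (_ - h%:C * _)]mulrBr (mulKf hC0); ring.
apply: le_trans (normcD _ _) _; rewrite normcN [e]splitr; apply: lerD.
  apply: le_trans Hj _; rewrite ltr_pdivlMr ?ltr_wpDl ?mulr_ge0// in he.
  by apply: le_trans (ltW he); have := ltW h0; lra.
rewrite normcM normcV nh ler_pdivrMl//; apply: le_trans G1 _.
by rewrite mulrC ler_wpM2r// ltW.
Qed.

(** The one-variable statement on the complex line through p and q. The radius is halved because a
    square has to fit into the ball. *)
Lemma holo_identity_ball (F : C2 R -> C) p q (r M : R) : holo_bounded F p r M ->
  (exists2 d : R, 0 < d & forall q, vnorm (q - p) < d -> F q = 0) ->
  vnorm (q - p) < r / 2 -> F q = 0.
Proof.
move=> HF [d d0 F0] qr; have [vq|vq] := eqVneq (vnorm (q - p)) 0.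
  by apply: F0; rewrite vq.
have vp : 0 < vnorm (q - p) by rewrite lt_def vq vnorm_ge0.
have r0 : 0 < r by lra.
have L := line_bounded (v := q - p) r0 HF.
pose s := r / (2 * vnorm (q - p)); have s0 : 0 < s by rewrite divr_gt0// mulr_gt0.
have Ls l : snorm (l - 0) < s -> snorm l * (2 * vnorm (q - p)) < r.
  by rewrite subr0 /s ltr_pdivlMr// mulr_gt0.
have := @identity_square R (fun l : C => F (p + l *: (q - p))) 0 s M _ _ _ 1.
rewrite scale1r subrKC; apply.
- by move=> l /Ls/L[] [].
- by move=> l /Ls/L[].
- exists (d / vnorm (q - p)); first by rewrite divr_gt0.
  move=> l; rewrite subr0 ltr_pdivlMr// => ld; apply: F0.
  by rewrite addrC addKr vnormZ.
- by rewrite subr0 normc1 /s ltr_pdivlMr ?mulr_gt0// mul1r; lra.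
Qed.

Lemma exists_primitive_square g c (s : R) : 0 < s ->
  (forall z, snorm (z - c) <= s -> exists d, is_derive z (1 : C) g d) ->
  exists F : C -> C, forall z, snorm (z - c) < s -> is_derive z (1 : C) F (g z).
Proof.
move=> s0 dg.
have [|||F HF] := @exists_primitive R g (re c - s) (re c + s) (im c - s) (im c + s).
- by lra.
- by lra.
- move=> z [/andP[h1 h2] /andP[h3 h4]]; apply: dg.
  by rewrite snorm_le reB imB !ler_norml; apply/andP; split; apply/andP; split; lra.
exists F => z; rewrite snorm_lt reB imB !ltr_norml => /andP[/andP[? ?] /andP[? ?]].
by apply: HF; apply/andP; split; lra.
Qed.

End PartialsOpen.

(** * The Poincare lemma for holomorphic 1-forms *)

Section Poincare.
Variable R : realType.
Local Notation C := (Cplx R).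
Implicit Types (z w h d : C) (f g : C -> C).

Implicit Types (u v p q : C2 R).

Definition pt (x y : C) : C2 R := x *: ei R z1 + y *: ei R z2.

Lemma pt_coord (x y : C) : (pt x y) 0 z1 = x /\ (pt x y) 0 z2 = y.
Proof. by rewrite !mxE !eqxx /= !mulr1 !mulr0 addr0 add0r. Qed.

Lemma pt_eta q : pt (q 0 z1) (q 0 z2) = q.
Proof. exact: (esym (ei_decomp q)). Qed.

Lemma ptB (x y x' y' : C) : pt x y - pt x' y' = pt (x - x') (y - y').
Proof. by rewrite /pt !scalerBl opprD addrACA. Qed.

Lemma vnorm_pt (x y : C) (r : R) : normc x < r -> normc y < r -> vnorm (pt x y) < r.
Proof.
move=> xr yr; apply: vnorm_lt => [|i]; first by apply: le_lt_trans xr; exact: normc_ge0.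
by have [->|->] := ord2P i; [rewrite (pt_coord x y).1|rewrite (pt_coord x y).2].
Qed.

Lemma is_derive_pt1 (F : C2 R -> C) (x y : C) : differentiable F (pt x y) ->
  is_derive x (1 : C) (fun x => F (pt x y)) (partial z1 F (pt x y)).
Proof.
move=> dF; have E (x' : C) : y *: ei R z2 + x' *: ei R z1 = pt x' y by rewrite addrC.
rewrite (partialE z1 dF) -E; rewrite -E in dF.
by apply: is_derive_eqfun (is_derive_path dF) _ (erefl _) => x'; rewrite E.
Qed.

(** The candidate is P x y + Q y, where P integrates F1 (., y) from a to x and Q is a primitive of
    F2 (a, .). The antiderivatives G y are picked separately for each y, so differentiability in y
    has to come from closedness, through [PE]. *)
Lemma poincare_aux (F1 F2 : C2 R -> C) p (r M : R) : 0 < r ->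
  holo_bounded F1 p r M -> holo_bounded F2 p r M ->
  (forall q, vnorm (q - p) < r -> partial z2 F1 q = partial z1 F2 q) ->
  exists g : C2 R -> C, forall q, vnorm (q - p) < r / 8 ->
    [/\ differentiable g q, partial z1 g q = F1 q & partial z2 g q = F2 q].
Proof.
move=> r0 H1 H2 H12; set a := p 0 z1; set b := p 0 z2.
have M0 : 0 <= M by have [|_] := @H1 p; [rewrite subrr vnorm0|apply: le_trans; exact: normc_ge0].
have pE : p = pt a b by rewrite pt_eta.
have near_pt (x y : C) (t : R) : normc (x - a) < t -> normc (y - b) < t -> vnorm (pt x y - p) < t.
  by move=> xt yt; rewrite pE ptB; exact: vnorm_pt.
have s0 : 0 < r / 4 by rewrite divr_gt0.
have s_r (x : C) : snorm (x - a) <= r / 4 -> normc (x - a) < r.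
  by move=> xs; apply: le_lt_trans (normc_snorm _) _; lra.
have /choice[G HG] : forall y, exists Gy : C -> C, normc (y - b) < r ->
    forall x, snorm (x - a) < r / 4 -> is_derive x (1 : C) Gy (F1 (pt x y)).
  move=> y; have [yb|yb] := ltP (normc (y - b)) r; last by exists id.
  have [|Gy HGy] := @exists_primitive_square R (fun x => F1 (pt x y)) a (r / 4) s0; last by exists Gy => _.
  move=> x xs; exists (partial z1 F1 (pt x y)); apply: is_derive_pt1.
  by apply: (H1 _ _).1; apply: near_pt => //; exact: s_r.
have [Q HQ] : exists Q : C -> C, forall y, snorm (y - b) < r / 4 -> is_derive y (1 : C) Q (F2 (pt a y)).
  apply: exists_primitive_square => // y ys; exists (partial z2 F2 (pt a y)).
  have d2 : differentiable F2 (pt a y).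
    apply: (H2 _ _).1; apply: near_pt; first by rewrite subrr normc0.
    by apply: le_lt_trans (normc_snorm _) _; lra.
  by rewrite (partialE z2 d2); exact: is_derive_path.
pose P (x y : C) := G y x - G y a.
exists (fun q => P (q 0 z1) (q 0 z2) + Q (q 0 z2)) => q qr.
set x := q 0 z1; set y := q 0 z2; have qE : q = pt x y by rewrite pt_eta.
have xr : normc (x - a) < r / 8 by apply: le_lt_trans qr; have := normc_coord (q - p) z1; rewrite !mxE.
have yr : normc (y - b) < r / 8 by apply: le_lt_trans qr; have := normc_coord (q - p) z2; rewrite !mxE.
pose K := 512 * M / (r / 2) ^+ 2.
have K0 : 0 <= K.
  by rewrite /K; apply: divr_ge0; [apply: mulr_ge0 M0; exact: ler0n|apply: exprn_ge0; lra].
(* Mean value inequality in t for G (y + k) t - G y t - k F2 (t, y). By closedness its derivative is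
   the first-order error of F1 in the second variable, at most K |k|^2. *)
have PE (x' k : C) : snorm (x' - a) < r / 4 -> normc k < r / 16 ->
    normc (P x' (y + k) - P x' y - k * (F2 (pt x' y) - F2 (pt a y))) <= K * normc k ^+ 2 * normc (x' - a).
  move=> xs kr.
  have yk : normc (y + k - b) < r by rewrite (addrAC y); apply: le_lt_trans (normcD _ _) _; lra.
  have yb : normc (y - b) < r by lra.
  have := @is_derive_mvt R (fun t => G (y + k) t - G y t - k * F2 (pt t y))
    (fun t => F1 (pt t (y + k)) - F1 (pt t y) - k * partial z1 F2 (pt t y)) a (x' - a) (K * normc k ^+ 2).
  rewrite subrKC.
  have -> : G (y + k) x' - G y x' - k * F2 (pt x' y) - (G (y + k) a - G y a - k * F2 (pt a y)) =
    P x' (y + k) - P x' y - k * (F2 (pt x' y) - F2 (pt a y)) by rewrite /P; ring.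
  have seg (t : R) : 0 <= t <= 1 -> snorm (a + t%:C * (x' - a) - a) < r / 4.
    move=> /andP[t0 t1]; rewrite addrC addKr; apply: le_lt_trans xs.
    rewrite /snorm mulrC reMr imMr !normrM ge_max !le_max (ger0_norm t0).
    by rewrite !ler_piMr// orbT.
  apply=> t t01; have ts := seg t t01; set w := a + _ in ts *.
    have dw : differentiable F2 (pt w y) by apply: (H2 _ _).1; apply: near_pt => //; apply/s_r/ltW.
    apply: is_deriveB; first by apply: is_deriveB; apply: HG.
    exact: (is_deriveZ k (is_derive_pt1 dw)).
  have wr : vnorm (pt w y - p) < r / 2.
    by apply: near_pt; [apply: le_lt_trans (normc_snorm _) _; lra|lra].
  have r2 : 0 < r / 2 by lra.
  have Hw : holo_bounded F1 (pt w y) (r / 2) M by apply: holo_bounded_sub H1 _; lra.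
  have vk : vnorm (k *: ei R z2) <= normc k.
    by rewrite vnormZ ler_piMr ?normc_ge0 ?vnorm_ei.
  have kr2 : vnorm (k *: ei R z2) < r / 2 / 8 by apply: le_lt_trans vk _; lra.
  have := quad_estimate r2 Hw kr2.
  have dw : differentiable F1 (pt w y) by apply: (H1 _ _).1; lra.
  rewrite linearZ /= -(partialE z2 dw) H12; last by lra.
  rewrite (_ : pt w y + k *: ei R z2 = pt w (y + k)); last by rewrite /pt -addrA -scalerDl.
  move=> H; apply: le_trans H _.
  by rewrite (ler_wpM2l K0)// lerXn2r ?nnegrE ?vnorm_ge0 ?normc_ge0.
have xs : snorm (x - a) < r / 4 by apply: le_lt_trans (snorm_normc _) _; lra.
have ys : snorm (y - b) < r / 4 by apply: le_lt_trans (snorm_normc _) _; lra.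
have yb : normc (y - b) < r by lra.
have dFq : differentiable F2 (pt x y) by apply: (H2 _ _).1; rewrite -qE; lra.
suff [? ? ?] : [/\ differentiable (fun q : C2 R => P (q 0 z1) (q 0 z2) + Q (q 0 z2)) q,
    partial z1 (fun q : C2 R => P (q 0 z1) (q 0 z2) + Q (q 0 z2)) q = F1 q &
    partial z2 (fun q : C2 R => P (q 0 z1) (q 0 z2) + Q (q 0 z2)) q = F2 q] by [].
apply: expand_differentiable => e e0.
have e4 : 0 < e / 4 by rewrite divr_gt0.
have /is_deriveCP/(_ _ e4)[r1 r10 D1] := HG y yb x xs.
have /is_deriveCP/(_ _ e4)[r2 r20 D2] := HQ y ys.
have [r3 r30 D3] := cont_is_derive (is_derive_pt1 dFq) e4.
have Kr : 0 < K * r + 1 by rewrite ltr_wpDl// mulr_ge0// ltW.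
exists (Num.min (Num.min r1 r2) (Num.min (Num.min r3 (r / 16)) (e / 4 / (K * r + 1)))).
  by rewrite !lt_min r10 r20 r30 !divr_gt0.
move=> v; rewrite !lt_min => /andP[/andP[v1 v2] /andP[/andP[v3 v4] v5]].
rewrite ltr_pdivlMr// in v5.
have E1 : (q + v) 0 z1 = x + v 0 z1 by rewrite mxE.
have E2 : (q + v) 0 z2 = y + v 0 z2 by rewrite mxE.
rewrite E1 E2 -/x -/y qE.
have hv := normc_coord v z1; have kv := normc_coord v z2.
move: (v 0 z1) (v 0 z2) hv kv => h k hv kv; set n := vnorm v in v1 v2 v3 v4 v5 hv kv *.
have n0 : 0 <= n by exact: vnorm_ge0.
have T1 := D1 h (le_lt_trans hv v1).
have T2 := D2 k (le_lt_trans kv v2).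
have T3 := D3 h (le_lt_trans hv v3).
have xh : normc (x + h - a) < r / 4.
  by rewrite (addrAC x); apply: le_lt_trans (normcD _ _) _; lra.
have T4 := PE (x + h) k (le_lt_trans (snorm_normc _) xh) (le_lt_trans kv v4).
(* The increment splits into the error of [PE] at x + h, the variation of F2 in x, and the errors of
   G y and of Q; each gets a quarter of e. *)
have -> : P (x + h) (y + k) + Q (y + k) - (P x y + Q y) - (F1 (pt x y) * h + F2 (pt x y) * k) =
  (P (x + h) (y + k) - P (x + h) y - k * (F2 (pt (x + h) y) - F2 (pt a y))) +
  k * (F2 (pt (x + h) y) - F2 (pt x y)) + (G y (x + h) - G y x - F1 (pt x y) * h) +
  (Q (y + k) - Q y - F2 (pt a y) * k).
  rewrite /P.
  move: (G (y + k) (x + h)) (G (y + k) a) (G y (x + h)) (G y a) (G y x) (Q (y + k)) (Q y).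
  move: (F1 (pt x y)) (F2 (pt x y)) (F2 (pt a y)) (F2 (pt (x + h) y)) => *; ring.
rewrite (_ : e * n = e / 4 * n + e / 4 * n + e / 4 * n + e / 4 * n); last by field.
apply: le_trans (normcD _ _) _; apply: lerD; last first.
  by apply: le_trans T2 _; rewrite ler_wpM2l// ltW.
apply: le_trans (normcD _ _) _; apply: lerD; last first.
  by apply: le_trans T1 _; rewrite ler_wpM2l// ltW.
apply: le_trans (normcD _ _) _; apply: lerD; last first.
  by rewrite normcM mulrC; apply: ler_pM; rewrite ?normc_ge0// ltW.
apply: le_trans T4 _.
apply: (@le_trans _ _ (K * n ^+ 2 * r)).
  apply: ler_pM; rewrite ?normc_ge0//; first by rewrite mulr_ge0// exprn_ge0// normc_ge0.
    by rewrite ler_wpM2l// lerXn2r ?nnegrE ?normc_ge0.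
  by move: (normc_ge0 (x + h - a)) xh; lra.
rewrite (_ : K * n ^+ 2 * r = (n * (K * r)) * n); last by ring.
rewrite (ler_wpM2r n0)//; apply: le_trans _ (ltW v5); rewrite ler_wpM2l//.
by rewrite lerDl.
Qed.

Lemma poincare (O : set (C2 R)) (F1 F2 : C2 R -> C) p : open O -> O p ->
  holomorphic_on O F1 -> holomorphic_on O F2 ->
  (forall q, O q -> partial z2 F1 q = partial z1 F2 q) ->
  exists (r : R) (g : C2 R -> C), 0 < r /\ forall q, vnorm (q - p) < r ->
    [/\ O q, differentiable g q, partial z1 g q = F1 q & partial z2 g q = F2 q].
Proof.
move=> oO Op H1 H2 H12.
have /nbhsC2P[r0 r00 H0] : nbhs p O by exact: open_nbhs_nbhs.
have [r1 [M1 [r10 HM1]]] := holo_locally_bounded oO H1 Op.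
have [r2 [M2 [r20 HM2]]] := holo_locally_bounded oO H2 Op.
pose r := Num.min r0 (Num.min r1 r2).
have r_gt0 : 0 < r by rewrite !lt_min r00 r10.
have [|||g Hg] := @poincare_aux F1 F2 p r (Num.max M1 M2) r_gt0.
- by move=> q; rewrite !lt_min => /and3P[_ /HM1[d m] _]; split => //; rewrite le_max m.
- by move=> q; rewrite !lt_min => /and3P[_ _ /HM2[d m]]; split => //; rewrite le_max m orbT.
- by move=> q; rewrite !lt_min => /and3P[/H0 Oq _ _]; exact: H12.
exists (r / 8), g; split; first by rewrite divr_gt0.
move=> q qr; have [d e1 e2] := Hg q qr; split => //; apply: H0.
by apply: lt_le_trans qr _; rewrite ler_pdivrMr// (@le_trans _ _ r0)// ?ge_min ?lexx// ler_peMr// ?ler1n// ltW.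
Qed.

End Poincare.

(** * The complex exponential *)

Section Exponential.
Variable R : realType.
Local Notation C := (Cplx R).
Local Notation re := (@complex.Re R).
Local Notation im := (@complex.Im R).
Implicit Types (z w h d : C) (f g : C -> C).

Definition cexp z : C := (expR (re z) * cos (im z)) +i* (expR (re z) * sin (im z)).

Lemma cexpD z w : cexp (z + w) = cexp z * cexp w.
Proof.
rewrite /cexp reD imD expRD cosD sinD; apply/eqP; rewrite eq_complex /=.
by apply/andP; split; apply/eqP; ring.
Qed.

Lemma cexp0 : cexp 0 = 1.
Proof. by rewrite /cexp /= expR0 cos0 sin0 mulr1 mulr0. Qed.

Lemma cexp_neq0 z : cexp z != 0.
Proof.
have : cexp z * cexp (- z) = 1 by rewrite -cexpD subrr cexp0.
by apply: contra_eq_neq => ->; rewrite mul0r eq_sym oner_eq0.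
Qed.

(** The functional equation [cexpD] reduces differentiability everywhere to 0, where the first-order
    expansions of the real exp, cos and sin suffice. *)
Lemma is_derive_cexp0 : is_derive (0 : C) (1 : C) cexp 1.
Proof.
apply/is_deriveCP => e e0.
(* The errors below add up to 9 k |h|, so 12 k <= e leaves room; k <= 1 bounds the exponential
   factor by 3. *)
have [k [k0 k1 ke]] : exists k : R, [/\ 0 < k, k <= 1 & 12 * k <= e].
  exists (Num.min 1 (e / 12)); rewrite lt_min ltr01 divr_gt0// ge_min lexx; split => //.
  by rewrite -ler_pdivlMl// mulrC ge_min lexx orbT.
have /is_deriveRP/(_ _ k0)[r1 r10 H1] : is_derive (0 : R) (1 : R) expR 1.
  by have := is_derive_expR (0 : R); rewrite expR0.
have /is_deriveRP/(_ _ k0)[r2 r20 H2] : is_derive (0 : R) (1 : R) cos 0.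
  by have := is_derive_cos (0 : R); rewrite sin0 oppr0.
have /is_deriveRP/(_ _ k0)[r3 r30 H3] : is_derive (0 : R) (1 : R) sin 1.
  by have := is_derive_sin (0 : R); rewrite cos0.
exists (Num.min (Num.min r1 r2) (Num.min r3 k)).
  by rewrite !lt_min r10 r20 r30.
move=> h; rewrite !lt_min => /andP[/andP[h1 h2] /andP[h3 hk]].
have xh := normc_re h; have yh := normc_im h.
apply: le_trans (normc_le _) _; rewrite cexp0 add0r mul1r /cexp !reB !imB /= !subr0.
move: (re h) (im h) (normc h) xh yh (normc_ge0 h) h1 h2 h3 hk => x y n xn yn n0 h1 h2 h3 nk.
have hX := H1 _ (le_lt_trans xn h1); have hc := H2 _ (le_lt_trans yn h2).
have hs := H3 _ (le_lt_trans yn h3).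
rewrite !add0r expR0 cos0 sin0 subr0 !mul1r mul0r subr0 in hX hc hs.
have EX : expR x = (expR x - 1 - x) + 1 + x by ring.
rewrite EX; move: (expR x - 1 - x) (cos y) (sin y) hs hc hX {EX} => X c s hs hc hX.
have kx : k * `|x| <= k * n by rewrite ler_wpM2l// ltW.
have ky : k * `|y| <= k * n by rewrite ler_wpM2l// ltW.
have kn : k * n <= n by rewrite ler_piMl.
have hA : `|X + 1 + x| <= 3.
  apply: le_trans (ler_normD _ _) _; apply: le_trans (lerD (ler_normD _ _) (lexx _)) _.
  by rewrite normr1; lra.
have hB : `|X + x| <= 2 * n by apply: le_trans (ler_normD _ _) _; lra.
have -> : (X + 1 + x) * c - 1 - x = (X + 1 + x) * (c - 1) + X by ring.
have -> : (X + 1 + x) * s - y = (X + 1 + x) * (s - y) + (X + x) * y by ring.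
have b1 : `|(X + 1 + x) * (c - 1)| <= 3 * (k * n).
  by rewrite normrM; apply: ler_pM => //; exact: le_trans ky.
have b2 : `|(X + 1 + x) * (s - y)| <= 3 * (k * n).
  by rewrite normrM; apply: ler_pM => //; exact: le_trans ky.
have b3 : `|(X + x) * y| <= 2 * (k * n).
  rewrite normrM [k * n]mulrC mulrA; apply: ler_pM => //.
  by apply: le_trans yn _; exact: ltW.
apply: le_trans (lerD (ler_normD _ _) (ler_normD _ _)) _.
have : 12 * k * n <= e * n by rewrite ler_wpM2r.
by have := mulr_ge0 (ltW k0) n0; lra.
Qed.

Lemma is_derive_cexp z : is_derive z (1 : C) cexp (cexp z).
Proof.
have /is_deriveCP H := is_derive_cexp0.
apply/is_deriveCP => e e0.
have n0 : 0 < normc (cexp z) by rewrite normc_gt0 cexp_neq0.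
have [r r0 K] := H _ (divr_gt0 e0 n0); exists r => // h /K.
rewrite add0r cexp0 mul1r mulrAC ler_pdivlMr// => H'; apply: le_trans _ H'.
by rewrite -normcM cexpD le_eqVlt; apply/orP; left; apply/eqP; congr normc; ring.
Qed.

End Exponential.

(** * The Brioschi bracket and its change of coordinates *)

Section PartialRules.
Variable R : realType.
Local Notation C := (Cplx R).
Implicit Types (z w h d : C) (f g : C -> C).

Implicit Types (u v p q : C2 R).

Lemma det_mx22 (F : comNzRingType) (M : 'M[F]_2) : \det M = M 0 0 * M 1 1 - M 0 1 * M 1 0.
Proof.
rewrite (expand_det_row _ ord0) !big_ord_recl big_ord0 addr0 /cofactor !det_mx11 !mxE.
rewrite /= expr0 expr1 mul1r mulN1r mulrN.
by congr (M _ _ * M _ _ - M _ _ * M _ _); apply: val_inj.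
Qed.

Lemma det_mx33 (F : comNzRingType) (M : 'M[F]_3) : \det M =
  M 0 0 * (M 1 1 * M 2 2 - M 1 2 * M 2 1) - M 0 1 * (M 1 0 * M 2 2 - M 1 2 * M 2 0)
  + M 0 2 * (M 1 0 * M 2 1 - M 1 1 * M 2 0).
Proof.
rewrite (expand_det_row _ ord0) !big_ord_recl big_ord0 addr0 /cofactor !det_mx22 !mxE.
have E1 : lift ord0 ord0 = 1 :> 'I_3 by exact: val_inj.
have E2 : lift ord0 (lift ord0 ord0) = 2 :> 'I_3 by exact: val_inj.
have l00 : lift ord0 0 = 1 :> 'I_3 by exact: val_inj.
have l01 : lift ord0 1 = 2 :> 'I_3 by exact: val_inj.
have l10 : lift 1 0 = 0 :> 'I_3 by exact: val_inj.
have l11 : lift 1 1 = 2 :> 'I_3 by exact: val_inj.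
have l20 : lift 2 0 = 0 :> 'I_3 by exact: val_inj.
have l21 : lift 2 1 = 1 :> 'I_3 by exact: val_inj.
rewrite E1 ?E2 ?l00 ?l01 ?l10 ?l11 ?l20 ?l21 -[ord0]/(0 : 'I_3).
rewrite -[X in (-1) ^+ X * (M 1 1 * M 2 2 - _)]/0%N -[X in (-1) ^+ X * (M 1 0 * M 2 2 - _)]/1%N.
by rewrite -[X in (-1) ^+ X * (M 1 0 * M 2 1 - _)]/2%N; ring.
Qed.

Lemma det_mx3 (a b c d e f g h i : C) :
  \det (mx3 [:: [:: a; b; c]; [:: d; e; f]; [:: g; h; i]]) =
  a * (e * i - f * h) - b * (d * i - f * g) + c * (d * h - e * g).
Proof. by rewrite det_mx33 !mxE. Qed.

(** The difference of the two determinants, expanded. E, M, G stand for a11, a12, a22, so M is twice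
    the F of Gauss. With scalars in place of derivatives, identities between brackets fall to [ring]
    and [field]. *)
Definition brioschi_poly (E M G E1 E2 M1 M2 G1 G2 E22 G11 M12 : C) : C :=
  8^-1 * ((2 * M12 - 2 * E22 - 2 * G11) * (2 * E * G - 2^-1 * M ^+ 2)
   - 2 * E1 * ((M2 - G1) * G - 2^-1 * M * G2)
   + 2 * (M1 - E2) * (2^-1 * M * (M2 - G1) - E * G2)
   + 2 * E2 * (E2 * G - 2^-1 * M * G1) - 2 * G1 * (E2 * 2^-1 * M - E * G1)).

Lemma brioschi_polyE (E M G E1 E2 M1 M2 G1 G2 E22 G11 M12 : C) :
  \det (mx3
    [:: [:: - (2^-1 * (E22 + G11 - M12)); 2^-1 * E1; 2^-1 * (M1 - E2)];
        [:: 2^-1 * (M2 - G1); E; 2^-1 * M];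
        [:: 2^-1 * G2; 2^-1 * M; G]])
  - \det (mx3
    [:: [:: 0; 2^-1 * E2; 2^-1 * G1];
        [:: 2^-1 * E2; E; 2^-1 * M];
        [:: 2^-1 * G1; 2^-1 * M; G]]) = brioschi_poly E M G E1 E2 M1 M2 G1 G2 E22 G11 M12.
Proof. by rewrite !det_mx3 /brioschi_poly; field. Qed.

Lemma brioschiE (a11 a12 a22 : C2 R -> C) q :
  brioschi_bracket a11 a12 a22 q = brioschi_poly (a11 q) (a12 q) (a22 q)
    (partial z1 a11 q) (partial z2 a11 q) (partial z1 a12 q) (partial z2 a12 q)
    (partial z1 a22 q) (partial z2 a22 q) (partial z2 (partial z2 a11) q)
    (partial z1 (partial z1 a22) q) (partial z1 (partial z2 a12) q).
Proof. exact: brioschi_polyE. Qed.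

Lemma partial_near (O : set (C2 R)) (f g : C2 R -> C) i q : open O -> O q ->
  (forall p, O p -> f p = g p) -> partial i f q = partial i g q.
Proof.
move=> oO Oq fg; apply: near_eq_derive.
by apply: filterS (open_nbhs_nbhs (conj oO Oq)).
Qed.

Lemma partialD (f g : C2 R -> C) i q : differentiable f q -> differentiable g q ->
  differentiable (fun p : C2 R => f p + g p) q /\
  partial i (fun p : C2 R => f p + g p) q = partial i f q + partial i g q.
Proof.
move=> df dg; split; first exact: (differentiableD df dg).
exact: (@deriveD _ _ _ f g q (ei R i) (@diff_derivable _ _ _ f q (ei R i) df) (@diff_derivable _ _ _ g q (ei R i) dg)).
Qed.

Lemma partialM (f g : C2 R -> C) i q : differentiable f q -> differentiable g q ->
  differentiable (fun p : C2 R => f p * g p) q /\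
  partial i (fun p : C2 R => f p * g p) q = partial i f q * g q + f q * partial i g q.
Proof.
move=> df dg; split; first exact: (differentiableM df dg).
apply: etrans (@deriveM _ _ f g q (ei R i) (@diff_derivable _ _ _ f q (ei R i) df) (@diff_derivable _ _ _ g q (ei R i) dg)) _.
by rewrite addrC [_ *: 'D_ _ f q]mulrC.
Qed.

Lemma partial_cst (c : C) i q : differentiable (fun=> c : C) q /\ partial i (fun=> c : C) q = 0.
Proof. by split; [exact: differentiable_cst|exact: derive_cst]. Qed.

Lemma partialZ (c : C) (f : C2 R -> C) i q : differentiable f q ->
  differentiable (fun p : C2 R => c * f p) q /\
  partial i (fun p : C2 R => c * f p) q = c * partial i f q.
Proof.
move=> df; have [dc ec] := partial_cst c i q; have [d e] := partialM i dc df.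
by split; [exact: d|rewrite e ec mul0r add0r].
Qed.

Lemma partial_comp1 (phi : C -> C) (f : C2 R -> C) (d : C) i q :
  is_derive (f q) (1 : C) phi d -> differentiable f q ->
  differentiable (fun p : C2 R => phi (f p)) q /\
  partial i (fun p : C2 R => phi (f p)) q = d * partial i f q.
Proof.
move=> [dphi ephi] df.
have dphi' : differentiable phi (f q) by exact/derivable1_diffP.
have dc : differentiable (phi \o f) q := differentiable_comp df dphi'.
split; first exact: dc.
rewrite (partialE i df); apply: etrans (partialE i dc) _.
apply: etrans (congr1 (fun k : C2 R -> C => k (ei R i)) (diff_comp df dphi')) _.
rewrite /= diff1E// /GRing.scale /= mulrC; congr (_ * _).
by rewrite -ephi derive1E.
Qed.

Lemma differentiable_pt (t1 t2 : C2 R -> C) q : differentiable t1 q -> differentiable t2 q ->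
  differentiable (fun p : C2 R => pt (t1 p) (t2 p)) q /\
  forall v, 'd (fun p : C2 R => pt (t1 p) (t2 p)) q v = pt ('d t1 q v) ('d t2 q v).
Proof.
move=> d1 d2.
have e1 := differentiableZl (ei R z1) d1; have e2 := differentiableZl (ei R z2) d2.
split; first exact: (differentiableD e1 e2).
move=> v; apply: etrans (congr1 (fun k : C2 R -> C2 R => k v) (diffD e1 e2)) _.
exact: (congr2 (fun x y : C2 R => x + y)
  (congr1 (fun k : C2 R -> C2 R => k v) (diffZl (ei R z1) d1))
  (congr1 (fun k : C2 R -> C2 R => k v) (diffZl (ei R z2) d2))).
Qed.

Lemma partial_comp2 (F t1 t2 : C2 R -> C) i q :
  differentiable F (pt (t1 q) (t2 q)) -> differentiable t1 q -> differentiable t2 q ->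
  differentiable (fun p : C2 R => F (pt (t1 p) (t2 p))) q /\
  partial i (fun p : C2 R => F (pt (t1 p) (t2 p))) q =
    partial z1 F (pt (t1 q) (t2 q)) * partial i t1 q + partial z2 F (pt (t1 q) (t2 q)) * partial i t2 q.
Proof.
move=> dF d1 d2; have [dT eT] := differentiable_pt d1 d2.
have dc : differentiable (F \o (fun p : C2 R => pt (t1 p) (t2 p))) q := differentiable_comp dT dF.
split; first exact: dc.
apply: etrans (partialE i dc) _.
apply: etrans (congr1 (fun k : C2 R -> C => k (ei R i)) (diff_comp dT dF)) _.
rewrite /= eT (diff_partial _ dF) (partialE i d1) (partialE i d2).
by rewrite (pt_coord _ _).1 (pt_coord _ _).2.
Qed.

End PartialRules.

(** * Leibniz and chain rules for the coefficients of a pull-back *)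

Section PullBacks.
Variable R : realType.
Local Notation C := (Cplx R).
Implicit Types (z w h d : C) (f g : C -> C).

Implicit Types (u v p q : C2 R).

(** Each term of a pulled-back coefficient is a coefficient times two first derivatives of the map;
    [tri_jet1] and [tri_jet2] are the Leibniz rules of first and second order for this shape. *)
Definition tri (B x y : C2 R -> C) : C2 R -> C := fun q => B q * x q * y q.

Definition tri_jet1 (b bk x xk y yk : C) : C := bk * x * y + b * xk * y + b * x * yk.

Definition tri_jet2 (b bk bl bkl x xk xl xkl y yk yl ykl : C) : C :=
  tri_jet1 bk bkl x xl y yl + tri_jet1 b bl xk xkl y yl + tri_jet1 b bl x xl yk ykl.

Definition cmp (F t1 t2 : C2 R -> C) : C2 R -> C := fun q => F (pt (t1 q) (t2 q)).

Section Jets.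
Variable O : set (C2 R).
Hypothesis oO : open O.
Implicit Types (B x y F : C2 R -> C).

Lemma triP B x y k q : differentiable B q -> differentiable x q -> differentiable y q ->
  differentiable (tri B x y) q /\
  partial k (tri B x y) q = tri_jet1 (B q) (partial k B q) (x q) (partial k x q) (y q) (partial k y q).
Proof.
move=> dB dx dy; have [d1 e1] := partialM k dB dx; have [d2 e2] := partialM k d1 dy.
split; first exact: d2.
apply: etrans e2 _; rewrite /tri_jet1.
apply: etrans (congr1 (fun c => c * y q + B q * x q * partial k y q) e1) _.
exact: (congr1 (fun c => c + _) (mulrDl _ _ _)).
Qed.

Lemma tri_holo B x y : holomorphic_on O B -> holomorphic_on O x -> holomorphic_on O y ->
  holomorphic_on O (tri B x y).
Proof. by move=> dB dx dy q Oq; case: (triP z1 (dB q Oq) (dx q Oq) (dy q Oq)). Qed.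

Lemma holoD (f g : C2 R -> C) : holomorphic_on O f -> holomorphic_on O g -> holomorphic_on O (fun q : C2 R => f q + g q).
Proof. by move=> df dg q Oq; case: (partialD z1 (df q Oq) (dg q Oq)). Qed.

Lemma holoZ (c : C) (f : C2 R -> C) : holomorphic_on O f -> holomorphic_on O (fun q : C2 R => c * f q).
Proof. by move=> df q Oq; case: (partialZ c z1 (df q Oq)). Qed.

Lemma triP2 B x y k l q : holomorphic_on O B -> holomorphic_on O x -> holomorphic_on O y -> O q ->
  partial l (partial k (tri B x y)) q =
  tri_jet2 (B q) (partial k B q) (partial l B q) (partial l (partial k B) q)
    (x q) (partial k x q) (partial l x q) (partial l (partial k x) q)
    (y q) (partial k y q) (partial l y q) (partial l (partial k y) q).
Proof.
move=> hB hx hy Oq.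
have hBk := partial_holomorphic k oO hB; have hxk := partial_holomorphic k oO hx.
have hyk := partial_holomorphic k oO hy.
have E p : O p -> partial k (tri B x y) p =
    tri (partial k B) x y p + tri B (partial k x) y p + tri B x (partial k y) p.
  by move=> Op; exact: (triP k (hB p Op) (hx p Op) (hy p Op)).2.
apply: etrans (partial_near l oO Oq E) _.
have [d1 e1] := triP l (hBk q Oq) (hx q Oq) (hy q Oq).
have [d2 e2] := triP l (hB q Oq) (hxk q Oq) (hy q Oq).
have [d3 e3] := triP l (hB q Oq) (hx q Oq) (hyk q Oq).
have [d12 e12] := partialD l d1 d2; have [d123 e123] := partialD l d12 d3.
apply: etrans e123 _; rewrite /tri_jet2.
apply: (congr2 (fun a b : C => a + b)) e3.
by apply: etrans e12 _; exact: (congr2 (fun a b : C => a + b)) e1 e2.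
Qed.

Lemma cmpP F t1 t2 k q : differentiable F (pt (t1 q) (t2 q)) -> differentiable t1 q -> differentiable t2 q ->
  differentiable (cmp F t1 t2) q /\
  partial k (cmp F t1 t2) q =
    cmp (partial z1 F) t1 t2 q * partial k t1 q + cmp (partial z2 F) t1 t2 q * partial k t2 q.
Proof. exact: partial_comp2. Qed.

Variables (O' : set (C2 R)) (t1 t2 : C2 R -> C).
Hypotheses (oO' : open O') (ht1 : holomorphic_on O t1) (ht2 : holomorphic_on O t2).
Hypothesis tO : forall q, O q -> O' (pt (t1 q) (t2 q)).

Lemma cmp_holo F : holomorphic_on O' F -> holomorphic_on O (cmp F t1 t2).
Proof.
by move=> hF q Oq; case: (cmpP z1 (hF _ (tO Oq)) (ht1 Oq) (ht2 Oq)).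
Qed.

Lemma cmpP2 F k l q : holomorphic_on O' F -> O q ->
  partial l (partial k (cmp F t1 t2)) q =
  (cmp (partial z1 (partial z1 F)) t1 t2 q * partial l t1 q + cmp (partial z1 (partial z2 F)) t1 t2 q * partial l t2 q)
    * partial k t1 q + cmp (partial z1 F) t1 t2 q * partial l (partial k t1) q +
  ((cmp (partial z1 (partial z2 F)) t1 t2 q * partial l t1 q + cmp (partial z2 (partial z2 F)) t1 t2 q * partial l t2 q)
    * partial k t2 q + cmp (partial z2 F) t1 t2 q * partial l (partial k t2) q).
Proof.
move=> hF Oq.
have h1 := partial_holomorphic z1 oO' hF; have h2 := partial_holomorphic z2 oO' hF.
have hx := partial_holomorphic k oO ht1; have hy := partial_holomorphic k oO ht2.
have E p : O p -> partial k (cmp F t1 t2) p =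
    cmp (partial z1 F) t1 t2 p * partial k t1 p + cmp (partial z2 F) t1 t2 p * partial k t2 p.
  by move=> Op; exact: (cmpP k (hF _ (tO Op)) (ht1 Op) (ht2 Op)).2.
apply: etrans (partial_near l oO Oq E) _.
have [c1 e1] := cmpP l (h1 _ (tO Oq)) (ht1 Oq) (ht2 Oq).
have [c2 e2] := cmpP l (h2 _ (tO Oq)) (ht1 Oq) (ht2 Oq).
have [m1 g1] := partialM l c1 (hx q Oq); have [m2 g2] := partialM l c2 (hy q Oq).
have [_ s] := partialD l m1 m2; apply: etrans s _.
have sym : cmp (partial z2 (partial z1 F)) t1 t2 q = cmp (partial z1 (partial z2 F)) t1 t2 q.
  exact: (partialC z2 z1 oO' hF (tO Oq)).
apply: (congr2 (fun a b : C => a + b)).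
  apply: etrans g1 _.
  apply: (congr1 (fun a : C => a * partial k t1 q + cmp (partial z1 F) t1 t2 q * partial l (partial k t1) q)).
  apply: etrans e1 _.
  exact: (congr1 (fun c : C => cmp (partial z1 (partial z1 F)) t1 t2 q * partial l t1 q + c * partial l t2 q) sym).
apply: etrans g2 _.
exact: (congr1 (fun a : C => a * partial k t2 q + cmp (partial z2 F) t1 t2 q * partial l (partial k t2) q) e2).
Qed.

(* The coefficients of the pull-back of b11 dz1^2 + b12 dz1 dz2 + b22 dz2^2 under
   (t1, t2) are pull z1 z1, 2 pull z1 z2 and pull z2 z2. *)
Definition pull (b11 b12 b22 : C2 R -> C) (i j : 'I_2) : C2 R -> C := fun q =>
  tri (cmp b11 t1 t2) (partial i t1) (partial j t1) q +
  2^-1 * tri (cmp b12 t1 t2) (partial i t1) (partial j t2) q +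
  2^-1 * tri (cmp b12 t1 t2) (partial j t1) (partial i t2) q +
  tri (cmp b22 t1 t2) (partial i t2) (partial j t2) q.

Lemma pull_terms (T1 T2 T3 T4 : C2 R -> C) k q :
  differentiable T1 q -> differentiable T2 q -> differentiable T3 q -> differentiable T4 q ->
  differentiable (fun p : C2 R => T1 p + 2^-1 * T2 p + 2^-1 * T3 p + T4 p) q /\
  partial k (fun p : C2 R => T1 p + 2^-1 * T2 p + 2^-1 * T3 p + T4 p) q =
  partial k T1 q + 2^-1 * partial k T2 q + 2^-1 * partial k T3 q + partial k T4 q.
Proof.
move=> d1 d2 d3 d4; have [c2 e2] := partialZ 2^-1 k d2; have [c3 e3] := partialZ 2^-1 k d3.
have [s1 g1] := partialD k d1 c2; have [s2 g2] := partialD k s1 c3; have [s3 g3] := partialD k s2 d4.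
split; first exact: s3.
apply: etrans g3 _; apply: (congr1 (fun c : C => c + partial k T4 q)).
apply: etrans g2 _; apply: (congr2 (fun a b : C => a + b)) e3.
apply: etrans g1 _; exact: (congr1 (fun c : C => partial k T1 q + c) e2).
Qed.

Variables (b11 b12 b22 : C2 R -> C).
Hypotheses (hb11 : holomorphic_on O' b11) (hb12 : holomorphic_on O' b12) (hb22 : holomorphic_on O' b22).

Lemma pull_holo i j : holomorphic_on O (pull b11 b12 b22 i j).
Proof.
move=> q Oq; have x i' := partial_holomorphic i' oO ht1; have y i' := partial_holomorphic i' oO ht2.
have c1 := cmp_holo hb11; have c2 := cmp_holo hb12; have c3 := cmp_holo hb22.
apply: (pull_terms z1 _ _ _ _).1.
- exact: (tri_holo c1 (x i) (x j) Oq).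
- exact: (tri_holo c2 (x i) (y j) Oq).
- exact: (tri_holo c2 (x j) (y i) Oq).
- exact: (tri_holo c3 (y i) (y j) Oq).
Qed.

Lemma pullP i j k q : O q -> partial k (pull b11 b12 b22 i j) q =
  partial k (tri (cmp b11 t1 t2) (partial i t1) (partial j t1)) q +
  2^-1 * partial k (tri (cmp b12 t1 t2) (partial i t1) (partial j t2)) q +
  2^-1 * partial k (tri (cmp b12 t1 t2) (partial j t1) (partial i t2)) q +
  partial k (tri (cmp b22 t1 t2) (partial i t2) (partial j t2)) q.
Proof.
move=> Oq; have x i' := partial_holomorphic i' oO ht1; have y i' := partial_holomorphic i' oO ht2.
have c1 := cmp_holo hb11; have c2 := cmp_holo hb12; have c3 := cmp_holo hb22.
apply: (pull_terms k _ _ _ _).2.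
- exact: (tri_holo c1 (x i) (x j) Oq).
- exact: (tri_holo c2 (x i) (y j) Oq).
- exact: (tri_holo c2 (x j) (y i) Oq).
- exact: (tri_holo c3 (y i) (y j) Oq).
Qed.

Lemma pullP2 i j k l q : O q -> partial l (partial k (pull b11 b12 b22 i j)) q =
  partial l (partial k (tri (cmp b11 t1 t2) (partial i t1) (partial j t1))) q +
  2^-1 * partial l (partial k (tri (cmp b12 t1 t2) (partial i t1) (partial j t2))) q +
  2^-1 * partial l (partial k (tri (cmp b12 t1 t2) (partial j t1) (partial i t2))) q +
  partial l (partial k (tri (cmp b22 t1 t2) (partial i t2) (partial j t2))) q.
Proof.
move=> Oq; have x i' := partial_holomorphic i' oO ht1; have y i' := partial_holomorphic i' oO ht2.
have c1 := cmp_holo hb11; have c2 := cmp_holo hb12; have c3 := cmp_holo hb22.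
apply: etrans (partial_near l oO Oq (fun p => @pullP i j k p)) _.
apply: (pull_terms l _ _ _ _).2.
- exact: (partial_holomorphic k oO (tri_holo c1 (x i) (x j)) Oq).
- exact: (partial_holomorphic k oO (tri_holo c2 (x i) (y j)) Oq).
- exact: (partial_holomorphic k oO (tri_holo c2 (x j) (y i)) Oq).
- exact: (partial_holomorphic k oO (tri_holo c3 (y i) (y j)) Oq).
Qed.

End Jets.

End PullBacks.

(** * Behaviour of the bracket under holomorphic maps *)

Section BracketPullBack.
Variable R : realType.
Local Notation C := (Cplx R).
Implicit Types (z w h d : C) (f g : C -> C).

Implicit Types (u v p q : C2 R).

(** The 2-jet of a coefficient as six independent scalars. [pull0], [pull1] and [pull2] express the
    value and the derivatives of [pull] through such jets and the derivatives of the map. *)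
Record jet2 := Jet2 { j0 : C; j1 : C; j2 : C; j11 : C; j12 : C; j22 : C }.

Definition jet_of (F : C2 R -> C) q : jet2 :=
  Jet2 (F q) (partial z1 F q) (partial z2 F q) (partial z1 (partial z1 F) q)
    (partial z1 (partial z2 F) q) (partial z2 (partial z2 F) q).

Definition cjet1 (J : jet2) (xk yk : C) : C := j1 J * xk + j2 J * yk.

Definition cjet2 (J : jet2) (xk yk xl yl xkl ykl : C) : C :=
  (j11 J * xl + j12 J * yl) * xk + j1 J * xkl + ((j12 J * xl + j22 J * yl) * yk + j2 J * ykl).

Definition pull0 (A N H : jet2) (xi yi xj yj : C) : C :=
  j0 A * xi * xj + 2^-1 * (j0 N * xi * yj) + 2^-1 * (j0 N * xj * yi) + j0 H * yi * yj.

Definition pull1 (A N H : jet2) (xk yk xi xik yi yik xj xjk yj yjk : C) : C :=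
  tri_jet1 (j0 A) (cjet1 A xk yk) xi xik xj xjk +
  2^-1 * tri_jet1 (j0 N) (cjet1 N xk yk) xi xik yj yjk +
  2^-1 * tri_jet1 (j0 N) (cjet1 N xk yk) xj xjk yi yik +
  tri_jet1 (j0 H) (cjet1 H xk yk) yi yik yj yjk.

Definition pull2 (A N H : jet2) (xk yk xl yl xkl ykl xi xik xil xikl yi yik yil yikl
    xj xjk xjl xjkl yj yjk yjl yjkl : C) : C :=
  tri_jet2 (j0 A) (cjet1 A xk yk) (cjet1 A xl yl) (cjet2 A xk yk xl yl xkl ykl)
    xi xik xil xikl xj xjk xjl xjkl +
  2^-1 * tri_jet2 (j0 N) (cjet1 N xk yk) (cjet1 N xl yl) (cjet2 N xk yk xl yl xkl ykl)
    xi xik xil xikl yj yjk yjl yjkl +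
  2^-1 * tri_jet2 (j0 N) (cjet1 N xk yk) (cjet1 N xl yl) (cjet2 N xk yk xl yl xkl ykl)
    xj xjk xjl xjkl yi yik yil yikl +
  tri_jet2 (j0 H) (cjet1 H xk yk) (cjet1 H xl yl) (cjet2 H xk yk xl yl xkl ykl)
    yi yik yil yikl yj yjk yjl yjkl.

Definition brioschi_jet (A N H : jet2) : C :=
  brioschi_poly (j0 A) (j0 N) (j0 H) (j1 A) (j2 A) (j1 N) (j2 N) (j1 H) (j2 H)
    (j22 A) (j11 H) (j12 N).

(** The invariance of curvature as a polynomial identity. Third derivatives of the map enter through
    the second derivatives of the pulled-back coefficients and cancel. Symmetry of mixed derivatives
    is passed as equations, because the derivatives arrive in the order in which they were taken. *)
Lemma brioschi_jet_pull (A N H : jet2)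
  (x1 x2 x11 x12 x21 x22 x112 x121 x122 x221 : C)
  (y1 y2 y11 y12 y21 y22 y112 y121 y122 y221 : C) :
  x21 = x12 -> x121 = x112 -> x122 = x221 -> y21 = y12 -> y121 = y112 -> y122 = y221 ->
  brioschi_poly
    (pull0 A N H x1 y1 x1 y1) (2 * pull0 A N H x1 y1 x2 y2) (pull0 A N H x2 y2 x2 y2)
    (pull1 A N H x1 y1 x1 x11 y1 y11 x1 x11 y1 y11)
    (pull1 A N H x2 y2 x1 x21 y1 y21 x1 x21 y1 y21)
    (2 * pull1 A N H x1 y1 x1 x11 y1 y11 x2 x12 y2 y12)
    (2 * pull1 A N H x2 y2 x1 x21 y1 y21 x2 x22 y2 y22)
    (pull1 A N H x1 y1 x2 x12 y2 y12 x2 x12 y2 y12)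
    (pull1 A N H x2 y2 x2 x22 y2 y22 x2 x22 y2 y22)
    (pull2 A N H x2 y2 x2 y2 x22 y22 x1 x21 x21 x221 y1 y21 y21 y221 x1 x21 x21 x221 y1 y21 y21 y221)
    (pull2 A N H x1 y1 x1 y1 x11 y11 x2 x12 x12 x112 y2 y12 y12 y112 x2 x12 x12 x112 y2 y12 y12 y112)
    (2 * pull2 A N H x2 y2 x1 y1 x12 y12 x1 x21 x11 x121 y1 y21 y11 y121 x2 x22 x12 x122 y2 y22 y12 y122)
  = brioschi_jet A N H * (x1 * y2 - x2 * y1) ^+ 4.
Proof.
move=> -> -> -> -> -> ->; case: A => A A1 A2 A11 A12 A22; case: N => N N1 N2 N11 N12 N22.
case: H => H H1 H2 H11 H12 H22.
rewrite /brioschi_jet /brioschi_poly /pull0 /pull1 /pull2 /tri_jet2 /tri_jet1 /cjet1 /cjet2 /=.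
by field.
Qed.

Section Pullback.
Variables (O O' : set (C2 R)) (t1 t2 b11 b12 b22 : C2 R -> C).
Hypotheses (oO : open O) (oO' : open O').
Hypotheses (ht1 : holomorphic_on O t1) (ht2 : holomorphic_on O t2).
Hypothesis tO : forall q, O q -> O' (pt (t1 q) (t2 q)).
Hypotheses (hb11 : holomorphic_on O' b11) (hb12 : holomorphic_on O' b12) (hb22 : holomorphic_on O' b22).

Let T q := pt (t1 q) (t2 q).
Let w := pull t1 t2 b11 b12 b22.

Lemma tri_cmp_jet1 (B x y : C2 R -> C) k q : O q -> holomorphic_on O' B ->
  holomorphic_on O x -> holomorphic_on O y ->
  partial k (tri (cmp B t1 t2) x y) q =
  tri_jet1 (j0 (jet_of B (T q))) (cjet1 (jet_of B (T q)) (partial k t1 q) (partial k t2 q))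
    (x q) (partial k x q) (y q) (partial k y q).
Proof.
move=> Oq hB hx hy; have hc := cmp_holo ht1 ht2 tO hB.
apply: etrans (triP k (hc q Oq) (hx q Oq) (hy q Oq)).2 _.
apply: (congr1 (fun c => tri_jet1 (cmp B t1 t2 q) c (x q) (partial k x q) (y q) (partial k y q))).
exact: (cmpP k (hB _ (tO Oq)) (ht1 Oq) (ht2 Oq)).2.
Qed.

Lemma tri_cmp_jet2 (B x y : C2 R -> C) k l q : O q -> holomorphic_on O' B ->
  holomorphic_on O x -> holomorphic_on O y ->
  partial l (partial k (tri (cmp B t1 t2) x y)) q =
  tri_jet2 (j0 (jet_of B (T q))) (cjet1 (jet_of B (T q)) (partial k t1 q) (partial k t2 q))
    (cjet1 (jet_of B (T q)) (partial l t1 q) (partial l t2 q))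
    (cjet2 (jet_of B (T q)) (partial k t1 q) (partial k t2 q) (partial l t1 q) (partial l t2 q)
      (partial l (partial k t1) q) (partial l (partial k t2) q))
    (x q) (partial k x q) (partial l x q) (partial l (partial k x) q)
    (y q) (partial k y q) (partial l y q) (partial l (partial k y) q).
Proof.
move=> Oq hB hx hy; have hc := cmp_holo ht1 ht2 tO hB.
apply: etrans (triP2 oO k l hc hx hy Oq) _.
have e1 k' := (cmpP k' (hB _ (tO Oq)) (ht1 Oq) (ht2 Oq)).2.
have e2 := cmpP2 oO oO' ht1 ht2 tO k l hB Oq.
apply: etrans (congr1 (fun c => tri_jet2 _ c _ _ _ _ _ _ _ _ _ _) (e1 k)) _.
apply: etrans (congr1 (fun c => tri_jet2 _ _ c _ _ _ _ _ _ _ _ _) (e1 l)) _.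
exact: (congr1 (fun c => tri_jet2 _ _ _ c _ _ _ _ _ _ _ _) e2).
Qed.

Lemma pull_jet1 i j k q : O q -> partial k (w i j) q =
  pull1 (jet_of b11 (T q)) (jet_of b12 (T q)) (jet_of b22 (T q)) (partial k t1 q) (partial k t2 q)
    (partial i t1 q) (partial k (partial i t1) q) (partial i t2 q) (partial k (partial i t2) q)
    (partial j t1 q) (partial k (partial j t1) q) (partial j t2 q) (partial k (partial j t2) q).
Proof.
move=> Oq; have x i' := partial_holomorphic i' oO ht1; have y i' := partial_holomorphic i' oO ht2.
apply: etrans (pullP oO ht1 ht2 tO hb11 hb12 hb22 i j k Oq) _.
have e1 := tri_cmp_jet1 k Oq hb11 (x i) (x j); have e2 := tri_cmp_jet1 k Oq hb12 (x i) (y j).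
have e3 := tri_cmp_jet1 k Oq hb12 (x j) (y i); have e4 := tri_cmp_jet1 k Oq hb22 (y i) (y j).
apply: (congr2 (fun a b : C => a + b)) e4; apply: (congr2 (fun a b : C => a + 2^-1 * b)) e3.
exact: (congr2 (fun a b : C => a + 2^-1 * b)) e1 e2.
Qed.

Lemma pull_jet2 i j k l q : O q -> partial l (partial k (w i j)) q =
  pull2 (jet_of b11 (T q)) (jet_of b12 (T q)) (jet_of b22 (T q)) (partial k t1 q) (partial k t2 q)
    (partial l t1 q) (partial l t2 q) (partial l (partial k t1) q) (partial l (partial k t2) q)
    (partial i t1 q) (partial k (partial i t1) q) (partial l (partial i t1) q) (partial l (partial k (partial i t1)) q)
    (partial i t2 q) (partial k (partial i t2) q) (partial l (partial i t2) q) (partial l (partial k (partial i t2)) q)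
    (partial j t1 q) (partial k (partial j t1) q) (partial l (partial j t1) q) (partial l (partial k (partial j t1)) q)
    (partial j t2 q) (partial k (partial j t2) q) (partial l (partial j t2) q) (partial l (partial k (partial j t2)) q).
Proof.
move=> Oq; have x i' := partial_holomorphic i' oO ht1; have y i' := partial_holomorphic i' oO ht2.
apply: etrans (pullP2 oO ht1 ht2 tO hb11 hb12 hb22 i j k l Oq) _.
have e1 := tri_cmp_jet2 k l Oq hb11 (x i) (x j); have e2 := tri_cmp_jet2 k l Oq hb12 (x i) (y j).
have e3 := tri_cmp_jet2 k l Oq hb12 (x j) (y i); have e4 := tri_cmp_jet2 k l Oq hb22 (y i) (y j).
apply: (congr2 (fun a b : C => a + b)) e4; apply: (congr2 (fun a b : C => a + 2^-1 * b)) e3.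
exact: (congr2 (fun a b : C => a + 2^-1 * b)) e1 e2.
Qed.

Lemma brioschi_poly_congr (a b c d e f g h i j k l a' b' c' d' e' f' g' h' i' j' k' l' : C) :
  a = a' -> b = b' -> c = c' -> d = d' -> e = e' -> f = f' -> g = g' -> h = h' -> i = i' ->
  j = j' -> k = k' -> l = l' ->
  brioschi_poly a b c d e f g h i j k l = brioschi_poly a' b' c' d' e' f' g' h' i' j' k' l'.
Proof. by move=> -> -> -> -> -> -> -> -> -> -> -> ->. Qed.

(** The same statement serves the transitions between charts and the pair (F1, F2) of a
    decomposition, whose Jacobian may vanish. *)
Theorem brioschi_pullback (a11 a12 a22 : C2 R -> C) q : O q ->
  (forall p, O p -> a11 p = w z1 z1 p) ->
  (forall p, O p -> a12 p = 2 * w z1 z2 p) ->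
  (forall p, O p -> a22 p = w z2 z2 p) ->
  brioschi_bracket a11 a12 a22 q = brioschi_bracket b11 b12 b22 (T q) *
    (partial z1 t1 q * partial z2 t2 q - partial z2 t1 q * partial z1 t2 q) ^+ 4.
Proof.
move=> Oq E11 E12 E22.
have hw i j : holomorphic_on O (w i j) by exact: (pull_holo oO ht1 ht2 tO hb11 hb12 hb22).
have d11 k p (Op : O p) := partial_near k oO Op E11.
have d22 k p (Op : O p) := partial_near k oO Op E22.
have d12 k p (Op : O p) : partial k a12 p = 2 * partial k (w z1 z2) p.
  apply: etrans (partial_near k oO Op E12) _.
  exact: (partialZ 2 k (hw z1 z2 p Op)).2.
have dd11 k l := etrans (partial_near l oO Oq (fun p => @d11 k p)).
have dd22 k l := etrans (partial_near l oO Oq (fun p => @d22 k p)).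
have dd12 k l : partial l (partial k a12) q = 2 * partial l (partial k (w z1 z2)) q.
  apply: etrans (partial_near l oO Oq (fun p => @d12 k p)) _.
  exact: (partialZ 2 l (partial_holomorphic k oO (hw z1 z2) Oq)).2.
have m2 (x y : C) : x = y -> 2 * x = 2 * y by move=> ->.
have sym (t : C2 R -> C) (ht : holomorphic_on O t) := partialC z2 z1 oO ht Oq.
have sym1 (t : C2 R -> C) (ht : holomorphic_on O t) :
    partial z1 (partial z2 (partial z1 t)) q = partial z1 (partial z1 (partial z2 t)) q.
  by apply: (partial_near z1 oO Oq) => p Op; exact: (partialC z2 z1 oO ht Op).
have sym2 (t : C2 R -> C) (ht : holomorphic_on O t) :
    partial z1 (partial z2 (partial z2 t)) q = partial z2 (partial z2 (partial z1 t)) q.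
  apply: etrans (partialC z1 z2 oO (partial_holomorphic z2 oO ht) Oq) _.
  by apply: (partial_near z2 oO Oq) => p Op; exact: (partialC z1 z2 oO ht Op).
apply: etrans (brioschiE _ _ _ _) _; apply: etrans _ (congr1 (fun c => c * _) (esym (brioschiE _ _ _ _))).
apply: etrans (brioschi_poly_congr (E11 q Oq) (E12 q Oq) (E22 q Oq)
  (etrans (d11 z1 q Oq) (pull_jet1 z1 z1 z1 Oq)) (etrans (d11 z2 q Oq) (pull_jet1 z1 z1 z2 Oq))
  (etrans (d12 z1 q Oq) (m2 _ _ (pull_jet1 z1 z2 z1 Oq))) (etrans (d12 z2 q Oq) (m2 _ _ (pull_jet1 z1 z2 z2 Oq)))
  (etrans (d22 z1 q Oq) (pull_jet1 z2 z2 z1 Oq)) (etrans (d22 z2 q Oq) (pull_jet1 z2 z2 z2 Oq))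
  (dd11 _ _ _ (pull_jet2 z1 z1 z2 z2 Oq)) (dd22 _ _ _ (pull_jet2 z2 z2 z1 z1 Oq))
  (etrans (dd12 _ _) (m2 _ _ (pull_jet2 z1 z2 z2 z1 Oq)))) _.
exact: (@brioschi_jet_pull (jet_of b11 (T q)) (jet_of b12 (T q)) (jet_of b22 (T q))
  (partial z1 t1 q) (partial z2 t1 q) (partial z1 (partial z1 t1) q) _ _ (partial z2 (partial z2 t1) q) _ _ _ _
  (partial z1 t2 q) (partial z2 t2 q) (partial z1 (partial z1 t2) q) _ _ (partial z2 (partial z2 t2) q) _ _ _ _
  (sym _ ht1) (sym1 _ ht1) (sym2 _ ht1) (sym _ ht2) (sym1 _ ht2) (sym2 _ ht2)).
Qed.

End Pullback.

End BracketPullBack.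

(** * Local exact decompositions *)

Section Roots.
Variable R : realType.
Local Notation C := (Cplx R).
Implicit Types (z w h d : C) (f g : C -> C).

Implicit Types (u v p q : C2 R).

Definition vball p (r : R) : set (C2 R) := [set q | vnorm (q - p) < r].

Lemma open_vball p (r : R) : open (vball p r).
Proof.
rewrite openE => q qr; apply/nbhsC2P; exists (r - vnorm (q - p)); first by rewrite subr_gt0.
move=> q' h; rewrite /vball /= (_ : q' - p = (q' - q) + (q - p)); last by rewrite addrA subrK.
by apply: le_lt_trans (vnormD _ _) _; rewrite -ltrBrDr.
Qed.

Lemma vball_center p (r : R) : 0 < r -> vball p r p.
Proof. by move=> r0; rewrite /vball /= subrr vnorm0. Qed.

Lemma open_subball (O : set (C2 R)) p : open O -> O p ->
  exists2 r : R, 0 < r & forall q, vball p r q -> O q.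
Proof. by move=> oO Op; apply/nbhsC2P; exact: open_nbhs_nbhs. Qed.

Lemma partialV (f : C2 R -> C) i q : differentiable f q -> f q != 0 ->
  differentiable (fun p : C2 R => (f p)^-1) q /\
  partial i (fun p : C2 R => (f p)^-1) q = - (f q) ^- 2 * partial i f q.
Proof.
move=> df f0; split; first exact: (differentiableV df f0).
exact: (@deriveV _ _ f q (ei R i) f0 (@diff_derivable _ _ _ f q (ei R i) df)).
Qed.

Lemma partial_div (f g : C2 R -> C) i q : differentiable f q -> differentiable g q -> g q != 0 ->
  differentiable (fun p : C2 R => f p / g p) q /\
  partial i (fun p : C2 R => f p / g p) q = (partial i f q * g q - f q * partial i g q) / g q ^+ 2.
Proof.
move=> df dg g0; have [dv ev] := partialV i dg g0; have [dm em] := partialM i df dv.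
split; first exact: dm.
apply: etrans em _; apply: etrans (congr1 (fun c => _ + _ * c) ev) _.
by move: (partial i f q) (partial i g q) (f q) (g q) g0 => a b c d d0; field.
Qed.

Lemma ball_constant (f : C2 R -> C) p (r : R) :
  (forall q, vball p r q -> [/\ differentiable f q, partial z1 f q = 0 & partial z2 f q = 0]) ->
  forall q, vball p r q -> f q = f p.
Proof.
move=> H q qr; apply/eqP; rewrite -subr_eq0 -normc_eq0 eq_le normc_ge0 andbT.
have seg (t : R) : 0 <= t <= 1 -> vball p r (p + t%:C *: (q - p)).
  move=> /andP[t0 t1]; rewrite /vball /= addrC addKr vnormZ normc_real ger0_norm//.
  by apply: le_lt_trans qr; rewrite ler_piMl ?vnorm_ge0.
have := @is_derive_mvt R (fun l : C => f (p + l *: (q - p))) (fun=> 0) 0 1 0.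
rewrite add0r scale1r scale0r addr0 subrKC mul0r; apply.
  move=> t t01; have [d e1 e2] := H _ (seg t t01); rewrite add0r mulr1.
  have := is_derive_path d; rewrite (diff_partial _ d) e1 e2 !mul0r addr0.
  exact: id.
by move=> t _; rewrite normc0.
Qed.

Lemma holo_neq0 (O : set (C2 R)) (f : C2 R -> C) p : open O -> holomorphic_on O f -> O p -> f p != 0 ->
  exists2 r : R, 0 < r & forall q, vball p r q -> O q /\ f q != 0.
Proof.
move=> oO hf Op f0; have [r0 r00 H0] := open_subball oO Op.
have : nbhs p (f @^-1` [set~ 0]).
  apply: (differentiable_continuous (hf p Op)); apply/nbhsCP.
  exists (normc (f p)); first by rewrite normc_gt0.
  by move=> x + x0; rewrite x0 sub0r normcN ltxx.
move=> /nbhsC2P[r1 r10 H1]; exists (Num.min r0 r1) => [|q]; first by rewrite lt_min r00.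
by rewrite /vball /= lt_min => /andP[/H0 ? /H1 /eqP].
Qed.

(** dD / D is closed, so [poincare] gives a logarithm g up to a constant: D e^(-g) has zero
    derivatives, and a square root of this constant times e^(g / 2) is a root of D. *)
Lemma holo_sqrt (O : set (C2 R)) (D : C2 R -> C) p : open O -> holomorphic_on O D -> O p -> D p != 0 ->
  exists (r : R) (s : C2 R -> C), 0 < r /\
    forall q, vball p r q -> [/\ O q, differentiable s q & s q ^+ 2 = D q].
Proof.
move=> oO hD Op D0; have [r0 r00 H0] := holo_neq0 oO hD Op D0.
have oU := @open_vball p r0.
have hDi i := partial_holomorphic i oO hD.
have dq i j q : vball p r0 q -> differentiable (fun q : C2 R => partial i D q / D q) q /\
    partial j (fun q : C2 R => partial i D q / D q) q =
    (partial j (partial i D) q * D q - partial i D q * partial j D q) / D q ^+ 2.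
  by move=> /H0[Oq Dq]; exact: (partial_div j (hDi i q Oq) (hD q Oq) Dq).
have [|||r [g [rp Hg]]] := @poincare R (vball p r0) (fun q => partial z1 D q / D q) (fun q => partial z2 D q / D q) p oU (@vball_center p r0 r00).
- by move=> q /(dq z1 z1)[].
- by move=> q /(dq z2 z1)[].
- move=> q Uq; apply: etrans (dq z1 z2 q Uq).2 _; apply: etrans _ (esym (dq z2 z1 q Uq).2).
  have [Oq _] := H0 q Uq; apply: (congr1 (fun c => c / _)).
  exact: (congr2 (fun a b : C => a * D q - b) (partialC z2 z1 oO hD Oq) (mulrC _ _)).
have Hexp (c : C) i q : vball p r q -> differentiable (fun q : C2 R => cexp (c * g q)) q /\
    partial i (fun q : C2 R => cexp (c * g q)) q = cexp (c * g q) * (c * partial i g q).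
  move=> /Hg[_ dg _ _]; have [d e] := partialZ c i dg.
  have [d' e'] := partial_comp1 i (is_derive_cexp (c * g q)) d.
  by split; [exact: d'|exact: (etrans e' (congr1 (fun a : C => cexp (c * g q) * a) e))].
have const q : vball p r q -> D q * cexp (-1 * g q) = D p * cexp (-1 * g p).
  apply: (@ball_constant (fun q => D q * cexp (-1 * g q)) p r) => {}q qr.
  have [Uq dg e1 e2] := Hg q qr; have [Oq Dq] := H0 q Uq.
  have pz i (e : partial i g q = partial i D q / D q) :
      differentiable (fun q : C2 R => D q * cexp (-1 * g q)) q /\ partial i (fun q : C2 R => D q * cexp (-1 * g q)) q = 0.
    have [d' e'] := Hexp (-1) i q qr; have [d'' e''] := partialM i (hD q Oq) d'.
    split; first exact: d''.
    apply: etrans e'' _; apply: etrans (congr1 (fun c => _ + _ * c) e') _; rewrite e.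
    by move: (partial i D q) (D q) (cexp _) Dq => a b c b0; field.
  by split; [exact: (pz z1 e1).1|exact: (pz z1 e1).2|exact: (pz z2 e2).2].
pose c := sqrtC (D p * cexp (-1 * g p)).
exists r, (fun q => c * cexp (2^-1 * g q)); split; first exact: rp.
move=> q qr; have [Uq _ _ _] := Hg q qr; have [Oq Dq] := H0 q Uq; split; first exact: Oq.
  exact: (partialZ c z1 (Hexp 2^-1 z1 q qr).1).1.
rewrite exprMn sqrtCK -(const q qr) -mulrA expr2 -!cexpD.
rewrite (_ : _ + _ = 0) ?cexp0 ?mulr1//; by field.
Qed.

End Roots.

(** * From a product of two independent 1-forms to exact factors *)

Section Coframes.
Variable R : realType.
Local Notation C := (Cplx R).
Implicit Types (z w h d : C) (f g : C -> C).

Implicit Types (u v p q : C2 R).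

(** Differentiability and the value of the derivative travel together, so that the rules compose as
    terms and the derivative of a long formula is read off its proof. *)
Definition pd (f : C2 R -> C) k q (d : C) := differentiable f q /\ partial k f q = d.

Lemma pd0 (f : C2 R -> C) k q : differentiable f q -> pd f k q (partial k f q).
Proof. by move=> df; split; [exact: df|]. Qed.

Lemma pdD (f g : C2 R -> C) k q (a b : C) : pd f k q a -> pd g k q b ->
  pd (fun p : C2 R => f p + g p) k q (a + b).
Proof.
move=> [df ef] [dg eg]; have [d e] := partialD k df dg; split; first exact: d.
exact: etrans e (congr2 (fun a b : C => a + b) ef eg).
Qed.

Lemma pdM (f g : C2 R -> C) k q (a b : C) : pd f k q a -> pd g k q b ->
  pd (fun p : C2 R => f p * g p) k q (a * g q + f q * b).
Proof.
move=> [df ef] [dg eg]; have [d e] := partialM k df dg; split; first exact: d.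
exact: etrans e (congr2 (fun a b : C => a * g q + f q * b) ef eg).
Qed.

Lemma pdZ (c : C) (f : C2 R -> C) k q (a : C) : pd f k q a ->
  pd (fun p : C2 R => c * f p) k q (c * a).
Proof.
move=> [df ef]; have [d e] := partialZ c k df; split; first exact: d.
exact: etrans e (congr1 (fun a : C => c * a) ef).
Qed.

Lemma pd_div (f g : C2 R -> C) k q (a b : C) : pd f k q a -> pd g k q b -> g q != 0 ->
  pd (fun p : C2 R => f p / g p) k q ((a * g q - f q * b) / g q ^+ 2).
Proof.
move=> [df ef] [dg eg] g0; have [d e] := partial_div k df dg g0; split; first exact: d.
exact: etrans e (congr2 (fun a b : C => (a * g q - f q * b) / g q ^+ 2) ef eg).
Qed.

Lemma pd_cexp (c : C) (f : C2 R -> C) k q (a : C) : pd f k q a ->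
  pd (fun p : C2 R => cexp (c * f p)) k q (cexp (c * f q) * (c * a)).
Proof.
move=> /(pdZ c)[df ef]; have [d e] := partial_comp1 k (is_derive_cexp (c * f q)) df.
split; first exact: d.
exact: etrans e (congr1 (fun a : C => cexp (c * f q) * a) ef).
Qed.

Lemma brioschi_near (O : set (C2 R)) (a11 a12 a22 b11 b12 b22 : C2 R -> C) q : open O -> O q ->
  (forall p, O p -> a11 p = b11 p) -> (forall p, O p -> a12 p = b12 p) ->
  (forall p, O p -> a22 p = b22 p) ->
  brioschi_bracket a11 a12 a22 q = brioschi_bracket b11 b12 b22 q.
Proof.
move=> oO Oq e11 e12 e22.
have d (a b : C2 R -> C) (e : forall p, O p -> a p = b p) k p (Op : O p) := partial_near k oO Op e.
have dd (a b : C2 R -> C) (e : forall p, O p -> a p = b p) k l := partial_near l oO Oq (d a b e k).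
apply: etrans (brioschiE _ _ _ _) _; apply: etrans _ (esym (brioschiE _ _ _ _)).
exact: (brioschi_poly_congr (e11 q Oq) (e12 q Oq) (e22 q Oq) (d _ _ e11 _ q Oq) (d _ _ e11 _ q Oq)
  (d _ _ e12 _ q Oq) (d _ _ e12 _ q Oq) (d _ _ e22 _ q Oq) (d _ _ e22 _ q Oq)
  (dd _ _ e11 _ _) (dd _ _ e22 _ _) (dd _ _ e12 _ _)).
Qed.

(* Up to the factor X Z - Y, the left-hand side is the numerator of d omega, for the connection
   form omega of the coframe (X dz1 + Y dz2, dz1 + Z dz2). *)
Lemma brioschi_frame_poly (X x1 x2 x11 x12 x22 Y y1 y2 y11 y12 y22 Z w1 w2 w11 w12 w22 : C) :
  (X * Z - Y) * ((X * Z - Y) * ((x12 - y11) * Z + (x2 - y1) * w1 - w11 * Y - w1 * y1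
     - (x22 - y12 - w12 * X - w1 * x2))
   - ((x2 - y1) * Z - w1 * Y) * (x1 * Z + X * w1 - y1)
   + (x2 - y1 - w1 * X) * (x2 * Z + X * w2 - y2)) =
  - 8 * brioschi_poly X (X * Z + Y) (Y * Z) x1 x2 (x1 * Z + X * w1 + y1) (x2 * Z + X * w2 + y2)
    (y1 * Z + Y * w1) (y2 * Z + Y * w2) x22 (y11 * Z + y1 * w1 + (y1 * w1 + Y * w11))
    (x12 * Z + x2 * w1 + (x1 * w2 + X * w12) + y12).
Proof. by rewrite /brioschi_poly; field. Qed.

(** [brioschi_frame_poly] with the factor X Z - Y cancelled, arranged as the equality of the two
    numerators that the quotient rule produces for the coefficients of omega; hence the factors -1
    left by [pdZ]. *)
Lemma frame_closed_poly (X x1 x2 x11 x12 x22 Y y1 y2 y11 y12 y21 y22 Z w1 w2 w11 w12 w21 w22 : C) :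
  y21 = y12 -> w21 = w12 -> X * Z + -1 * Y != 0 ->
  brioschi_poly X (X * Z + Y) (Y * Z) x1 x2 (x1 * Z + X * w1 + y1) (x2 * Z + X * w2 + y2)
    (y1 * Z + Y * w1) (y2 * Z + Y * w2) x22 (y11 * Z + y1 * w1 + (y1 * w1 + Y * w11))
    (x12 * Z + x2 * w1 + (x1 * w2 + X * w12) + y12) = 0 ->
  (x22 + -1 * y21 + -1 * (w21 * X + w1 * x2)) * (X * Z + -1 * Y) -
    (x2 + -1 * y1 + -1 * (w1 * X)) * (x2 * Z + X * w2 + -1 * y2) =
  ((x12 + -1 * y11) * Z + (x2 + -1 * y1) * w1 + -1 * (w11 * Y + w1 * y1)) * (X * Z + -1 * Y) -
    ((x2 + -1 * y1) * Z + -1 * (w1 * Y)) * (x1 * Z + X * w1 + -1 * y1).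
Proof.
move=> -> -> D0 B0.
have := brioschi_frame_poly X x1 x2 x11 x12 x22 Y y1 y2 y11 y12 y22 Z w1 w2 w11 w12 w22.
rewrite B0 mulr0 => /eqP; rewrite mulf_eq0 => /orP[/eqP DE|/eqP E].
  by move: D0; rewrite mulN1r DE eqxx.
apply/eqP; rewrite eq_sym -subr_eq0; apply/eqP; rewrite -[RHS]E; ring.
Qed.

Section Frame.
Variables (O : set (C2 R)) (X Y Z : C2 R -> C).
Hypotheses (oO : open O) (hX : holomorphic_on O X) (hY : holomorphic_on O Y) (hZ : holomorphic_on O Z).
Hypothesis D0 : forall q, O q -> X q * Z q + -1 * Y q != 0.

Let M q := X q * Z q + Y q.
Let G q := Y q * Z q.

Lemma brioschi_frame q : O q ->
  brioschi_bracket X M G q = brioschi_poly (X q) (X q * Z q + Y q) (Y q * Z q)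
    (partial z1 X q) (partial z2 X q)
    (partial z1 X q * Z q + X q * partial z1 Z q + partial z1 Y q)
    (partial z2 X q * Z q + X q * partial z2 Z q + partial z2 Y q)
    (partial z1 Y q * Z q + Y q * partial z1 Z q) (partial z2 Y q * Z q + Y q * partial z2 Z q)
    (partial z2 (partial z2 X) q)
    (partial z1 (partial z1 Y) q * Z q + partial z1 Y q * partial z1 Z q +
      (partial z1 Y q * partial z1 Z q + Y q * partial z1 (partial z1 Z) q))
    (partial z1 (partial z2 X) q * Z q + partial z2 X q * partial z1 Z q +
      (partial z1 X q * partial z2 Z q + X q * partial z1 (partial z2 Z) q) + partial z1 (partial z2 Y) q).
Proof.
move=> Oq; apply: etrans (brioschiE _ _ _ _) _.
have h (f : C2 R -> C) (hf : holomorphic_on O f) k p (Op : O p) := pd0 k (hf p Op).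
have h' (f : C2 R -> C) (hf : holomorphic_on O f) k l p (Op : O p) :=
  pd0 l (partial_holomorphic k oO hf Op).
have dM k p (Op : O p) := pdD (pdM (h _ hX k p Op) (h _ hZ k p Op)) (h _ hY k p Op).
have dG k p (Op : O p) := pdM (h _ hY k p Op) (h _ hZ k p Op).
have M12 := partial_near z1 oO Oq (fun p Op => (dM z2 p Op).2).
have G11 := partial_near z1 oO Oq (fun p Op => (dG z1 p Op).2).
have M12' := pdD (pdD (pdM (h' _ hX z2 z1 q Oq) (h _ hZ z1 q Oq)) (pdM (h _ hX z1 q Oq) (h' _ hZ z2 z1 q Oq)))
  (h' _ hY z2 z1 q Oq).
have G11' := pdD (pdM (h' _ hY z1 z1 q Oq) (h _ hZ z1 q Oq)) (pdM (h _ hY z1 q Oq) (h' _ hZ z1 z1 q Oq)).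
exact: (brioschi_poly_congr erefl erefl erefl erefl erefl (dM z1 q Oq).2 (dM z2 q Oq).2
  (dG z1 q Oq).2 (dG z2 q Oq).2 erefl (etrans G11 G11'.2) (etrans M12 M12'.2)).
Qed.

(* Write the form as the product of alpha = X dz1 + Y dz2 and beta = dz1 + Z dz2, and let
   omega be the 1-form with d alpha = omega /\ alpha and d beta = - omega /\ beta. The bracket
   vanishes iff omega is closed; then omega = dg, and e^(-g) alpha = df1, e^g beta = df2. *)
Lemma frame_exact p : O p -> (forall q, O q -> brioschi_bracket X M G q = 0) ->
  exists (r : R) (f1 f2 : C2 R -> C), 0 < r /\ forall q, vball p r q ->
    [/\ O q, differentiable f1 q, differentiable f2 q &
      [/\ X q = partial z1 f1 q * partial z1 f2 q,
       M q = partial z1 f1 q * partial z2 f2 q + partial z2 f1 q * partial z1 f2 q &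
       G q = partial z2 f1 q * partial z2 f2 q]].
Proof.
move=> Op B0.
have h (f : C2 R -> C) (hf : holomorphic_on O f) k q (Oq : O q) := pd0 k (hf q Oq).
have h' (f : C2 R -> C) (hf : holomorphic_on O f) k l q (Oq : O q) :=
  pd0 l (partial_holomorphic k oO hf Oq).
have dD k q (Oq : O q) := pdD (pdM (h _ hX k q Oq) (h _ hZ k q Oq)) (pdZ (-1) (h _ hY k q Oq)).
have dA k q (Oq : O q) := pdD (h' _ hX z2 k q Oq) (pdZ (-1) (h' _ hY z1 k q Oq)).
have dN1 k q (Oq : O q) := pdD (dA k q Oq) (pdZ (-1) (pdM (h' _ hZ z1 k q Oq) (h _ hX k q Oq))).
have dN2 k q (Oq : O q) := pdD (pdM (dA k q Oq) (h _ hZ k q Oq)) (pdZ (-1) (pdM (h' _ hZ z1 k q Oq) (h _ hY k q Oq))).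
have dW1 k q (Oq : O q) := pd_div (dN1 k q Oq) (dD k q Oq) (D0 Oq).
have dW2 k q (Oq : O q) := pd_div (dN2 k q Oq) (dD k q Oq) (D0 Oq).
have [|r [g [rp Hg]]] := poincare oO Op (fun q Oq => (dW1 z1 q Oq).1) (fun q Oq => (dW2 z1 q Oq).1).
  move=> q Oq; apply: etrans (dW1 z2 q Oq).2 _; apply: etrans _ (esym (dW2 z1 q Oq).2).
  apply: (congr1 (fun a : C => a / _)).
  exact: (@frame_closed_poly _ _ _ (partial z1 (partial z1 X) q) _ _ _ _ _ _ _ _ (partial z2 (partial z2 Y) q)
    _ _ _ _ _ _ (partial z2 (partial z2 Z) q)
    (partialC z2 z1 oO hY Oq) (partialC z2 z1 oO hZ Oq) (D0 Oq) (etrans (esym (brioschi_frame Oq)) (B0 q Oq))).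
have oU := @open_vball R p r; have Up := @vball_center R p r rp.
have OU q (Uq : vball p r q) : O q by have [] := Hg q Uq.
(* omega = W1 dz1 + W2 dz2. The equations for d alpha and d beta are linear in (W1, W2) with
   determinant X Z - Y up to sign, and Cramer's rule gives these quotients. *)
pose W1 q := (partial z2 X q + -1 * partial z1 Y q + -1 * (partial z1 Z q * X q)) / (X q * Z q + -1 * Y q).
pose W2 q := ((partial z2 X q + -1 * partial z1 Y q) * Z q + -1 * (partial z1 Z q * Y q)) / (X q * Z q + -1 * Y q).
have e1 (c : C) q (Uq : vball p r q) : pd (fun p : C2 R => cexp (c * g p)) z1 q (cexp (c * g q) * (c * W1 q)).
  by apply: pd_cexp; have [_ dg g1 _] := Hg q Uq; split; [exact: dg|exact: g1].
have e2 (c : C) q (Uq : vball p r q) : pd (fun p : C2 R => cexp (c * g p)) z2 q (cexp (c * g q) * (c * W2 q)).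
  by apply: pd_cexp; have [_ dg _ g2] := Hg q Uq; split; [exact: dg|exact: g2].
have a1 q (Uq : vball p r q) := pdM (e1 (-1) q Uq) (h _ hY z1 q (OU q Uq)).
have a2 q (Uq : vball p r q) := pdM (e2 (-1) q Uq) (h _ hX z2 q (OU q Uq)).
have b1 q (Uq : vball p r q) := pdM (e1 1 q Uq) (h _ hZ z1 q (OU q Uq)).
have b2 q (Uq : vball p r q) := e2 1 q Uq.
(* d (e^(-g) alpha) = e^(-g) (d alpha - omega /\ alpha) = 0; the next call treats e^g beta in the
   same way. *)
have [|r1 [f1 [r1p Hf1]]] := poincare oU Up (fun q Uq => (a2 q Uq).1) (fun q Uq => (a1 q Uq).1).
  move=> q Uq; apply: etrans (a2 q Uq).2 _; apply: etrans _ (esym (a1 q Uq).2).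
  have := D0 (OU q Uq); rewrite /W1 /W2; move: (cexp _) (X q) (Y q) (Z q) (partial z2 X q) (partial z1 Y q) (partial z1 Z q).
  by move=> E x y w x2 y1 w1 d0; field.
have [|r2 [f2 [r2p Hf2]]] := poincare oU Up (fun q Uq => (b2 q Uq).1) (fun q Uq => (b1 q Uq).1).
  move=> q Uq; apply: etrans (b2 q Uq).2 _; apply: etrans _ (esym (b1 q Uq).2).
  have := D0 (OU q Uq); rewrite /W1 /W2; move: (cexp _) (X q) (Y q) (Z q) (partial z2 X q) (partial z1 Y q) (partial z1 Z q).
  by move=> E x y w x2 y1 w1 d0; field.
exists (Num.min r1 r2), f1, f2; split; first by rewrite lt_min r1p.
move=> q; rewrite /vball /= lt_min => /andP[/Hf1[Uq d1 f11 f12] /Hf2[_ d2 f21 f22]].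
have EE : cexp (-1 * g q) * cexp (1 * g q) = 1.
  by rewrite -cexpD -mulrDl addNr mul0r cexp0.
split; [exact: (OU q Uq)|exact: d1|exact: d2|].
have EF (a b : C) : a * b = cexp (-1 * g q) * a * (cexp (1 * g q) * b).
  by rewrite mulrACA EE mul1r.
split.
- apply: etrans _ (esym (congr2 (fun a b : C => a * b) f11 f21)).
  by have := EF (X q) 1; rewrite !mulr1.
- apply: etrans _ (esym (congr2 (fun a b : C => a + b)
    (congr2 (fun a b : C => a * b) f11 f22) (congr2 (fun a b : C => a * b) f12 f21))).
  by have := EF (Y q) 1; rewrite -(EF (X q) (Z q)) !mulr1 => <-.
- apply: etrans _ (esym (congr2 (fun a b : C => a * b) f12 f22)).
  exact: EF.
Qed.

End Frame.

End Coframes.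

(** * Factorization of a nondegenerate quadratic form *)

Section LocalExact.
Variable R : realType.
Local Notation C := (Cplx R).
Implicit Types (z w h d : C) (f g : C -> C).

Implicit Types (u v p q : C2 R).

Theorem local_exact (O : set (C2 R)) (a11 a12 a22 : C2 R -> C) p : open O -> O p ->
  holomorphic_on O a11 -> holomorphic_on O a12 -> holomorphic_on O a22 ->
  det_loc a11 a12 a22 p != 0 ->
  (forall q, O q -> brioschi_bracket a11 a12 a22 q = 0) ->
  exists (r : R) (f1 f2 : C2 R -> C), 0 < r /\ forall q, vball p r q ->
    [/\ O q, differentiable f1 q, differentiable f2 q &
      [/\ a11 q = partial z1 f1 q * partial z1 f2 q,
       a12 q = partial z1 f1 q * partial z2 f2 q + partial z2 f1 q * partial z1 f2 q &
       a22 q = partial z2 f1 q * partial z2 f2 q]].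
Proof.
move=> oO Op h11 h12 h22 det0 B0.
(* P is a root of t^2 - a12 t + a11 a22, so that the form factors as
   (a11 dz1 + P dz2) (dz1 + (a22 / P) dz2); the sign c of the square root is chosen
   so that P does not vanish at p. *)
pose Delta (q : C2 R) := 4^-1 * (a12 q * a12 q) + -1 * (a11 q * a22 q).
have hDelta : holomorphic_on O Delta.
  by move=> q Oq; exact: (pdD (pdZ 4^-1 (pdM (pd0 z1 (h12 q Oq)) (pd0 z1 (h12 q Oq))))
    (pdZ (-1) (pdM (pd0 z1 (h11 q Oq)) (pd0 z1 (h22 q Oq))))).1.
have DE : Delta p != 0.
  by rewrite (_ : Delta p = - det_loc a11 a12 a22 p) ?oppr_eq0// /Delta /det_loc; ring.
have [r0 [s [r0p Hs]]] := holo_sqrt oO hDelta Op DE.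
have oU := @open_vball R p r0; have Up := @vball_center R p r0 r0p.
have [_ _ sp2] := Hs p Up.
have sp : s p != 0 by apply: contraNneq DE => s0; rewrite -sp2 s0 expr0n.
(* The two roots differ by 2 s p, nonzero like the discriminant, so at most one of them vanishes at
   p. *)
have [c [c2 Pp]] : exists c : C, c ^+ 2 = 1 /\ 2^-1 * a12 p + c * s p != 0.
  have [E|] := eqVneq (2^-1 * a12 p + 1 * s p) 0; last by exists 1; rewrite expr1n.
  exists (-1); split; first by rewrite sqrrN expr1n.
  apply: contraNneq sp => E'; have : (2^-1 * a12 p + 1 * s p) - (2^-1 * a12 p + -1 * s p) = 0.
    by rewrite E E' subrr.
  rewrite (_ : _ - _ = 2 * s p); last by ring.
  by move=> /eqP; rewrite mulf_eq0 pnatr_eq0.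
have c0 : c != 0 by apply: contra_eq_neq c2 => ->; rewrite expr0n eq_sym oner_eq0.
pose P (q : C2 R) := 2^-1 * a12 q + c * s q.
(* P is a denominator and a12 - 2 P equals the coframe determinant a11 B - P; taking their product
   lets one ball serve both. *)
pose PD (q : C2 R) := P q * (a12 q + -2 * P q).
have hP : holomorphic_on (vball p r0) P.
  move=> q /Hs[Oq ds _].
  exact: (pdD (pdZ 2^-1 (pd0 z1 (h12 q Oq))) (pdZ c (pd0 z1 ds))).1.
have hPD : holomorphic_on (vball p r0) PD.
  move=> q Uq; have [Oq _ _] := Hs q Uq; have dP := pd0 z1 (hP q Uq).
  exact: (pdM dP (pdD (pd0 z1 (h12 q Oq)) (pdZ (-2) dP))).1.
have PDp : PD p != 0.
  rewrite mulf_neq0// (_ : _ + _ = -2 * c * s p); last by rewrite /P; field.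
  by rewrite !mulf_neq0// oppr_eq0 pnatr_eq0.
have [r1 r1p H1] := holo_neq0 oU hPD Up PDp.
have H1' q (Vq : vball p r1 q) : [/\ O q, differentiable P q, P q != 0 & a12 q + -2 * P q != 0].
  have [Uq] := H1 q Vq; rewrite mulf_eq0 negb_or => /andP[P0 D0].
  by have [Oq _ _] := Hs q Uq; split; [exact: Oq|exact: (hP q Uq)|exact: P0|exact: D0].
have oV := @open_vball R p r1; have Vp := @vball_center R p r1 r1p.
have quad q (Vq : vball p r1 q) : P q ^+ 2 - a12 q * P q + a11 q * a22 q = 0.
  have [Uq _] := H1 q Vq; have [_ _ sE] := Hs q Uq.
  have -> : P q ^+ 2 - a12 q * P q + a11 q * a22 q = c ^+ 2 * s q ^+ 2 - Delta q.
    by rewrite /P /Delta; field.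
  by rewrite sE c2 mul1r subrr.
pose B (q : C2 R) := a22 q / P q.
have hB : holomorphic_on (vball p r1) B.
  move=> q Vq; have [Oq dP P0 _] := H1' q Vq.
  exact: (pd_div (pd0 z1 (h22 q Oq)) (pd0 z1 dP) P0).1.
have e12 q (Vq : vball p r1 q) : a12 q = a11 q * B q + P q.
  have [Oq dP P0 _] := H1' q Vq; apply: (mulIf P0); apply/eqP.
  rewrite eq_sym -subr_eq0 /B; apply/eqP; rewrite -[RHS](quad q Vq).
  by move: (a12 q) (a11 q) (a22 q) (P q) P0 => *; field.
have e22 q (Vq : vball p r1 q) : a22 q = P q * B q.
  by have [_ _ P0 _] := H1' q Vq; rewrite /B mulrC divfK.
have VO q (Vq : vball p r1 q) : O q by case: (H1' q Vq).
have D0 q (Vq : vball p r1 q) : a11 q * B q + -1 * P q != 0.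
  have [_ _ _] := H1' q Vq; rewrite {1}(e12 q Vq).
  by rewrite (_ : _ + -2 * _ = a11 q * B q + -1 * P q)//; ring.
have [|r2 [f1 [f2 [r2p Hf]]]] := @frame_exact R (vball p r1) a11 P B oV
    (fun q Vq => h11 q (VO q Vq)) (fun q Vq => let: And4 _ d _ _ := H1' q Vq in d) hB D0 p Vp.
  move=> q Vq; rewrite -(B0 q (VO q Vq)).
  by apply/esym; exact: (brioschi_near oV Vq (fun _ _ => erefl) e12 e22).
exists (Num.min r1 r2), f1, f2; split; first by rewrite lt_min r1p.
move=> q; rewrite /vball /= lt_min => /andP[Vq /Hf[_ d1 d2 [E1 E2 E3]]].
split; [exact: VO|exact: d1|exact: d2|].
split; [exact: E1|exact: (etrans (e12 q Vq) E2)|exact: (etrans (e22 q Vq) E3)].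
Qed.

End LocalExact.

(** * Symmetric differentials on surfaces *)

Section QuadraticForms.
Variable R : realType.
Local Notation C := (Cplx R).
Implicit Types (z w h d : C) (f g : C -> C).

Implicit Types (u v p q : C2 R).

Lemma holoM (O : set (C2 R)) (f g : C2 R -> C) : holomorphic_on O f -> holomorphic_on O g ->
  holomorphic_on O (fun q : C2 R => f q * g q).
Proof. by move=> df dg q Oq; case: (partialM z1 (df q Oq) (dg q Oq)). Qed.

Lemma holoB (O : set (C2 R)) (f g : C2 R -> C) : holomorphic_on O f -> holomorphic_on O g ->
  holomorphic_on O (fun q : C2 R => f q - g q).
Proof. by move=> df dg q Oq; exact: (differentiableB (df q Oq) (dg q Oq)). Qed.

Lemma det_loc_holo (O : set (C2 R)) (a11 a12 a22 : C2 R -> C) :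
  holomorphic_on O a11 -> holomorphic_on O a12 -> holomorphic_on O a22 ->
  holomorphic_on O (det_loc a11 a12 a22).
Proof. by move=> h1 h2 h3; exact: (holoB (holoM h1 h3) (holoZ 4^-1 (holoM h2 h2))). Qed.

Lemma brioschi_holo (O : set (C2 R)) (a11 a12 a22 : C2 R -> C) : open O ->
  holomorphic_on O a11 -> holomorphic_on O a12 -> holomorphic_on O a22 ->
  holomorphic_on O (brioschi_bracket a11 a12 a22).
Proof.
move=> oO hE hM hG; have hp i (f : C2 R -> C) := @partial_holomorphic R O f i oO.
have hE1 := hp z1 _ hE; have hE2 := hp z2 _ hE; have hM1 := hp z1 _ hM; have hM2 := hp z2 _ hM.
have hG1 := hp z1 _ hG; have hG2 := hp z2 _ hG.
have hE22 := hp z2 _ hE2; have hG11 := hp z1 _ hG1; have hM12 := hp z1 _ hM2.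
have -> : brioschi_bracket a11 a12 a22 = (fun q : C2 R => brioschi_poly (a11 q) (a12 q) (a22 q)
    (partial z1 a11 q) (partial z2 a11 q) (partial z1 a12 q) (partial z2 a12 q)
    (partial z1 a22 q) (partial z2 a22 q) (partial z2 (partial z2 a11) q)
    (partial z1 (partial z1 a22) q) (partial z1 (partial z2 a12) q)).
  by apply/funext => q; exact: brioschiE.
have hc (c : C) : holomorphic_on O (fun=> c) by move=> q _; exact: differentiable_cst.
exact: (holoM (hc 8^-1) (holoB (holoD (holoD (holoB
  (holoM (holoB (holoB (holoM (hc 2) hM12) (holoM (hc 2) hE22)) (holoM (hc 2) hG11))
         (holoB (holoM (holoM (hc 2) hE) hG) (holoM (hc 2^-1) (holoM hM hM))))
  (holoM (holoM (hc 2) hE1) (holoB (holoM (holoB hM2 hG1) hG) (holoM (holoM (hc 2^-1) hM) hG2))))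
  (holoM (holoM (hc 2) (holoB hM1 hE2)) (holoB (holoM (holoM (hc 2^-1) hM) (holoB hM2 hG1)) (holoM hE hG2))))
  (holoM (holoM (hc 2) hE2) (holoB (holoM hE2 hG) (holoM (holoM (hc 2^-1) hM) hG1))))
  (holoM (holoM (hc 2) hG1) (holoB (holoM (holoM hE2 (hc 2^-1)) hM) (holoM hE hG1))))).
Qed.

Lemma qform_pt (a b c x y : C) : qform a b c (pt x y) = a * x ^+ 2 + b * (x * y) + c * y ^+ 2.
Proof. by have [] := pt_coord x y; rewrite /qform; move: (pt x y) => v -> ->. Qed.

Lemma qform_inj (a11 a12 a22 b11 b12 b22 : C) :
  (forall v, qform a11 a12 a22 v = qform b11 b12 b22 v) -> [/\ a11 = b11, a12 = b12 & a22 = b22].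
Proof.
move=> H; have h1 := etrans (esym (qform_pt _ _ _ 1 0)) (etrans (H (pt 1 0)) (qform_pt _ _ _ 1 0)).
have h2 := etrans (esym (qform_pt _ _ _ 0 1)) (etrans (H (pt 0 1)) (qform_pt _ _ _ 0 1)).
have h3 := etrans (esym (qform_pt _ _ _ 1 1)) (etrans (H (pt 1 1)) (qform_pt _ _ _ 1 1)).
have e1 : a11 = b11 by move: h1; rewrite expr1n expr0n /= !mulr1 !mulr0 !addr0.
have e2 : a22 = b22 by move: h2; rewrite expr1n expr0n /= !mul0r !mulr1 !mulr0 !add0r.
by split => //; move: h3; rewrite expr1n !mulr1 e1 e2 => /addIr /addrI.
Qed.

Lemma qform_product (a11 a12 a22 p1 p2 q1 q2 : C) :
  (forall v, qform a11 a12 a22 v = (p1 * v 0 z1 + p2 * v 0 z2) * (q1 * v 0 z1 + q2 * v 0 z2)) <->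
  [/\ a11 = p1 * q1, a12 = p1 * q2 + p2 * q1 & a22 = p2 * q2].
Proof.
have E v : (p1 * v 0 z1 + p2 * v 0 z2) * (q1 * v 0 z1 + q2 * v 0 z2) =
    qform (p1 * q1) (p1 * q2 + p2 * q1) (p2 * q2) v.
  by rewrite /qform; move: (v 0 z1) (v 0 z2) => x y; ring.
by split=> [H|[-> -> ->] v]; [apply: qform_inj => v; rewrite H E|rewrite E].
Qed.

Lemma qform_pull (a11 a12 a22 b11 b12 b22 x1 x2 y1 y2 : C) :
  (forall v, qform a11 a12 a22 v =
     qform b11 b12 b22 (pt (x1 * v 0 z1 + x2 * v 0 z2) (y1 * v 0 z1 + y2 * v 0 z2))) ->
  [/\ a11 = b11 * x1 * x1 + 2^-1 * (b12 * x1 * y1) + 2^-1 * (b12 * x1 * y1) + b22 * y1 * y1,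
     a12 = 2 * (b11 * x1 * x2 + 2^-1 * (b12 * x1 * y2) + 2^-1 * (b12 * x2 * y1) + b22 * y1 * y2) &
     a22 = b11 * x2 * x2 + 2^-1 * (b12 * x2 * y2) + 2^-1 * (b12 * x2 * y2) + b22 * y2 * y2].
Proof.
move=> H; apply: qform_inj => v; apply: etrans (H v) _; apply: etrans (qform_pt _ _ _ _ _) _.
by rewrite /qform; move: (v 0 z1) (v 0 z2) => x y; field.
Qed.

Lemma differentiable_coordf (T : C2 R -> C2 R) p i : differentiable T p ->
  differentiable (fun q : C2 R => T q 0 i : C) p /\
  forall v, 'd (fun q : C2 R => T q 0 i : C) p v = 'd T p v 0 i.
Proof.
move=> dT; have lin : linear (fun v : C2 R => v 0 i : C) by move=> k u v; rewrite !mxE.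
pose Lm := GRing.isLinear.Build _ _ _ _ _ lin.
pose L : {linear C2 R -> C} := HB.pack (fun v : C2 R => v 0 i : C) Lm.
have cL : continuous L by move=> x; apply: (differentiable_continuous (f := L)); exact: differentiable_coord.
have dL := @linear_differentiable _ _ _ L (T p) cL.
split; first exact: (differentiable_comp dT dL).
move=> v; apply: etrans (congr1 (fun k : C2 R -> C => k v) (diff_comp dT dL)) _.
by rewrite /= (diff_lin _ cL).
Qed.

End QuadraticForms.

(** * The bracket as a section of 4 K_X *)

Section P2Operator.
Variable R : realType.
Local Notation C := (Cplx R).
Implicit Types (z w h d : C) (f g : C -> C).

Section Surface.
Variable X : complex_surface R.
Implicit Types (a b : chart X) (x y : X) (om : symdiff X).

Lemma chart_sub_open a (U : set X) : open U -> open (chart_map a @` (chart_dom a `&` U)).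
Proof.
move=> oU; rewrite openE => _ [x [ax Ux] <-].
have img : chart_img a (chart_map a x) by exists x.
have n1 := open_nbhs_nbhs (conj (@chart_img_open R X a) img).
have n2 : nbhs (chart_map a x) (chart_inv a @^-1` U).
  apply: (chart_inv_continuous img); rewrite chart_mapK//.
  exact: open_nbhs_nbhs (conj oU Ux).
apply: filterS (filterI n1 n2) => _ [[y ay <-]]; rewrite /preimage /= chart_mapK// => Uy.
by exists y.
Qed.

Definition overlap a b : set (C2 R) := chart_map a @` (chart_dom a `&` chart_dom b).

Lemma open_overlap a b : open (overlap a b).
Proof. by apply: chart_sub_open; exact: chart_dom_open. Qed.

Definition tcoord a b (i : 'I_2) : C2 R -> C := fun q => transition a b q 0 i.

Lemma transition_pt a b q : pt (tcoord a b z1 q) (tcoord a b z2 q) = transition a b q.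
Proof. exact: pt_eta. Qed.

Lemma transition_chart a b x : chart_dom a x -> transition a b (chart_map a x) = chart_map b x.
Proof. by move=> ax; rewrite /transition /= chart_mapK. Qed.

Lemma transition_diff a b q : overlap a b q -> differentiable (transition a b) q.
Proof. exact: transition_holomorphic. Qed.

Lemma tcoord_holo a b i : holomorphic_on (overlap a b) (tcoord a b i).
Proof. by move=> q Oq; exact: (differentiable_coordf i (transition_diff Oq)).1. Qed.

Lemma transition_img a b q : overlap a b q -> chart_img b (transition a b q).
Proof. by move=> [x [ax bx] <-]; rewrite transition_chart//; exists x. Qed.

Definition tjac a b q : C := partial z1 (tcoord a b z1) q * partial z2 (tcoord a b z2) q -
  partial z2 (tcoord a b z1) q * partial z1 (tcoord a b z2) q.

Lemma diff_tcoord a b q v i : overlap a b q ->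
  'd (transition a b) q v 0 i = partial z1 (tcoord a b i) q * v 0 z1 + partial z2 (tcoord a b i) q * v 0 z2.
Proof.
move=> Oq; have [d e] := differentiable_coordf i (transition_diff Oq).
by rewrite -e; exact: (diff_partial v d).
Qed.

Lemma diff_transition a b q v : overlap a b q -> 'd (transition a b) q v =
  pt (partial z1 (tcoord a b z1) q * v 0 z1 + partial z2 (tcoord a b z1) q * v 0 z2)
     (partial z1 (tcoord a b z2) q * v 0 z1 + partial z2 (tcoord a b z2) q * v 0 z2).
Proof.
move=> Oq; apply: etrans (esym (pt_eta _)) _.
exact: (congr2 (fun s t : C => pt s t) (diff_tcoord v z1 Oq) (diff_tcoord v z2 Oq)).
Qed.

Lemma lform_ei (f : 'I_2 -> C) i : f z1 * (ei R i) 0 z1 + f z2 * (ei R i) 0 z2 = f i.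
Proof.
by rewrite !mxE !eqxx /=; have [->|->] := ord2P i; rewrite !eqxx /= !(mulr1, mulr0, addr0, add0r).
Qed.

(** Tangent vectors are rows, so the matrix is the transpose of the usual Jacobian; its determinant
    is the same. *)
Lemma jacobian_entry a b q (i j : 'I_2) : overlap a b q ->
  jacobian (transition a b) q i j = partial i (tcoord a b j) q.
Proof.
move=> Oq; apply: etrans (mxE _ _ _ _) _; apply: etrans (diff_tcoord (ei R i) j Oq) _.
exact: (lform_ei (fun k => partial k (tcoord a b j) q) i).
Qed.

Lemma jacobian_tjac a b q : overlap a b q -> \det (jacobian (transition a b) q) = tjac a b q.
Proof.
move=> Oq; apply: etrans (det_mx22 _) _.
have e0 : (0 : 'I_2) = z1 by exact: val_inj.
have e1 : (1 : 'I_2) = z2 by exact: val_inj.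
have H (k l m n k' l' m' n' : C) : k = k' -> l = l' -> m = m' -> n = n' ->
  k * l - m * n = k' * l' - n' * m' by move=> -> -> -> ->; congr (_ - _); exact: mulrC.
rewrite e0 e1.
exact: (H _ _ _ _ _ _ _ _ (jacobian_entry z1 z1 Oq) (jacobian_entry z2 z2 Oq)
  (jacobian_entry z1 z2 Oq) (jacobian_entry z2 z1 Oq)).
Qed.

Lemma compat_pull om a b q : overlap a b q ->
  let P := pull (tcoord a b z1) (tcoord a b z2) (c11 om b) (c12 om b) (c22 om b) in
  [/\ c11 om a q = P z1 z1 q, c12 om a q = 2 * P z1 z2 q & c22 om a q = P z2 z2 q].
Proof.
move=> Oq; have [x [ax bx] xq] := Oq.
have H v : qform (c11 om a q) (c12 om a q) (c22 om a q) v =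
    qform (c11 om b (transition a b q)) (c12 om b (transition a b q)) (c22 om b (transition a b q))
      ('d (transition a b) q v).
  by have := symdiff_compat om ax bx v; rewrite /= -(transition_chart b ax) xq.
have := @qform_pull R _ _ _ _ _ _ _ _ _ _ (fun v => etrans (H v) (congr1 (qform _ _ _) (diff_transition v Oq))).
by rewrite -transition_pt.
Qed.

Lemma bracket_compat om a b q : overlap a b q ->
  brioschi_bracket (c11 om a) (c12 om a) (c22 om a) q =
  brioschi_bracket (c11 om b) (c12 om b) (c22 om b) (transition a b q) * tjac a b q ^+ 4.
Proof.
move=> Oq; rewrite -transition_pt; apply: (@brioschi_pullback R (overlap a b) (chart_img b)) Oq _ _ _.
- exact: open_overlap.
- exact: chart_img_open.
- exact: tcoord_holo.
- exact: tcoord_holo.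
- by move=> p Op; rewrite transition_pt; exact: transition_img.
- exact: c11_holomorphic.
- exact: c12_holomorphic.
- exact: c22_holomorphic.
- by move=> p Op; have [] := compat_pull om Op.
- by move=> p Op; have [] := compat_pull om Op.
- by move=> p Op; have [] := compat_pull om Op.
Qed.

Lemma det_loc_compat om a b q : overlap a b q ->
  det_loc (c11 om a) (c12 om a) (c22 om a) q =
  det_loc (c11 om b) (c12 om b) (c22 om b) (transition a b q) * tjac a b q ^+ 2.
Proof.
move=> Oq; have [e1 e2 e3] := compat_pull om Oq; rewrite /det_loc e1 e2 e3 -transition_pt /pull /tri /cmp /tjac.
move: (c11 om b _) (c12 om b _) (c22 om b _) => b1 b2 b3.
move: (partial z1 (tcoord a b z1) q) (partial z2 (tcoord a b z1) q) => s t.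
by move: (partial z1 (tcoord a b z2) q) (partial z2 (tcoord a b z2) q) => m n; field.
Qed.

Definition P2coef om a : C2 R -> C := brioschi_bracket (c11 om a) (c12 om a) (c22 om a).

Lemma P2coef_holomorphic om a : holomorphic_on (chart_img a) (P2coef om a).
Proof.
by apply: brioschi_holo (@chart_img_open R X a) _ _ _;
  [exact: c11_holomorphic|exact: c12_holomorphic|exact: c22_holomorphic].
Qed.

Lemma P2coef_compat om a b x : chart_dom a x -> chart_dom b x ->
  P2coef om a (chart_map a x) =
  P2coef om b (chart_map b x) * \det (jacobian (transition a b) (chart_map a x)) ^+ 4.
Proof.
move=> ax bx; have Oq : overlap a b (chart_map a x) by exists x.
by rewrite jacobian_tjac// /P2coef (bracket_compat om Oq) transition_chart.
Qed.

Definition P2 om : pluricanonical X 4 :=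
  Pluricanonical (@P2coef_holomorphic om) (@P2coef_compat om).

Lemma P2_is_P2_operator : is_P2_operator P2.
Proof.
move=> om a z az; split=> [//|d0].
by rewrite /= /P2coef /RC_loc mulrA divff ?mul1r// expf_neq0.
Qed.

End Surface.

End P2Operator.

(** * Analytic subsets, and exact decompositions versus the bracket *)

Section ClosedDifferentials.
Variable R : realType.
Local Notation C := (Cplx R).
Implicit Types (z w h d : C) (f g : C -> C).

Section SurfaceAnalysis.
Variable X : complex_surface R.
Implicit Types (a b : chart X) (x y : X) (om : symdiff X).

Lemma chart_preim_open a (W : set (C2 R)) : open W -> open (chart_dom a `&` chart_map a @^-1` W).
Proof.
move=> oW; rewrite openE => x [ax Wx].
apply: filterI; first exact: (open_nbhs_nbhs (conj (@chart_dom_open R X a) ax)).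
exact: (chart_map_continuous ax (open_nbhs_nbhs (conj oW Wx))).
Qed.

(** The identity principle is applied on a ball centred at a nearby point c around which F vanishes,
    and that ball reaches beyond p. *)
Lemma holo_zero_extend (O : set (C2 R)) (F : C2 R -> C) p : open O -> O p -> holomorphic_on O F ->
  (forall r : R, 0 < r -> exists2 c : C2 R, vnorm (c - p) < r & nbhs c [set q | F q = 0]) ->
  nbhs p [set q | F q = 0].
Proof.
move=> oO Op hF H; have [r [M [r0 HM]]] := holo_locally_bounded oO hF Op.
(* With |c - p| < r / 6 the ball of radius 5 r / 6 around c lies in the given one; F vanishes within
   5 r / 12 of c, which covers the ball of radius r / 12 around p. *)
have [c cp /nbhsC2P Fc] := H (r / 6) (divr_gt0 r0 (ltr0n _ 6)).
have HMc : holo_bounded F c (r * (5 / 6)) M.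
  by apply: (holo_bounded_sub HM); move: cp; lra.
apply/nbhsC2P; exists (r / 12); first by rewrite divr_gt0.
move=> q qp; apply: (holo_identity_ball HMc Fc).
have -> : q - c = (q - p) - (c - p) by rewrite opprB addrA subrK.
by apply: le_lt_trans (vnormD _ _) _; rewrite vnormN; move: qp cp; lra.
Qed.

(** At a point x of the closure, the local equations of A vanish on open sets arbitrarily close to
    x, hence near x by [holo_zero_extend]. So the interior is open and closed, and connectedness
    decides in [analytic_dense_compl]. *)
Lemma analytic_interior_closed (A : set X) : analytic_subset A -> closed A°.
Proof.
move=> anA x cx; have [U [k [g [[oU Ux] hg AU]]]] := anA x.
have [a ax] := chart_dom_cover x.
pose G i : C2 R -> C := g i \o chart_inv a; pose p := chart_map a x.
have oO := @chart_sub_open R X a U oU.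
have Op : (chart_map a @` (chart_dom a `&` U)) p by exists x.
have G0 i : nbhs p [set q | G i q = 0].
  apply: (holo_zero_extend oO Op (hg i a)) => r r0.
  have oW := @chart_preim_open a _ (@open_vball R p r).
  have Wx : (chart_dom a `&` chart_map a @^-1` vball p r) x.
    by split => //; exact: vball_center.
  have [y [Iy [Uy [ay yr]]]] : A° `&` (U `&` (chart_dom a `&` chart_map a @^-1` vball p r)) !=set0.
    by apply: cx; apply: open_nbhs_nbhs; split; [exact: openI|split].
  exists (chart_map a y) => //.
  have oI := @chart_sub_open R X a (A° `&` U) (openI (open_interior A) oU).
  have Iy' : (chart_map a @` (chart_dom a `&` (A° `&` U))) (chart_map a y) by exists y.
  apply: filterS (open_nbhs_nbhs (conj oI Iy')) => _ [z [az [Iz Uz]] <-].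
  rewrite /G /= chart_mapK//.
  have : (A `&` U) z by split => //; exact: interior_subset Iz.
  by rewrite AU => -[_]; exact.
have Gall : nbhs p [set q | forall i, G i q = 0] by exact: (@filter_forall _ _ (fun i q => G i q = 0) (nbhs p) _ G0).
have n1 : nbhs x (chart_map a @^-1` [set q | forall i, G i q = 0]) by exact: (chart_map_continuous ax Gall).
have n2 := open_nbhs_nbhs (conj (@chart_dom_open R X a) ax).
have n3 := open_nbhs_nbhs (conj oU Ux).
suff : nbhs x A by [].
apply: filterS (filterI (filterI n1 n2) n3) => y [[Gy ay] Uy].
have : (A `&` U) y.
  by rewrite AU; split => // i; have := Gy i; rewrite /G /= chart_mapK.
by case.
Qed.

Lemma analytic_dense_compl (A U : set X) : analytic_subset A -> A <> setT ->
  open U -> U !=set0 -> exists2 y, U y & ~ A y.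
Proof.
move=> anA AT oU [x Ux]; apply: contrapT => H.
have UA : U `<=` A.
  by move=> y Uy; apply: contrapT => Ay; apply: H; exists y.
have I0 : A° !=set0.
  by exists x; apply: filterS UA _; exact: open_nbhs_nbhs.
have K := @surface_connected R X _ I0.
apply: AT; apply/seteqP; split => // y _.
have : [set: X] y by [].
rewrite -K; [exact: interior_subset| |].
- by exists A°; [exact: open_interior|rewrite setTI].
- by exists A°; [exact: analytic_interior_closed|rewrite setTI].
Qed.

Lemma bracket_dz1dz2 q : brioschi_bracket (fun=> 0 : C) (fun=> 1 : C) (fun=> 0 : C) q = 0.
Proof.
have d1 (c : C) i p := (partial_cst c i p).2.
have d2 (c : C) i j : partial i (partial j (fun=> c)) q = 0.
  exact: etrans (partial_near i openT (I : setT q) (fun p _ => d1 c j p)) (d1 0 i q).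
apply: etrans (brioschiE _ _ _ _) _.
apply: etrans (brioschi_poly_congr (erefl _) (erefl _) (erefl _) (d1 _ _ _) (d1 _ _ _) (d1 _ _ _)
  (d1 _ _ _) (d1 _ _ _) (d1 _ _ _) (d2 _ _ _) (d2 _ _ _) (d2 _ _ _)) _.
by rewrite /brioschi_poly; ring.
Qed.

Lemma bracket_product (O : set (C2 R)) (F1 F2 a11 a12 a22 : C2 R -> C) q : open O -> O q ->
  holomorphic_on O F1 -> holomorphic_on O F2 ->
  (forall p, O p -> forall v, qform (a11 p) (a12 p) (a22 p) v = 'd F1 p v * 'd F2 p v) ->
  brioschi_bracket a11 a12 a22 q = 0.
Proof.
move=> oO Oq h1 h2 H.
have K p (Op : O p) : [/\ a11 p = partial z1 F1 p * partial z1 F2 p,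
    a12 p = partial z1 F1 p * partial z2 F2 p + partial z2 F1 p * partial z1 F2 p &
    a22 p = partial z2 F1 p * partial z2 F2 p].
  apply/qform_product => v; apply: etrans (H p Op v) _.
  exact: (congr2 (fun s t : C => s * t) (diff_partial v (h1 p Op)) (diff_partial v (h2 p Op))).
have hc (c : C) : holomorphic_on setT (fun=> c : C) by move=> p _; exact: differentiable_cst.
apply: etrans (@brioschi_pullback R O setT F1 F2 (fun=> 0) (fun=> 1) (fun=> 0) oO openT h1 h2 _
  (hc 0) (hc 1) (hc 0) a11 a12 a22 q Oq _ _ _) _; first by [].
- move=> p Op; have [-> _ _] := K p Op; rewrite /pull /tri /cmp.
  by move: (partial _ _ _) (partial _ _ _) => s t; field.
- move=> p Op; have [_ -> _] := K p Op; rewrite /pull /tri /cmp.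
  move: (partial z1 F1 p) (partial z2 F1 p) (partial z1 F2 p) (partial z2 F2 p) => s t m n.
  by field.
- move=> p Op; have [_ _ ->] := K p Op; rewrite /pull /tri /cmp.
  by move: (partial _ _ _) (partial _ _ _) => s t; field.
- exact: etrans (congr1 (fun c : C => c * _) (bracket_dz1dz2 _)) (mul0r _).
Qed.

Lemma exact_at_bracket om a y : exact_at om y -> chart_dom a y -> P2coef om a (chart_map a y) = 0.
Proof.
move=> [U [f1 [f2 [[oU Uy] h1 h2 H]]]] ay.
apply: (@bracket_product _ (f1 \o chart_inv a) (f2 \o chart_inv a) _ _ _ _ (@chart_sub_open R X a U oU)).
- by exists y.
- exact: h1.
- exact: h2.
- by move=> _ [z [az Uz] <-] v; exact: (H z a Uz az v).
Qed.

Lemma closed_P2_zero om : closed_differential om -> is_zero_section (P2 om).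
Proof.
move=> [A [anA AT H]] a _ [x ax <-]; apply: contrapT => /eqP nz.
have imx : chart_img a (chart_map a x) by exists x.
have [r r0 Hr] := holo_neq0 (@chart_img_open R X a) (@P2coef_holomorphic R X om a) imx nz.
have oW := @chart_preim_open a _ (@open_vball R (chart_map a x) r).
have [|y [ay yr] Ay] := analytic_dense_compl anA AT oW.
  by exists x; split => //; exact: vball_center.
by have [_ /eqP] := Hr _ yr; apply; exact: exact_at_bracket (H y Ay) ay.
Qed.

(** Exactness is tested in every chart, while [local_exact] works in the chart a. F1 and F2 are
    composed with [chart_map a], and [symdiff_compat] with the chain rule carries the equality to
    any chart b. *)
Lemma P2_zero_exact_at om a x : is_zero_section (P2 om) -> chart_dom a x ->
  det_loc (c11 om a) (c12 om a) (c22 om a) (chart_map a x) != 0 -> exact_at om x.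
Proof.
move=> z0 ax d0; have imx : chart_img a (chart_map a x) by exists x.
have [r [F1 [F2 [r0 H]]]] := local_exact (@chart_img_open R X a) imx (@c11_holomorphic R X om a)
  (@c12_holomorphic R X om a) (@c22_holomorphic R X om a) d0 (z0 a).
pose U := chart_dom a `&` chart_map a @^-1` vball (chart_map a x) r.
have oU : open U by apply: chart_preim_open; exact: open_vball.
have Ob b y : U y -> chart_dom b y -> overlap b a (chart_map b y) by move=> [ay _] bly; exists y.
have dT b y (Uy : U y) (bly : chart_dom b y) (F : C2 R -> C) : differentiable F (chart_map a y) ->
    differentiable (F \o transition b a) (chart_map b y) /\
    forall v, 'd (F \o transition b a) (chart_map b y) v =
      'd F (chart_map a y) ('d (transition b a) (chart_map b y) v).
  have d1 := transition_diff (Ob b y Uy bly).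
  rewrite -(transition_chart a bly) => d2; split; first exact: (differentiable_comp d1 d2).
  by move=> v; exact: (congr1 (fun k : C2 R -> C => k v) (diff_comp d1 d2)).
have hol (F : C2 R -> C) : (forall q, vball (chart_map a x) r q -> differentiable F q) ->
    holomorphic_fun U (F \o chart_map a).
  by move=> dF b _ [y [bly Uy] <-]; exact: (dT b y Uy bly F (dF _ Uy.2)).1.
exists U, (F1 \o chart_map a), (F2 \o chart_map a); split.
- by split => //; split => //; exact: vball_center.
- by apply: hol => q /H[].
- by apply: hol => q /H[].
- move=> y b Uy bly v; have [_ d1 d2 K] := H _ Uy.2.
  apply: etrans (symdiff_compat om bly Uy.1 v) _.
  apply: etrans ((qform_product _ _ _ _ _ _ _).2 K _) _.
  apply: etrans (congr2 (fun s t : C => s * t) (esym (diff_partial _ d1)) (esym (diff_partial _ d2))) _.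
  exact: (congr2 (fun s t : C => s * t) (esym ((dT b y Uy bly F1 d1).2 v)) (esym ((dT b y Uy bly F2 d2).2 v))).
Qed.

End SurfaceAnalysis.

End ClosedDifferentials.

(** * Rank, degeneracy and the determinant *)

Section Degeneracy.
Variable R : realType.
Local Notation C := (Cplx R).
Implicit Types (z w h d : C) (f g : C -> C).

Lemma hom_coord (l : 'Hom(C2 R, C)) v : l v = l (ei R z1) * v 0 z1 + l (ei R z2) * v 0 z2.
Proof.
apply: etrans (congr1 l (ei_decomp v)) _.
by rewrite linearD !linearZ /=; congr (_ + _); exact: mulrC.
Qed.

Lemma free_det (l1 l2 : 'Hom(C2 R, C)) : free [:: l1; l2] ->
  l1 (ei R z1) * l2 (ei R z2) - l1 (ei R z2) * l2 (ei R z1) != 0.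
Proof.
rewrite free_cons seq1_free span_seq1 => /andP[/vlineP nl l20]; apply: contra_notN nl => /eqP D.
have := hom_coord l1; have := hom_coord l2; move: D.
move: (l1 (ei R z1)) (l1 (ei R z2)) (l2 (ei R z1)) (l2 (ei R z2)) => p1 p2 q1 q2 D H2 H1.
have K (k : C) : p1 = k * q1 -> p2 = k * q2 -> exists k, l1 = k *: l2.
  move=> e1 e2; exists k; apply/lfunP => v; rewrite scale_lfunE H1 H2 e1 e2 /GRing.scale /=.
  by rewrite mulrDr !mulrA.
have [q10|q10] := eqVneq q1 0; last first.
  by apply: (K (p1 / q1)); [rewrite divfK|rewrite mulrAC (subr0_eq D) mulfK].
have q20 : q2 != 0.
  by apply: contraNneq l20 => q20; apply/eqP/lfunP => v; rewrite H2 q10 q20 lfunE /= !mul0r addr0.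
apply: (K (p2 / q2)); last by rewrite divfK.
by rewrite mulrAC -(subr0_eq D) mulfK.
Qed.

(** The determinant of a product of linear forms is - 1/4 times the square of their wedge, nonzero
    by [free_det]. *)
Lemma det_product (a11 a12 a22 : C2 R -> C) q (l1 l2 : 'Hom(C2 R, C)) : free [:: l1; l2] ->
  (forall v, qform (a11 q) (a12 q) (a22 q) v = l1 v * l2 v) -> det_loc a11 a12 a22 q != 0.
Proof.
move=> /free_det D H.
have [e1 e2 e3] : [/\ a11 q = l1 (ei R z1) * l2 (ei R z1),
    a12 q = l1 (ei R z1) * l2 (ei R z2) + l1 (ei R z2) * l2 (ei R z1) &
    a22 q = l1 (ei R z2) * l2 (ei R z2)].
  by apply/qform_product => v; rewrite H [l1 v]hom_coord [l2 v]hom_coord.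
have -> : det_loc a11 a12 a22 q =
    - (4^-1 * (l1 (ei R z1) * l2 (ei R z2) - l1 (ei R z2) * l2 (ei R z1)) ^+ 2).
  by rewrite /det_loc e1 e2 e3; move: (l1 _) (l1 _) (l2 _) (l2 _) => p1 p2 q1 q2; field.
by rewrite oppr_eq0 mulf_neq0 ?expf_neq0 // invr_eq0 pnatr_eq0.
Qed.

Lemma line_pick (L : {vspace C2 R}) : \dim L = 1%N ->
  [/\ vpick L \in L, vpick L != 0 & L = <[vpick L]>%VS].
Proof.
move=> L1; have L0 : vpick L != 0 by rewrite vpick0 -dimv_eq0 L1.
split => //; first exact: memv_pick.
by apply/esym/eqP; rewrite eqEdim -memvE memv_pick dim_vline L0 L1.
Qed.

Lemma lines_indep (L1 L2 : {vspace C2 R}) : \dim L1 = 1%N -> \dim L2 = 1%N -> L1 <> L2 ->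
  (vpick L1) 0 z1 * (vpick L2) 0 z2 - (vpick L1) 0 z2 * (vpick L2) 0 z1 != 0.
Proof.
move=> /line_pick[_ + E1] /line_pick[_ + E2] L12; rewrite E1 E2 in L12.
move: (vpick L1) (vpick L2) L12 => v1 v2 L12 v10 v20; apply: contra_notN L12 => /eqP D.
have [k v2k] : exists k : C, v2 = k *: v1.
  have K (k : C) : v2 0 z1 = k * v1 0 z1 -> v2 0 z2 = k * v1 0 z2 -> exists k : C, v2 = k *: v1.
    by move=> h1 h2; exists k; apply/rowP => i; rewrite mxE; have [->|->] := ord2P i.
  have [h0|h0] := eqVneq (v1 0 z1) 0; last first.
    by apply: (K (v2 0 z1 / v1 0 z1)); [rewrite divfK|rewrite mulrAC [v2 0 z1 * _]mulrC -(subr0_eq D) mulrAC divff ?mul1r].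
  have h1 : v1 0 z2 != 0.
    apply: contraNneq v10 => h1; apply/eqP/rowP => i; rewrite mxE.
    by have [->|->] := ord2P i.
  apply: (K (v2 0 z2 / v1 0 z2)); last by rewrite divfK.
  have : v1 0 z2 * v2 0 z1 = 0 by rewrite -(subr0_eq D) h0 mul0r.
  by move/eqP; rewrite mulf_eq0 (negPf h1) => /eqP ->; rewrite h0 mulr0.
apply/esym/eqP; rewrite eqEdim -memvE !dim_vline v10 v20 andbT; apply/vlineP.
by exists k.
Qed.

(* With q the quadratic form and B its polarization,
   B(v1, v2)^2 - 4 q(v1) q(v2) = - 4 det(q) (v1 /\ v2)^2. *)
Lemma qform_two_lines (a b c : C) (v1 v2 : C2 R) :
  a * c - 4^-1 * b ^+ 2 = 0 -> v1 0 z1 * v2 0 z2 - v1 0 z2 * v2 0 z1 != 0 ->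
  qform a b c v1 = 0 -> qform a b c v2 = 0 -> forall v, qform a b c v = 0.
Proof.
rewrite /qform => + + + + v; move: (v1 0 z1) (v1 0 z2) (v2 0 z1) (v2 0 z2) (v 0 z1) (v 0 z2).
move=> x1 y1 x2 y2 x y D J q1 q2.
pose B := 2 * a * x1 * x2 + b * (x1 * y2 + y1 * x2) + 2 * c * y1 * y2.
have B0 : B = 0.
  apply/eqP; rewrite -sqrf_eq0; apply/eqP.
  have -> : B ^+ 2 = 4 * (a * x1 ^+ 2 + b * (x1 * y1) + c * y1 ^+ 2) * (a * x2 ^+ 2 + b * (x2 * y2) + c * y2 ^+ 2)
      - 4 * (a * c - 4^-1 * b ^+ 2) * (x1 * y2 - y1 * x2) ^+ 2 by rewrite /B; field.
  by rewrite q1 D !mulr0 !mul0r subrr.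
have : (x1 * y2 - y1 * x2) ^+ 2 * (a * x ^+ 2 + b * (x * y) + c * y ^+ 2) =
    (x * y2 - y * x2) ^+ 2 * (a * x1 ^+ 2 + b * (x1 * y1) + c * y1 ^+ 2) +
    (x * y2 - y * x2) * (x1 * y - y1 * x) * B +
    (x1 * y - y1 * x) ^+ 2 * (a * x2 ^+ 2 + b * (x2 * y2) + c * y2 ^+ 2) by rewrite /B; ring.
rewrite q1 q2 B0 !mulr0 !addr0 => /eqP; rewrite mulf_eq0 sqrf_eq0 (negPf J) /=; exact/eqP.
Qed.

Section SurfaceDegeneracy.
Variable X : complex_surface R.
Implicit Types (a b : chart X) (x y : X) (om : symdiff X).

Definition det_chart om a : C2 R -> C := det_loc (c11 om a) (c12 om a) (c22 om a).

(** Off the locus, some chart shows a nonzero form that vanishes on two distinct lines; with zero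
    determinant, [qform_two_lines] would make it vanish identically. *)
Lemma nondegenerate_det om x : ~ degeneracy_locus om x ->
  exists2 a, chart_dom a x & det_chart om a (chart_map a x) != 0.
Proof.
move=> /existsNP[a /not_implyP[ax /not_orP[n0 /contrapT[L1 [L2 [[d1 i1] [d2 i2] L12]]]]]].
exists a => //; apply: contra_notN n0 => /eqP D v.
have [m1 _ _] := line_pick d1; have [m2 _ _] := line_pick d2.
exact: (qform_two_lines D (lines_indep d1 d2 L12) (i1 _ m1) (i2 _ m2)).
Qed.

(** The exceptional set for closedness. Being described by the holomorphic function det instead of
    lines, it is visibly analytic. *)
Definition det_zero_locus om : set X :=
  [set x | forall a, chart_dom a x -> det_chart om a (chart_map a x) = 0].

Lemma det_zero_locus_analytic om : analytic_subset (det_zero_locus om).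
Proof.
move=> x; have [b bx] := chart_dom_cover x.
exists (chart_dom b), 1%N, (fun _ y => det_chart om b (chart_map b y)); split.
- by split => //; exact: chart_dom_open.
- move=> _ a q Oq; have d1 := transition_diff Oq.
  have d2 : differentiable (det_chart om b) (transition a b q).
    by apply: det_loc_holo (transition_img Oq);
      [exact: c11_holomorphic|exact: c12_holomorphic|exact: c22_holomorphic].
  exact: (differentiable_comp d1 d2).
- apply/seteqP; split=> y /= [H1 H2]; split => //; first by move=> _; exact: H1.
  (* The determinant changes by the square of the Jacobian, so its vanishing in the chart b implies
     that in every chart. *)
  move=> a ay; have Oq : overlap a b (chart_map a y) by exists y.
  by rewrite /det_chart (det_loc_compat om Oq) transition_chart// [det_loc _ _ _ _](H2 ord0) mul0r.
Qed.

Lemma rank2_det_zero_locus om : rank2 om -> det_zero_locus om <> setT.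
Proof.
move=> [A [_ AT H]] E; apply: AT; apply/seteqP; split => // x _; apply: contrapT => Ax.
have [a ax] := chart_dom_cover x; have [l1 [l2 [fr K]]] := H x Ax a ax.
have : det_zero_locus om x by rewrite E.
by move=> /(_ a ax) /eqP; apply/negP; exact: det_product fr K.
Qed.

Lemma P2_zero_closed om : rank2 om -> is_zero_section (P2 om) -> closed_differential om.
Proof.
move=> rk z0; exists (det_zero_locus om); split.
- exact: det_zero_locus_analytic.
- exact: rank2_det_zero_locus.
- by move=> x /existsNP[a /not_implyP[ax /eqP d0]]; exact: P2_zero_exact_at z0 ax d0.
Qed.

End SurfaceDegeneracy.

End Degeneracy.

Theorem theorem2p1 (R : realType) (X : complex_surface R) :
  exists P2 : symdiff X -> pluricanonical X 4,
    is_P2_operator P2 /\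
    forall w : symdiff X, rank2 w ->
      (closed_differential w <-> is_zero_section (P2 w)) /\
      (is_zero_section (P2 w) ->
       closed_1st_kind_on w (~` degeneracy_locus w)).
Proof.
exists (@P2 R X); split; first exact: P2_is_P2_operator.
move=> w rk; split.
  by split; [exact: closed_P2_zero|exact: P2_zero_closed].
move=> z0 x /nondegenerate_det[a ax d0]; exact: P2_zero_exact_at z0 ax d0.
Qed.
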